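(* For $\alpha \geq \beta > -1$ we have $$\log\big( (\mathbb{EP}1)(\alpha, \beta\,; 1\,; 1)\big) = 2(\alpha - \beta)\log(\alpha +2) + \log \left(\frac{\beta +1}{\alpha +1}\right) + O\left( \left(\frac{(\alpha - \beta)(\alpha +2)}{(\alpha +1)}\right) \, \log \left( \frac {2(\alpha +1)(\alpha - \beta + 1)}{(\alpha - \beta)(\alpha +2)}\right)\right),$$ where the implied constant is universal (i.e. independent of $\alpha$ and $\beta$).
   Context: An entire function $f: \mathbb{C} \to \mathbb{C}$, not identically zero, has exponential type $\tau(f):= \limsup_{|z|\to \infty} |z|^{-1}\log|f(z)|$ if this is finite. For $\alpha>-1$, $\mathcal{H}_{\alpha}(1; 1)$ is the Hilbert space of entire functions $f:\mathbb{C}\to\mathbb{C}$ of exponential type at most $1$ (together with the zero function) such that $\int_{\mathbb{R}} |f(x)|^2 |x|^{2\alpha + 1}\,dx <\infty$. For $\alpha \geq \beta > -1$, $$(\mathbb{EP}1)(\alpha, \beta\,; 1\,; 1):= \inf_{ 0 \neq f \in \mathcal{H}_{\alpha}(1; 1) } \frac{\int_{\mathbb{R}} |f(x)|^2 \, |x|^{2\alpha + 1}\,dx}{\int_{\mathbb{R}} |f(x)|^2 \, |x|^{2\beta + 1}\,dx}.$$ The notation $X = Y + O(Z)$ (with $Z \geq 0$) means $|X - Y| \leq C Z$ for some constant $C$. When $\alpha=\beta$ the error term is understood by its limiting value $0$. *)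

(* Defs.v *)
From HB Require Import structures.
From mathcomp Require Import all_boot all_order all_algebra.
From mathcomp Require Import all_classical all_reals all_analysis.
From mathcomp Require Import complex.
Set Implicit Arguments.
Unset Strict Implicit.
Unset Printing Implicit Defensive.
Import Order.TTheory GRing.Theory Num.Theory.
Import numFieldNormedType.Exports.
Local Open Scope classical_set_scope.
Local Open Scope ring_scope.
Local Open Scope complex_scope.

(* R[i]^o is R[i] seen as a normed module over the field R[i] itself, so
   [derivable f z 1] is complex differentiability at z (the difference
   quotient is taken over complex increments). *)
Definition entire (R : realType) (f : R[i]^o -> R[i]^o) : Prop :=
  forall z : R[i]^o, derivable f z (1 : R[i]^o).

(* The limsup is over the filter generated by the sets |z| > r; lne is the
   extended logarithm, so zeros of f contribute -oo. *)
Definition exp_type (R : realType) (f : R[i]^o -> R[i]^o) : \bar R :=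
  limf_esup (fun z : R[i]^o => ((Normc.normc z)^-1)%:E * lne (Normc.normc (f z))%:E)%E
            (filter_from [set: R] (fun r => [set z | r < Normc.normc z])).

Definition weighted_sqnorm (R : realType) (a : R) (f : R[i]^o -> R[i]^o) :
    \bar R :=
  (\int[@lebesgue_measure R]_x
     (Normc.normc (f x%:C) ^+ 2 * `|x| `^ (2 * a + 1))%:E)%E.

(* The zero function is listed separately: its limsup is -oo, so it has no
   exponential type. *)
Definition in_H11 (R : realType) (a : R) (f : R[i]^o -> R[i]^o) : Prop :=
  [/\ entire f,
      f = (fun=> 0) \/ (exp_type f \is a fin_num /\ (exp_type f <= 1)%E)
    & (weighted_sqnorm a f < +oo)%E].

Definition EP1 (R : realType) (a b : R) : \bar R :=
  ereal_inf [set (weighted_sqnorm a f / weighted_sqnorm b f)%E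
            | f in [set f : R[i]^o -> R[i]^o | f <> (fun=> 0) /\ in_H11 a f]].

(* Main.v *)
(* Let N be the squared norm of f for the weight |x|^(2 alpha + 1).

   Lower bound. Split the integral with exponent beta at |x| = r = rho (alpha + 2). Outside,
   |x|^(2 beta + 1) <= r^(-2 (alpha - beta)) |x|^(2 alpha + 1). Inside, f is bounded pointwise by
   N: if n is the integer part of 2 alpha + 2, a primitive G of f(z)^2 z^n vanishing at 0 satisfies
   |G(x)| <= (1 + |x|) N on the real line, so Phragmen-Lindelof gives |G(z)| <= 4 N exp(7 |z| + 1),
   Cauchy's estimate bounds f(z)^2 z^n = G'(z), and the maximum principle on a square of size
   alpha + 2 divides out z^n. When alpha < 0 a Lipschitz bound at 0 improves the estimate by the
   factor alpha + 1. With L the logarithm of the error term,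
   rho = exp(- 124 L (alpha + 2) / (alpha + 1)) makes the inner part at most the error term; if
   alpha + 1 > 2 (beta + 1), the error term exceeds alpha + 2 up to constants and rho = 1/2 is enough.

   Upper bound. The test function is ((exp(i z / m) - 1) / (i z / m))^m with m about 2 (alpha + 2):
   on the real line it is at most min(1, (2 m / |x|)^m), and at least 2^(-m) for |x| <= m / 2.

   Circle integrals are increments of primitives of f(z + exp w) over a period of exp, the
   primitives come from Goursat's bisection, and Phragmen-Lindelof is proved on strips in the
   coordinate w = log z. *)

Require Import Defs.
From mathcomp Require Import all_boot all_order all_algebra.
From mathcomp Require Import all_classical all_reals all_analysis.
From mathcomp Require Import measurable_realfun complex ring lra.
Set Implicit Arguments.
Unset Strict Implicit.
Unset Printing Implicit Defensive.
Import Order.TTheory GRing.Theory Num.Theory.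
Import numFieldNormedType.Exports.
Local Open Scope ring_scope.
Local Open Scope complex_scope.
Notation normc := Normc.normc.
Notation Re := complex.Re.
Notation Im := complex.Im.

(** * Complex derivatives *)

Section ComplexCalculus.
Context {R : realType}.
Implicit Types (f g : R[i] -> R[i]) (z d : R[i]).

(** The estimates must stay uniform when alpha or beta approaches -1, tends to infinity, or when the
    two merge. Bounding the two norms separately loses a factor exp (O (alpha + 2)), which is
    harmless only if alpha + 2 is at most a multiple of the error term. Otherwise the two norms of
    the same f are compared, and only the part on one side of the splitting radius is estimated
    crudely. Moving that radius by a factor rho costs the power 2 (alpha - beta) of rho or 1 / rho
    in the compared part; the gain in the crude part has to overcome exp (O (alpha + 2)) and to
    leave at most (alpha - beta) (alpha + 2) / (alpha + 1). This is where the logarithm comes from.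
    Any constant in that exponential will do, so type at most 1 enters only as a bound O (exp (2
    |z|)).

    An integral norm bounds a primitive pointwise on the real line, f itself only afterwards; and
    |x|^(2 alpha + 1) is in general not the modulus of an entire function. Hence the primitive, the
    integer power z^n and the loss 1 + |x|. *)

Definition cder f z d := forall e : R, 0 < e ->
  exists2 r : R, 0 < r & forall h, normc h < r ->
    normc (f (z + h) - f z - d * h) <= e * normc h.

Definition rder (g : R -> R[i]) (t : R) d := forall e : R, 0 < e ->
  exists2 r : R, 0 < r & forall s, `|s| < r ->
    normc (g (t + s) - g t - d * s%:C) <= e * `|s|.

Lemma normc_ge0 z : 0 <= normc z.
Proof. by case: z => a b; rewrite /normc sqrtr_ge0. Qed.

Lemma normc_gt0 z : z != 0 -> 0 < normc z.
Proof.
by move=> z0; rewrite lt_neqAle normc_ge0 andbT eq_sym; apply: contra z0 => /eqP/Normc.eq0_normc ->.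
Qed.

Lemma normcR (x : R) : normc x%:C = `|x|.
Proof. by rewrite /normc /= expr0n addr0 sqrtr_sqr. Qed.

Lemma normr_normc z : `|z| = (normc z)%:C.
Proof. by []. Qed.

Lemma normcB z d : normc (z - d) <= normc z + normc d.
Proof. by rewrite -(normcN d); exact: le_normcD. Qed.

Lemma normcX z n : normc (z ^+ n) = normc z ^+ n.
Proof. by elim: n => [|n IH]; [rewrite !expr0 Normc.normc1|rewrite !exprS Normc.normcM IH]. Qed.

Lemma normc_distC z d : normc (z - d) = normc (d - z).
Proof. by rewrite -normcN opprB. Qed.

Lemma sqr_normcE z : normc z ^+ 2 = Re z ^+ 2 + Im z ^+ 2.
Proof. by case: z => a b; rewrite /normc sqr_sqrtr // addr_ge0 ?sqr_ge0. Qed.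

Lemma Re_le_normc z : `|Re z| <= normc z.
Proof.
rewrite -(@ler_pXn2r _ 2) ?nnegrE ?normc_ge0 // sqr_normcE real_normK ?num_real //.
by rewrite lerDl sqr_ge0.
Qed.

Lemma Im_le_normc z : `|Im z| <= normc z.
Proof.
rewrite -(@ler_pXn2r _ 2) ?nnegrE ?normc_ge0 // sqr_normcE real_normK ?num_real //.
by rewrite lerDr sqr_ge0.
Qed.

Lemma normc_le_ReIm z : normc z <= `|Re z| + `|Im z|.
Proof.
rewrite -(@ler_pXn2r _ 2) ?nnegrE ?normc_ge0 ?addr_ge0 // sqr_normcE.
rewrite -[X in X + _ <= _]real_normK ?num_real // -[X in _ + X <= _]real_normK ?num_real //.
have := normr_ge0 (Re z); have := normr_ge0 (Im z); nra.
Qed.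

(** A positive element of [R[i]] has imaginary part 0, so quantifying over real [e] and [r] in
    [cder] loses nothing. *)
Lemma cder_cvgP f z d : cder f z d <->
  ((fun h : R[i]^o => h^-1 *: ((f : R[i]^o -> R[i]^o) (h *: (1 : R[i]^o) + z) - f z)) x @[x --> 0^'] --> (d : R[i]^o))%classic.
Proof.
split.
  move=> H; apply/cvgrPdist_le => e e0.
  have [e1 e10 ee1] : exists2 e1 : R, 0 < e1 & e = e1%:C.
    move: e0; case: e => a b; rewrite ltcE /= => /andP[/eqP b0 a0]. by exists a; rewrite // b0.
  have [r r0 Hr] := H _ e10.
  near=> h.
  have h0 : h != 0 by near: h; exact: nbhs_dnbhs_neq.
  have hr : normc h < r.
    have : `|h| < r%:C by near: h; apply: dnbhs0_lt; rewrite ltcR.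
    by rewrite normr_normc ltcR.
  have := Hr _ hr.
  rewrite ee1 normr_normc lecR => Hh.
  have -> : d - h^-1 *: ((f : R[i]^o -> R[i]^o) (h *: (1 : R[i]^o) + z) - f z) = - h^-1 * (f (z + h) - f z - d * h).
    by rewrite /GRing.scale /= mulr1 (addrC h); field; exact: h0.
  rewrite Normc.normcM normcN Normc.normcV mulrC ler_pdivrMr //.
  exact: normc_gt0.
move=> /cvgrPdist_le H e e0.
have e0' : 0 < e%:C by rewrite ltcR.
case/nbhs_ballP: (H _ e0') => r0 /= r00 Hr.
have [r rp rr] : exists2 r : R, 0 < r & r0 = r%:C.
  by move: r00; case: {Hr} r0 => a b; rewrite ltcE /= => /andP[/eqP b0 a0]; exists a; rewrite // b0.
exists r => // h hr.
have [->|h0] := eqVneq h 0; first by rewrite addr0 mulr0 subrr subr0 Normc.normc0 mulr0.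
have hb : ball (0 : R[i]^o) r0 h by rewrite -ball_normE /ball_ /= sub0r normrN rr normr_normc ltcR.
have := Hr h hb h0.
have -> : d - h^-1 *: ((f : R[i]^o -> R[i]^o) (h *: (1 : R[i]^o) + z) - f z) = - h^-1 * (f (z + h) - f z - d * h).
  by rewrite /GRing.scale /= mulr1 (addrC h); field.
rewrite normr_normc lecR Normc.normcM normcN Normc.normcV mulrC ler_pdivrMr //.
by apply: normc_gt0.
Unshelve. all: by end_near.
Qed.

Lemma cderP f z d :
  cder f z d <-> is_derive (z : R[i]^o) (1 : R[i]^o) (f : R[i]^o -> R[i]^o) d.
Proof.
split.
  move=> /cder_cvgP H; apply: DeriveDef; first by apply/cvg_ex; exists d.
  exact: cvg_lim.
by move=> [D <-]; apply/cder_cvgP; exact: D.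
Qed.

Lemma cderD f g z a b : cder f z a -> cder g z b -> cder (fun w => f w + g w) z (a + b).
Proof. by move=> /cderP ? /cderP ?; apply/cderP; exact: is_deriveD. Qed.

Lemma cderM f g z a b : cder f z a -> cder g z b ->
  cder (fun w => f w * g w) z (a * g z + f z * b).
Proof.
move=> /cderP fa /cderP gb.
suff : is_derive (z : R[i]^o) (1 : R[i]^o) (fun w : R[i]^o => (f w * g w : R[i]^o)) (a * g z + f z * b) by move=> /cderP.
by have := is_deriveM fa gb; rewrite addrC [X in X + _]mulrC; exact.
Qed.

Lemma cder_comp f g z a b : cder g z a -> cder f (g z) b ->
  cder (fun w => f (g w)) z (b * a).
Proof.
move=> Hg Hf e e0.
have a0 : 0 < 1 + normc a by rewrite ltr_pwDl // normc_ge0.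
have b0 : 0 < 1 + normc b by rewrite ltr_pwDl // normc_ge0.
have e20 : 0 < e / 2 by rewrite divr_gt0.
have [r1 r10 H1] := Hf _ (divr_gt0 e20 a0).
have e30 : 0 < Num.min 1 (e / 2 / (1 + normc b)) by rewrite lt_min ltr01 divr_gt0.
have [r2 r20 H2] := Hg _ e30.
exists (Num.min r2 (r1 / (1 + normc a))) => [|h]; first by rewrite lt_min r20 divr_gt0.
rewrite lt_min => /andP[/H2 hr2]; rewrite ltr_pdivlMr // => hr1.
have h0 := normc_ge0 h.
set k := g (z + h) - g z in hr2.
have k1 : normc k <= (1 + normc a) * normc h.
  rewrite -[k](subrK (a * h)) (le_trans (le_normcD _ _)) // Normc.normcM mulrDl lerD2r.
  by apply: le_trans hr2 _; rewrite ler_wpM2r // ge_min lexx.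
have k2 : normc (k - a * h) <= e / 2 / (1 + normc b) * normc h.
  by apply: le_trans hr2 _; rewrite ler_wpM2r // ge_min lexx orbT.
have := H1 k; rewrite [g z + k]addrC subrK => /(_ (le_lt_trans k1 _)); rewrite mulrC => /(_ hr1) k3.
have -> : f (g (z + h)) - f (g z) - b * a * h = (f (g (z + h)) - f (g z) - b * k) + b * (k - a * h) by ring.
apply: le_trans (le_normcD _ _) _; rewrite [e]splitr mulrDl Normc.normcM lerD //.
  apply: le_trans k3 _; rewrite mulrC -ler_pdivlMr ?divr_gt0 //.
  apply: le_trans k1 _; rewrite le_eqVlt; apply/orP; left; apply/eqP.
  by field; rewrite !gt_eqF //; lra.
apply: le_trans (ler_wpM2l (normc_ge0 b) k2) _.
rewrite mulrA ler_wpM2r // mulrCA ger_pMr // ler_pdivrMr // mul1r lerDr //.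
Qed.

Lemma cder_cst c z : cder (fun=> c) z 0.
Proof.
by move=> e e0; exists 1 => // h _; rewrite subrr mul0r subr0 Normc.normc0 mulr_ge0 ?normc_ge0 // ltW.
Qed.

Lemma cder_id z : cder id z 1.
Proof.
move=> e e0; exists 1 => // h _; have -> : id (z + h) - id z - 1 * h = 0 by rewrite /=; ring.
rewrite Normc.normc0.
by rewrite mulr_ge0 ?normc_ge0 // ltW.
Qed.

Lemma cder_eq f z a b : cder f z a -> a = b -> cder f z b.
Proof. by move=> ? <-. Qed.

Lemma cder_ext f g z a : (forall w, f w = g w) -> cder f z a -> cder g z a.
Proof. by move=> fg; have -> : g = f by apply/funext. Qed.

Lemma cderMl c f z a : cder f z a -> cder (fun w => c * f w) z (c * a).
Proof. by move=> fa; apply: cder_eq (cderM (cder_cst c z) fa) _; rewrite mul0r add0r. Qed.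

Lemma cderB f g z a b : cder f z a -> cder g z b -> cder (fun w => f w - g w) z (a - b).
Proof.
move=> fa /(cderMl (-1)) gb; apply: cder_ext (cder_eq (cderD fa gb) _); last by rewrite mulN1r.
by move=> w; rewrite mulN1r.
Qed.

Lemma cderX f z a n : cder f z a -> cder (fun w => f w ^+ n) z (n%:R * f z ^+ n.-1 * a).
Proof.
move=> fa; elim: n => [|n IH]; first by apply: cder_eq (cder_cst 1 z) _; rewrite !mul0r.
apply: cder_ext (cder_eq (cderM fa IH) _) => [w|/=]; first by rewrite exprS.
by case: n {IH} => [|n] /=; rewrite ?exprS -?natr1; ring.
Qed.

Lemma cder_near f g z a (r : R) : 0 < r -> (forall h, normc h < r -> f (z + h) = g (z + h)) ->
  cder g z a -> cder f z a.
Proof.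
move=> r0 fg ga e e0; have [r1 r10 H] := ga e e0.
exists (Num.min r r1) => [|h]; first by rewrite lt_min r0 r10.
rewrite lt_min => /andP[hr hr1]; rewrite fg //.
have -> : f z = g z by rewrite -[z]addr0 fg // Normc.normc0.
exact: H.
Qed.

Lemma cderV f z a : f z != 0 -> cder f z a -> cder (fun w => (f w)^-1) z (- a / f z ^+ 2).
Proof.
move=> fz /cderP[D <-]; apply/cderP; apply: (@DeriveDef _ R[i]^o R[i]^o z 1 (fun w => (f w)^-1) _); first exact: derivableV.
by rewrite deriveV // /GRing.scale /= !mulNr mulrC.
Qed.

Lemma cder_cont f z a : cder f z a -> forall e : R, 0 < e ->
  exists2 r : R, 0 < r & forall h, normc h < r -> normc (f (z + h) - f z) < e.
Proof.
move=> H e e0; have [r r0 Hr] := H 1 ltr01.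
have M0 : 0 < 1 + normc a by rewrite ltr_pwDl // normc_ge0.
exists (Num.min r (e / (1 + normc a))) => [|h]; first by rewrite lt_min r0 divr_gt0.
rewrite lt_min => /andP[hr]; rewrite ltr_pdivlMr // => he.
apply: le_lt_trans he.
rewrite -[f (z + h) - f z](subrK (a * h)) (le_trans (le_normcD _ _)) //.
by rewrite Normc.normcM [leRHS]mulrC mulrDl lerD2r Hr.
Qed.

End ComplexCalculus.

(** * Curves in the complex plane and the mean value inequality *)

Section Curves.
Context {R : realType}.
Implicit Types (f : R[i] -> R[i]) (g : R -> R[i]) (z d : R[i]).

Lemma realderP (p : R -> R) (t d : R) : is_derive t 1 p d <->
  forall e : R, 0 < e -> exists2 r : R, 0 < r & forall s, `|s| < r -> `|p (t + s) - p t - d * s| <= e * `|s|.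
Proof.
split.
  move=> [D E] e e0; move: D E => /cvg_ex[l /= Hl]; rewrite /derive (cvg_lim _ Hl) // => ld.
  rewrite ld in Hl; move/cvgrPdist_le : Hl => /(_ e e0) /nbhs_ballP[r /= r0 Hr].
  exists r => // s sr; have [->|s0] := eqVneq s 0; first by rewrite addr0 mulr0 subrr subr0 normr0 mulr0.
  have hb : ball (0 : R) r s by rewrite /ball /= sub0r normrN.
  have := Hr s hb s0; rewrite mulrC -ler_pdivrMr ?normr_gt0 // -normfV -normrM distrC.
  by congr (`|_| <= _); rewrite /GRing.scale /= mulr1 (addrC s); field.
move=> H; have Hc : ((s^-1 *: (p (s *: 1 + t) - p t)) @[s --> 0^'] --> d)%classic.
  apply/cvgrPdist_le => e e0; have [r r0 Hr] := H e e0.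
  near=> s; have s0 : s != 0 by near: s; exact: nbhs_dnbhs_neq.
  have sr : `|s| < r by near: s; exact: dnbhs0_lt.
  have := Hr s sr; rewrite -ler_pdivrMr ?normr_gt0 // -normfV -normrM distrC.
  by congr (`|_| <= _); rewrite /GRing.scale /= mulr1 (addrC s); field.
by apply: DeriveDef; [apply/cvg_ex; exists d|exact: cvg_lim].
Unshelve. all: by end_near.
Qed.

Lemma rderP g t d : rder g t d <->
  is_derive t 1 (fun s => Re (g s)) (Re d) /\ is_derive t 1 (fun s => Im (g s)) (Im d).
Proof.
have E1 s : Re (g (t + s) - g t - d * s%:C) = Re (g (t + s)) - Re (g t) - Re d * s.
  by case: (g (t + s)) (g t) (d) => [? ?] [? ?] [? ?] /=; ring.
have E2 s : Im (g (t + s) - g t - d * s%:C) = Im (g (t + s)) - Im (g t) - Im d * s.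
  by case: (g (t + s)) (g t) (d) => [? ?] [? ?] [? ?] /=; ring.
split.
  move=> H; split; apply/realderP => e e0; have [r r0 Hr] := H e e0; exists r => // s /Hr;
   apply: le_trans; [rewrite -E1; exact: Re_le_normc|rewrite -E2; exact: Im_le_normc].
move=> [/realderP H1 /realderP H2] e e0.
have e20 : 0 < e / 2 by rewrite divr_gt0.
have [r1 r10 Hr1] := H1 _ e20; have [r2 r20 Hr2] := H2 _ e20.
exists (Num.min r1 r2) => [|s]; first by rewrite lt_min r10 r20.
rewrite lt_min => /andP[/Hr1 A /Hr2 B]; apply: le_trans (normc_le_ReIm _) _.
by rewrite E1 E2 [e]splitr mulrDl lerD.
Qed.

Lemma cder_line f z v d (t : R) : cder f (z + t%:C * v) d ->
  rder (fun s => f (z + s%:C * v)) t (d * v).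
Proof.
move=> H e e0; have M0 : 0 < 1 + normc v by rewrite ltr_pwDl // normc_ge0.
have e10 : 0 < e / (1 + normc v) by rewrite divr_gt0.
have [r r0 Hr] := H _ e10; exists (r / (1 + normc v)) => [|s]; first by rewrite divr_gt0.
rewrite ltr_pdivlMr // => sr.
have vs : normc (s%:C * v) = `|s| * normc v by rewrite Normc.normcM normcR.
have := Hr (s%:C * v); rewrite vs.
have -> : z + t%:C * v + s%:C * v = z + (t + s)%:C * v by rewrite rmorphD /=; ring.
have -> : d * (s%:C * v) = d * v * s%:C by ring.
have h1 : `|s| * normc v <= `|s| * (1 + normc v) by rewrite ler_wpM2l // lerDr.
move=> /(_ (le_lt_trans h1 sr)) h; apply: le_trans h _.
have -> : e / (1 + normc v) * (`|s| * normc v) = e * `|s| * (normc v / (1 + normc v)) by ring.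
by rewrite ler_piMr ?mulr_ge0 // ?(ltW e0) // ler_pdivrMr // mul1r lerDr.
Qed.

Lemma rderD g1 g2 t a b : rder g1 t a -> rder g2 t b -> rder (fun s => g1 s + g2 s) t (a + b).
Proof.
move=> H1 H2 e e0; have e20 : 0 < e / 2 by rewrite divr_gt0.
have [r1 r10 Hr1] := H1 _ e20; have [r2 r20 Hr2] := H2 _ e20.
exists (Num.min r1 r2) => [|s]; first by rewrite lt_min r10 r20.
rewrite lt_min => /andP[/Hr1 A /Hr2 B].
have -> : g1 (t + s) + g2 (t + s) - (g1 t + g2 t) - (a + b) * s%:C =
  (g1 (t + s) - g1 t - a * s%:C) + (g2 (t + s) - g2 t - b * s%:C) by ring.
by apply: le_trans (le_normcD _ _) _; rewrite [e]splitr mulrDl lerD.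
Qed.

Lemma rderMl c g t a : rder g t a -> rder (fun s => c * g s) t (c * a).
Proof.
move=> H e e0; have M0 : 0 < 1 + normc c by rewrite ltr_pwDl // normc_ge0.
have e10 : 0 < e / (1 + normc c) by rewrite divr_gt0.
have [r r0 Hr] := H _ e10; exists r => // s /Hr h.
have -> : c * g (t + s) - c * g t - c * a * s%:C = c * (g (t + s) - g t - a * s%:C) by ring.
rewrite Normc.normcM; apply: le_trans (ler_wpM2l (normc_ge0 c) h) _.
have -> : normc c * (e / (1 + normc c) * `|s|) = e * `|s| * (normc c / (1 + normc c)) by ring.
by rewrite ler_piMr ?mulr_ge0 // ?(ltW e0) // ler_pdivrMr // mul1r lerDr.
Qed.

Lemma rder_Re_le g g' (a b M : R) : a <= b ->
  (forall t, a <= t <= b -> rder g t (g' t) /\ Re (g' t) <= M) ->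
  Re (g b - g a) <= M * (b - a).
Proof.
move=> ab H.
have := @MVT_segment R (fun s => Re (g s)) (fun s => Re (g' s)) a b ab.
case.
- by move=> x /subset_itv_oo_cc; rewrite in_itv /= => /H[/rderP[]].
- apply: derivable_within_continuous => x; rewrite in_itv /= => /H[/rderP[[]]] //.
move=> c; rewrite in_itv /= => /H[_ cM].
have -> : Re (g b - g a) = Re (g b) - Re (g a) by case: (g b) (g a) => [? ?] [? ?].
by move=> ->; rewrite ler_wpM2r // subr_ge0.
Qed.

(** The mean value theorem is only available for real functions. Multiplying [g] by the conjugate of
    the increment [w] turns the increment into [normc w ^+ 2], so that a bound on real parts
    suffices. *)
Lemma rder_le g g' (a b M : R) : a <= b ->
  (forall t, a <= t <= b -> rder g t (g' t) /\ normc (g' t) <= M) ->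
  normc (g b - g a) <= M * (b - a).
Proof.
move=> ab H; set w := g b - g a.
have [->|w0] := eqVneq w 0.
  rewrite Normc.normc0 mulr_ge0 ?subr_ge0 //.
  by have [|_] := H a; [rewrite lexx|apply: le_trans; exact: normc_ge0].
have nw : 0 < normc w by apply: normc_gt0.
have ww : conjc w * w = (normc w ^+ 2)%:C.
  by rewrite sqr_normcE; case: (w) => x y /=; simpc; congr (_ +i* _); ring.
have := @rder_Re_le (fun t => conjc w * g t) (fun t => conjc w * g' t) a b (normc w * M) ab.
have -> : Re (conjc w * g b - conjc w * g a) = normc w ^+ 2 by rewrite -mulrBr -/w ww.
have -> : normc w * M * (b - a) = normc w * (M * (b - a)) by ring.
rewrite expr2 ler_pM2l //; apply => t /H[h1 h2]; split; first exact: rderMl.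
apply: le_trans (ler_norm _) _; apply: le_trans (Re_le_normc _) _.
rewrite Normc.normcM; have -> : normc (conjc w) = normc w by case: (w) => x y; rewrite /normc /= sqrrN.
by rewrite ler_pM2l.
Qed.

Lemma cder_le f f' z v (M : R) :
  (forall t, 0 <= t <= 1 -> cder f (z + t%:C * v) (f' (z + t%:C * v)) /\ normc (f' (z + t%:C * v)) <= M) ->
  normc (f (z + v) - f z) <= M * normc v.
Proof.
move=> H; have := @rder_le (fun t => f (z + t%:C * v)) (fun t => f' (z + t%:C * v) * v) 0 1 (M * normc v) ler01.
rewrite mul1r mul0r addr0 subr0 mulr1; apply => t /H[h1 h2]; split; first exact: cder_line.
by rewrite Normc.normcM ler_wpM2r ?normc_ge0.
Qed.

End Curves.

(** * Primitives of continuous functions of a real variable *)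

Section Primitives.
Context {R : realType}.
Notation mu := (@lebesgue_measure R).

Lemma continuous_primitive (p : R -> R) : continuous p ->
  exists P : R -> R, forall x : R, is_derive x 1 P (p x).
Proof.
move=> cp.
(* Starting the integral at - (|x| + 1) lets one formula cover both signs of x; near a
   given x, moving this end point does not change the increment from 0. *)
have ip a b : mu.-integrable `[a, b]%classic (EFin \o p).
  by apply: continuous_compact_integrable; [exact: segment_compact|exact: continuous_subspaceT].
pose I a b := (\int[mu]_(t in `[a, b]) p t)%R.
have Ichasles a b c : a <= b -> b <= c -> I a c = I a b + I b c.
  move=> ab bc; apply/eqP; rewrite addrC -subr_eq; apply/eqP.
  rewrite /I (@Rintegral_itvB _ p (BLeft a) (BRight c) b) ?bnd_simp //.
  apply: Rintegral_itv_obnd_cbnd.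
  by apply: integrableS (ip b c) => //; exact: subset_itv_oc_cc.
exists (fun x => I (- (`|x| + 1)) x - I (- (`|x| + 1)) 0) => x.
set M := `|x| + 2.
have E y : `|y - x| < 1 -> I (- (`|y| + 1)) y - I (- (`|y| + 1)) 0 = I (- M) y - I (- M) 0.
  move=> yx; have h1 : `|y| + 1 <= M.
    by rewrite /M; have := ler_normD (y - x) x; rewrite subrK; lra.
  have h2 : - M <= - (`|y| + 1) by rewrite lerN2.
  have h3 := normr_ge0 y.
  rewrite (Ichasles _ _ y h2) ?(Ichasles _ _ 0 h2); [ring| |].
    by lra.
  by have := ler_norm (- y); rewrite normrN; lra.
have h1 : x < x + 1 by lra.
have h2 : - M < x by rewrite /M; have := ler_norm (- x); rewrite normrN; lra.
clearbody M.
have [D1 D2] := @continuous_FTC1_closed R p (- M) x (x + 1) h1 (ip _ _) h2 (cp x).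
have H : is_derive x 1 (fun y => I (- M) y - I (- M) 0) (p x).
  have H1 : is_derive x 1 (I (- M)) (p x) by apply: DeriveDef; [exact: D1|rewrite -derive1E; exact: D2].
  have := is_deriveB H1 (is_derive_cst (I (- M) 0) x 1); rewrite subr0; exact.
apply/realderP => e e0; move/realderP : H => /(_ e e0)[r r0 Hr].
exists (Num.min r 1) => [|s]; first by rewrite lt_min r0 ltr01.
rewrite lt_min => /andP[/Hr h s1]; rewrite (E (x + s)) ?(E x) ?subrr ?normr0 //.
by rewrite addrC addKr.
Qed.

Lemma curve_primitive (g : R -> R[i]) :
  (forall t e : R, 0 < e -> exists2 r : R, 0 < r & forall s, `|s| < r -> normc (g (t + s) - g t) < e) ->
  exists G : R -> R[i], forall t, rder G t (g t).
Proof.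
move=> cg.
have cRe : continuous (fun t => Re (g t)).
  move=> t; apply/cvgrPdist_lt => e e0; have [r r0 Hr] := cg t e e0.
  apply/nbhs_ballP; exists r => //= s; rewrite /ball /= distrC => sr.
  have := Hr (s - t) sr; rewrite (_ : t + (s - t) = s); last by ring.
  apply: le_lt_trans.
  by rewrite distrC; case: (g s) (g t) => a b [c d]; exact: (Re_le_normc ((a - c) +i* (b - d))).
have cIm : continuous (fun t => Im (g t)).
  move=> t; apply/cvgrPdist_lt => e e0; have [r r0 Hr] := cg t e e0.
  apply/nbhs_ballP; exists r => //= s; rewrite /ball /= distrC => sr.
  have := Hr (s - t) sr; rewrite (_ : t + (s - t) = s); last by ring.
  apply: le_lt_trans.
  by rewrite distrC; case: (g s) (g t) => a b [c d]; exact: (Im_le_normc ((a - c) +i* (b - d))).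
have [P1 H1] := continuous_primitive cRe; have [P2 H2] := continuous_primitive cIm.
by exists (fun t => P1 t +i* P2 t) => t; apply/rderP; split; [exact: H1|exact: H2].
Qed.
End Primitives.

(** * The complex exponential *)

Section ComplexExp.
Context {R : realType}.
Implicit Types (z w : R[i]).

Definition cexp z : R[i] := (expR (Re z) * cos (Im z)) +i* (expR (Re z) * sin (Im z)).

Lemma cexpD z w : cexp (z + w) = cexp z * cexp w.
Proof.
case: z w => a b [c d]; rewrite /cexp /= expRD cosD sinD; simpc.
by congr (_ +i* _); ring.
Qed.

Lemma cexp0 : cexp 0 = 1.
Proof. by rewrite /cexp /= expR0 cos0 sin0 mulr1 mulr0. Qed.

Lemma normc_cexp z : normc (cexp z) = expR (Re z).
Proof.
rewrite /normc /= !exprMn -mulrDr cos2Dsin2 mulr1 sqrtr_sqr ger0_norm //.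
Qed.

Lemma cexp_period z : cexp (z + 0 +i* (2 * pi)) = cexp z.
Proof.
by case: z => a b; rewrite /cexp /= addr0 mulr_natl cosD2pi sinD2pi.
Qed.

Lemma cder_cexp z : cder cexp z (cexp z).
Proof.
(* By the addition formula only the derivative at 0 has to be computed. *)
suff H : cder cexp 0 1.
  have H1 : cder (fun w => w - z) z (1 - 0) by apply: cderB; [exact: cder_id|exact: cder_cst].
  have H2 : cder cexp (z - z) 1 by rewrite subrr.
  have := cderMl (cexp z) (cder_comp H1 H2); rewrite subr0 !mulr1.
  by apply: cder_ext => w; rewrite -cexpD addrC subrK.
move=> e e0.
have e40 : 0 < e / 8 by rewrite divr_gt0.
have /realderP/(_ _ e40)[r1 r10 H1] := is_derive_expR (0:R).
have /realderP/(_ _ e40)[r2 r20 H2] := is_derive_cos (0:R).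
have /realderP/(_ _ e40)[r3 r30 H3] := is_derive_sin (0:R).
rewrite expR0 in H1; rewrite sin0 cos0 in H2; rewrite sin0 cos0 in H3.
have /realderP/(_ _ ltr01)[r5 r50 H5] := is_derive_sin (0:R).
(* [ln 2] gives [expR a <= 2]; [r5] gives |sin b - b| <= |b|, whence |sin b| <= 2 |b| <= e / 8 by
   the bound [e / 16]. *)
pose r4 := Num.min (ln 2) (Num.min (e / 16) r5) : R.
have ln2 : 0 < ln (2 : R) by rewrite ln_gt0 // ltr1n.
have r40 : 0 < r4 by rewrite !lt_min ln2 r50 !divr_gt0.
rewrite sin0 cos0 in H5.
exists (Num.min (Num.min r1 r2) (Num.min r3 r4)); first by rewrite 3!lt_min r10 r20 r30 r40.
case=> a b; rewrite 3!lt_min => /andP[/andP[h1 h2] /andP[h3 h4]].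
set h := a +i* b in h1 h2 h3 h4 *.
have ha : `|a| <= normc h := Re_le_normc h.
have hb : `|b| <= normc h := Im_le_normc h.
have := H1 a (le_lt_trans ha h1); have := H2 b (le_lt_trans hb h2); have := H3 b (le_lt_trans hb h3).
rewrite !add0r !mul1r oppr0 mul0r !subr0 => K3 K2 K1.
move: h4; rewrite !lt_min => /andP[h4 /andP[h5 h6]].
have := H5 b (le_lt_trans hb h6); rewrite !add0r !mul1r subr0 => K5.
have ea2 : expR a <= 2.
  rewrite -[leRHS]lnK ?posrE // ler_expR; apply: ltW; apply: le_lt_trans (ler_norm _) _.
  exact: le_lt_trans ha h4.
rewrite cexp0; rewrite addr0 in K3.
apply: le_trans (normc_le_ReIm _) _.
have e1 : Re (cexp h - 1 - h) = (expR a - 1 - a) + expR a * (cos b - 1) by rewrite /cexp /=; ring.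
have e2 : Im (cexp h - 1 - h) = (sin b - b) + (expR a - 1) * sin b by rewrite /cexp /=; ring.
rewrite e1 e2.
have nh := normc_ge0 h; have na := normr_ge0 a; have nb := normr_ge0 b.
have ea0 : 0 <= expR a by exact: expR_ge0.
have t1 : `|expR a * (cos b - 1)| <= 2 * (e / 8 * `|b|) by rewrite normrM ger0_norm // ler_pM.
have t2 : `|(expR a - 1) * sin b| <= e / 8 * `|a| + `|a| * (e / 8).
  have -> : (expR a - 1) * sin b = (expR a - 1 - a) * sin b + a * sin b by ring.
  apply: le_trans (ler_normD _ _) _; rewrite !normrM lerD //.
    rewrite -[leRHS]mulr1; apply: ler_pM => //.
    by rewrite ler_norml sin_geN1 sin_le1.
  apply: ler_wpM2l => //.
  have -> : sin b = (sin b - b) + b by rewrite subrK.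
  apply: le_trans (ler_normD _ _) _.
lra.
have m1 : e * `|a| <= e * normc h by rewrite ler_wpM2l // ltW.
have m2 : e * `|b| <= e * normc h by rewrite ler_wpM2l // ltW.
have m3 : 0 <= e * normc h by rewrite mulr_ge0 // ltW.
apply: le_trans (lerD (ler_normD _ _) (ler_normD _ _)) _; lra.
Qed.

Lemma cder_cexp_comp (g : R[i] -> R[i]) z a : cder g z a -> cder (fun w => cexp (g w)) z (cexp (g z) * a).
Proof. by move=> ga; exact: cder_comp ga (cder_cexp _). Qed.

Lemma Re_le_norm (z : R[i]) : Re z <= normc z.
Proof. exact: le_trans (ler_norm _) (Re_le_normc z). Qed.

Let seg_le z (t : R) : 0 <= t <= 1 -> normc (0 + t%:C * z) <= normc z.
Proof.
by move=> /andP[t0 t1]; rewrite add0r Normc.normcM normcR ger0_norm // ler_piMl ?normc_ge0.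
Qed.

(** First of three Taylor remainders: each one has the previous one as derivative and vanishes at 0,
    so [cder_le] on the segment from 0 to [z] gains one factor [normc z]. *)
Lemma cexp_sub1_le z : normc (cexp z - 1) <= normc z * expR (normc z).
Proof.
rewrite -{1}[z]add0r -cexp0 mulrC; apply: (@cder_le _ _ cexp) => t t01; split; first exact: cder_cexp.
by rewrite normc_cexp ler_expR (le_trans (Re_le_norm _)) ?seg_le.
Qed.

Lemma cexp_sub2_le z : normc (cexp z - 1 - z) <= normc z ^+ 2 * expR (normc z).
Proof.
have -> : normc z ^+ 2 * expR (normc z) = normc z * expR (normc z) * normc z by ring.
have := @cder_le R (fun w => cexp w - 1 - w) (fun w => cexp w - 0 - 1) 0 z (normc z * expR (normc z)).
rewrite add0r cexp0 subrr !subr0; apply => t t01; split.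
  by apply: cderB; [apply: cderB; [exact: cder_cexp|exact: cder_cst]|exact: cder_id].
rewrite subr0; apply: le_trans (cexp_sub1_le _) _.
by apply: ler_pM; rewrite ?normc_ge0 ?expR_ge0 ?ler_expR ?seg_le.
Qed.

Lemma cexp_sub3_le z : normc (cexp z - 1 - z - z ^+ 2 / 2) <= normc z ^+ 3 * expR (normc z).
Proof.
have -> : normc z ^+ 3 * expR (normc z) = normc z ^+ 2 * expR (normc z) * normc z by ring.
have := @cder_le R (fun w => cexp w - 1 - w - 2^-1 * w ^+ 2) (fun w => cexp w - 0 - 1 - 2^-1 * (2%:R * w ^+ 1 * 1)) 0 z (normc z ^+ 2 * expR (normc z)).
rewrite add0r cexp0 subrr !subr0 expr0n mulr0 subr0 [2^-1 * z ^+ 2]mulrC subr0; apply => t t01; split.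
  apply: cderB; last by apply: cderMl; apply: (@cderX _ id); exact: cder_id.
  by apply: cderB; [apply: cderB; [exact: cder_cexp|exact: cder_cst]|exact: cder_id].
rewrite subr0 mulr1 expr1 mulrA mulVf ?pnatr_eq0 // mul1r.
apply: le_trans (cexp_sub2_le _) _.
apply: ler_pM; rewrite ?exprn_ge0 ?normc_ge0 ?expR_ge0 ?ler_expR ?seg_le //.
by rewrite lerXn2r ?nnegrE ?normc_ge0 ?seg_le.
Qed.
End ComplexExp.

(** * Primitives of entire functions *)

Section Goursat.
Context {R : realType}.
Implicit Types (f : R[i] -> R[i]) (g : R -> R[i]) (z d : R[i]).

Definition holo f := forall z, exists d, cder f z d.

Lemma rder_ext g1 g2 (t : R) d : (forall s, g1 s = g2 s) -> rder g1 t d -> rder g2 t d.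
Proof. by move=> E; have -> : g2 = g1 by apply/funext. Qed.

Lemma rder_eq g (t : R) d1 d2 : rder g t d1 -> d1 = d2 -> rder g t d2.
Proof. by move=> ? <-. Qed.

Lemma rderB g1 g2 (t : R) a b : rder g1 t a -> rder g2 t b -> rder (fun s => g1 s - g2 s) t (a - b).
Proof.
move=> h1 /(rderMl (-1)) h2; apply: rder_ext (rder_eq (rderD h1 h2) _) => [s|]; by rewrite mulN1r.
Qed.

Lemma cder_horizontal f (x y : R) d : cder f (x +i* y) d -> rder (fun t => f (t +i* y)) x d.
Proof.
have E (t : R) : (0 +i* y) + t%:C * 1 = t +i* y by simpc.
rewrite -{1}E => /cder_line; rewrite mulr1; apply: rder_ext => s; by rewrite E.
Qed.

Lemma cder_vertical f (x y : R) d : cder f (x +i* y) d ->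
  rder (fun t => f (x +i* t)) y ((0 +i* 1) * d).
Proof.
have E (t : R) : (x +i* 0) + t%:C * (0 +i* 1) = x +i* t by simpc.
rewrite -{1}E => /cder_line; rewrite mulrC; apply: rder_ext => s; by rewrite E.
Qed.

Lemma rder_le_dist g g' (a b M : R) :
  (forall t, `|t - a| <= `|b - a| -> rder g t (g' t) /\ normc (g' t) <= M) ->
  normc (g b - g a) <= M * `|b - a|.
Proof.
move=> H; have [ab|ba] := leP a b.
  rewrite ger0_norm ?subr_ge0 //; apply: (@rder_le _ g g') => // t /andP[t1 t2]; apply: H.
  by rewrite !ger0_norm ?subr_ge0 // lerD2r.
rewrite normc_distC distrC ger0_norm ?subr_ge0 ?(ltW ba) //; apply: (@rder_le _ g g') => // [|t /andP[t1 t2]].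
  exact: ltW.
by apply: H; rewrite distrC (distrC b) !ger0_norm ?subr_ge0 // ?(ltW ba) // lerD2l lerN2.
Qed.

Lemma nested_interval (u w : nat -> R) : (forall n, u n <= u n.+1) -> (forall n, w n.+1 <= w n) ->
  (forall n, u n <= w n) -> exists X, forall n, u n <= X <= w n.
Proof.
move=> hu hw huw.
have uM m n : (m <= n)%N -> u m <= u n.
  by move=> /subnK <-; elim: (n - m)%N => // k IH; rewrite addSn; exact: le_trans (hu _).
have wM m n : (m <= n)%N -> w n <= w m.
  by move=> /subnK <-; elim: (n - m)%N => // k IH; rewrite addSn; exact: le_trans (hw _) IH.
have uw m n : u m <= w n.
  apply: le_trans (uM m (maxn m n) (leq_maxl _ _)) _; apply: le_trans (huw _) _; exact: wM (leq_maxr _ _).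
exists (sup (range u)) => n; apply/andP; split.
  by apply: ub_le_sup; [exists (w 0%N) => _ [m _ <-]|exists n].
by apply: ge_sup; [exists (u 0%N), 0%N|move=> _ [m _ <-]].
Qed.

Section Rectangle.
Variables (h : R[i] -> R[i]) (H V : R -> R -> R[i]).
Hypothesis hh : holo h.
Hypothesis HH : forall x y, rder (H y) x (h (x +i* y)).
Hypothesis HV : forall x y, rder (V x) y (h (x +i* y)).

(* H y and V x are primitives of h on the horizontal and the vertical lines, so J stands
   for the contour integral of h around a rectangle. *)
Let ii : R[i] := 0 +i* 1.
Let J x1 x2 y1 y2 : R[i] :=
  (H y1 x2 - H y1 x1) + ii * (V x2 y2 - V x2 y1) - ((H y2 x2 - H y2 x1) + ii * (V x1 y2 - V x1 y1)).

Let quarter (x y a b : R) (p q : bool) :=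
  J (x + p%:R * (a / 2)) (x + p%:R * (a / 2) + a / 2) (y + q%:R * (b / 2)) (y + q%:R * (b / 2) + b / 2).

(** In the sum over the four quarters the inner edges cancel, which leaves the whole rectangle. *)
Lemma J_bisect x y a b : exists p q : bool,
  normc (J x (x + a) y (y + b)) <= 4 * normc (quarter x y a b p q).
Proof.
apply: contrapT => /forallNP Hn.
have K p q : normc (quarter x y a b p q) < normc (J x (x + a) y (y + b)) / 4.
  rewrite ltr_pdivlMr // mulrC ltNge; apply/negP => K.
  by have /forallNP/(_ q) := Hn p.
have E : J x (x + a) y (y + b) = quarter x y a b false false + quarter x y a b true false
    + quarter x y a b false true + quarter x y a b true true.
  rewrite /quarter !mul0r !addr0 !mul1r.
  have -> : x + a / 2 + a / 2 = x + a by rewrite -addrA -splitr.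
  have -> : y + b / 2 + b / 2 = y + b by rewrite -addrA -splitr.
  rewrite /J; ring.
have := le_normcD (quarter x y a b false false + quarter x y a b true false
    + quarter x y a b false true) (quarter x y a b true true).
have := le_normcD (quarter x y a b false false + quarter x y a b true false)
    (quarter x y a b false true).
have := le_normcD (quarter x y a b false false) (quarter x y a b true false).
rewrite -E; have := K false false; have := K false true; have := K true false; have := K true true.
lra.
Qed.

(** The bound is quadratic in the size of the rectangle: this compensates the factor 4 lost at each
    bisection, and [e] remains as a gain. *)
Lemma goursat_small z e : 0 < e -> exists2 r : R, 0 < r & forall x y a b : R, 0 <= a -> 0 <= b ->
  x <= Re z <= x + a -> y <= Im z <= y + b -> a + b < r ->
  normc (J x (x + a) y (y + b)) <= 2 * e * (a + b) ^+ 2.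
Proof.
move=> e0; have [d hd] := hh z; have [r r0 Hr] := hd e e0.
exists r => // x y a b a0 b0 /andP[x1 x2] /andP[y1 y2] abr.
(* L has derivative l, the affine approximation of h at z, and contributes nothing to J. *)
pose L w := h z * w + d / 2 * (w - z) ^+ 2.
pose l w := h z + d * (w - z).
have HL w : cder L w (l w).
  apply: cder_eq (cderD (cderMl _ (cder_id w)) (cderMl _ (cderX 2 (cderB (cder_id w) (cder_cst z w))))) _.
  by rewrite /l /=; field.
have near_l (u v : R) : x <= u <= x + a -> y <= v <= y + b -> normc (h (u +i* v) - l (u +i* v)) <= e * (a + b).
  move=> /andP[u1 u2] /andP[v1 v2].
  set w := u +i* v.
  have wz : normc (w - z) <= a + b.
    apply: le_trans (normc_le_ReIm _) _; rewrite /w; case: (z) x1 x2 y1 y2 => p q /= *.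
    by apply: lerD; rewrite ler_norml; apply/andP; split; lra.
  have := Hr (w - z) (le_lt_trans wz abr); rewrite [z + _]addrC subrK => K.
  rewrite /l opprD addrA; apply: le_trans K _; rewrite ler_wpM2l //; exact: ltW.
have ineqH v : y <= v <= y + b ->
    normc ((H v (x + a) - L ((x + a) +i* v)) - (H v x - L (x +i* v))) <= e * (a + b) * a.
  move=> vy; have := @rder_le _ (fun t => H v t - L (t +i* v)) (fun t => h (t +i* v) - l (t +i* v)) x (x + a) (e * (a + b)).
  rewrite lerDl => /(_ a0); rewrite [x + a - x]addrC addKr; apply => t txa; split; last exact: near_l.
  by apply: rderB; [exact: HH|apply: cder_horizontal].
have nii : normc ii = 1 by rewrite /normc /= expr0n add0r expr1n sqrtr1.
have ineqV u : x <= u <= x + a ->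
    normc ((ii * V u (y + b) - L (u +i* (y + b))) - (ii * V u y - L (u +i* y))) <= e * (a + b) * b.
  move=> ux; have := @rder_le _ (fun t => ii * V u t - L (u +i* t)) (fun t => ii * h (u +i* t) - ii * l (u +i* t)) y (y + b) (e * (a + b)).
  rewrite lerDl => /(_ b0); rewrite [y + b - y]addrC addKr; apply => t tyb; split.
    by apply: rderB; [apply: rderMl; exact: HV|apply: cder_vertical].
  by rewrite -mulrBr Normc.normcM nii mul1r; exact: near_l.
have xx : x <= x <= x + a by rewrite lexx lerDl.
have xa : x <= x + a <= x + a by rewrite lexx lerDl a0.
have yy : y <= y <= y + b by rewrite lexx lerDl.
have yb : y <= y + b <= y + b by rewrite lexx lerDl b0.
move: (ineqH _ yy) (ineqH _ yb) (ineqV _ xx) (ineqV _ xa).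
set A := (X in normc X <= _ -> _) => B1; set B := (X in normc X <= _ -> _) => B2.
set C := (X in normc X <= _ -> _) => B3; set D := (X in normc X <= _ -> _) => B4.
have -> : J x (x + a) y (y + b) = A + D - (B + C) by rewrite /A /B /C /D /J; ring.
have := normcB (A + D) (B + C); have := le_normcD A D; have := le_normcD B C.
have -> : 2 * e * (a + b) ^+ 2 = (e * (a + b) * a) + (e * (a + b) * b) + ((e * (a + b) * a) + (e * (a + b) * b)) by ring.
lra.
Qed.

Lemma goursat_pos x y a b : 0 <= a -> 0 <= b -> J x (x + a) y (y + b) = 0.
Proof.
move=> a0 b0; pose sz (c : R) n := c / 2 ^+ n.
have szS c n : sz c n.+1 = sz c n / 2 by rewrite /sz exprSr invfM mulrA.
have sz0 c n : 0 <= c -> 0 <= sz c n by move=> c0; rewrite divr_ge0 // exprn_ge0.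
(* A bad quarter is chosen for every corner and every level at once, so that the bisection becomes a
   plain recursion on corners. *)
have [s Hs] := @choice (R * R * nat) (bool * bool) (fun u v =>
  normc (J u.1.1 (u.1.1 + sz a u.2) u.1.2 (u.1.2 + sz b u.2)) <= 4 * normc (quarter u.1.1 u.1.2 (sz a u.2) (sz b u.2) v.1 v.2))
  (fun u => let: ex_intro p (ex_intro q Hpq) := J_bisect u.1.1 u.1.2 (sz a u.2) (sz b u.2) in
     ex_intro _ (p, q) Hpq).
pose step n (u : R * R) := (u.1 + (s (u, n)).1%:R * (sz a n / 2), u.2 + (s (u, n)).2%:R * (sz b n / 2)).
pose pt := nat_rect (fun=> (R * R)%type) (x, y) step.
have bR (c : bool) : (0 <= c%:R :> R) /\ (c%:R <= 1 :> R) by case: c; rewrite lexx ler01.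
have [X HX] : exists X, forall n, (pt n).1 <= X <= (pt n).1 + sz a n.
  apply: nested_interval => n; rewrite ?lerDl ?sz0 // ?szS /=;
   have [l0 l1] := bR (s (pt n, n)).1; have hs := sz0 a n a0; have hs2 : 0 <= sz a n / 2 by rewrite divr_ge0.
    by rewrite mulr_ge0.
  by have := ler_wpM2r hs2 l1; rewrite mul1r -/pt; lra.
have [Y HY] : exists Y, forall n, (pt n).2 <= Y <= (pt n).2 + sz b n.
  apply: nested_interval => n; rewrite ?lerDl ?sz0 // ?szS /=;
   have [l0 l1] := bR (s (pt n, n)).2; have hs := sz0 b n b0; have hs2 : 0 <= sz b n / 2 by rewrite divr_ge0.
    by rewrite mulr_ge0.
  by have := ler_wpM2r hs2 l1; rewrite mul1r -/pt; lra.
pose Jn n := J (pt n).1 ((pt n).1 + sz a n) (pt n).2 ((pt n).2 + sz b n).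
have J4 n : normc (Jn 0%N) <= 4 ^+ n * normc (Jn n).
  elim: n => [|n IH]; first by rewrite expr0 mul1r.
  apply: le_trans IH _; rewrite exprSr -mulrA ler_pM2l ?exprn_gt0 //.
  by have K := Hs (pt n, n); rewrite /Jn !szS; exact: K.
have -> : J x (x + a) y (y + b) = Jn 0%N by rewrite /Jn /sz /= !expr0 !divr1.
apply: Normc.eq0_normc; apply/eqP; rewrite eq_le normc_ge0 andbT leNgt; apply/negP => Jp.
(* The bound of [goursat_small] at level n, multiplied by [4 ^+ n], is 2 e (a + b)^2; with this [e]
   it is smaller than [normc (Jn 0)]. *)
pose e := normc (Jn 0%N) / (4 * (1 + (a + b)) ^+ 2).
have ab1 : 0 < 1 + (a + b) by rewrite ltr_pwDl // addr_ge0.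
have e0 : 0 < e by rewrite divr_gt0 // mulr_gt0 // exprn_gt0.
have [r r0 Hr] := goursat_small (X +i* Y) e0.
have ab0 : 0 <= a + b by rewrite addr_ge0.
have [n Hn] : exists n, sz a n + sz b n < r.
  exists (Num.bound ((a + b) / r)); rewrite /sz -mulrDl ltr_pdivrMr ?exprn_gt0 // mulrC -ltr_pdivrMr //.
  apply: lt_trans (archi_boundP _) _; first by rewrite divr_ge0 // ltW.
  by rewrite -natrX ltr_nat ltn_expl.
have := Hr _ _ _ _ (sz0 a n a0) (sz0 b n b0) (HX n) (HY n) Hn.
rewrite -/(Jn n) leNgt => /negP; apply.
have n4 : (4 : R) ^+ n = (2 ^+ n) ^+ 2 by rewrite exprAC; congr (_ ^+ n); ring.
have p2 : 0 < (2 : R) ^+ n by rewrite exprn_gt0.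
rewrite -(@ltr_pM2l _ (4 ^+ n)) ?exprn_gt0 //; apply: lt_le_trans (J4 n).
have -> : 4 ^+ n * (2 * e * (sz a n + sz b n) ^+ 2) = 2 * e * (a + b) ^+ 2.
  by rewrite n4 /sz; field; rewrite gt_eqF.
have -> : normc (Jn 0%N) = e * (4 * (1 + (a + b)) ^+ 2).
  by rewrite /e divfK // gt_eqF // mulr_gt0 // exprn_gt0.
rewrite (mulrC 2) -mulrA ltr_pM2l //; nra.
Qed.

Lemma J_anti1 x1 x2 y1 y2 : J x2 x1 y1 y2 = - J x1 x2 y1 y2.
Proof. rewrite /J; ring. Qed.

Lemma J_anti2 x1 x2 y1 y2 : J x1 x2 y2 y1 = - J x1 x2 y1 y2.
Proof. rewrite /J; ring. Qed.

(** Path independence: the two sides integrate [h] from one corner to the opposite one along the two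
    pairs of edges. Antisymmetry of [J] reduces the orientation of the sides to that of
    [goursat_pos]. *)
Lemma goursat x1 x2 y1 y2 :
  (H y1 x2 - H y1 x1) + (0 +i* 1) * (V x2 y2 - V x2 y1) =
  (H y2 x2 - H y2 x1) + (0 +i* 1) * (V x1 y2 - V x1 y1).
Proof.
apply/eqP; rewrite -subr_eq0 -/(J x1 x2 y1 y2); apply/eqP.
wlog x12 : x1 x2 / x1 <= x2.
  by move=> W; have [/W //|/ltW/W] := leP x1 x2; rewrite J_anti1 => /eqP; rewrite oppr_eq0 => /eqP.
wlog y12 : y1 y2 / y1 <= y2.
  by move=> W; have [/W //|/ltW/W] := leP y1 y2; rewrite J_anti2 => /eqP; rewrite oppr_eq0 => /eqP.
have := @goursat_pos x1 y1 (x2 - x1) (y2 - y1); rewrite !subr_ge0 => /(_ x12 y12).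
by rewrite [x1 + _]addrC [y1 + _]addrC !subrK.
Qed.

End Rectangle.

(** The primitive integrates from 0 along the real axis, then vertically. By [goursat] its increment
    from [z] to [z + w] is an integral over one horizontal and one vertical segment near [z], where
    [f] is close to [f z]. *)
Lemma holo_primitive f : holo f -> exists F : R[i] -> R[i], forall z, cder F z (f z).
Proof.
move=> hf.
have hc z (e : R) : 0 < e -> exists2 r : R, 0 < r & forall w, normc w < r -> normc (f (z + w) - f z) < e.
  by move=> e0; have [d /cder_cont] := hf z; apply.
have H0 y : exists g : R -> R[i], forall x, rder g x (f (x +i* y)).
  apply: (@curve_primitive R (fun x => f (x +i* y))) => t e /(hc (t +i* y))[r r0 Hr].
  exists r => // s; rewrite -normcR => /Hr; by simpc.
have V0 x : exists g : R -> R[i], forall y, rder g y (f (x +i* y)).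
  apply: (@curve_primitive R (fun y => f (x +i* y))) => t e /(hc (x +i* t))[r r0 Hr].
  exists r => // s; have -> : `|s| = normc (0 +i* s) by rewrite /normc /= expr0n add0r sqrtr_sqr.
  by move=> /Hr; simpc.
have [H HH] := choice H0; have [V HV] := choice V0.
have G := goursat hf (fun x y => HH y x) HV.
exists (fun z => (H 0 (Re z) - H 0 0) + (0 +i* 1) * (V (Re z) (Im z) - V (Re z) 0)) => z e e0.
have e20 : 0 < e / 2 by rewrite divr_gt0.
have [r r0 Hr] := hc z _ e20; exists r => // w wr.
have -> : H 0 (Re (z + w)) - H 0 0 + (0 +i* 1) * (V (Re (z + w)) (Im (z + w)) - V (Re (z + w)) 0) -
   (H 0 (Re z) - H 0 0 + (0 +i* 1) * (V (Re z) (Im z) - V (Re z) 0)) - f z * w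
  = (H (Im z) (Re z + Re w) - f z * (Re z + Re w)%:C - (H (Im z) (Re z) - f z * (Re z)%:C))
  + (0 +i* 1) * (V (Re z + Re w) (Im z + Im w) - f z * (Im z + Im w)%:C - (V (Re z + Re w) (Im z) - f z * (Im z)%:C)).
  have -> : Re (z + w) = Re z + Re w by case: (z) (w) => [? ?] [? ?].
  have -> : Im (z + w) = Im z + Im w by case: (z) (w) => [? ?] [? ?].
  have := G (Re z) (Re z + Re w) 0 (Im z).
  have E : f z * w = f z * ((Re w)%:C + (0 +i* 1) * (Im w)%:C) by congr (_ * _); case: (w) => p q; simpc.
  rewrite E !rmorphD.
  move=> /eqP; rewrite -subr_eq0 => /eqP G0; apply/eqP; rewrite -subr_eq0 -G0; apply/eqP; ring.
have hl (t : R[i]) : normc t < r -> normc (f (z + t) - f z) <= e / 2 by move=> /Hr/ltW.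
have zE : z = Re z +i* Im z by case: (z).
have lin (c : R[i]) (t : R) : rder (fun s => c * s%:C) t c.
  move=> e1 e10; exists 1 => // s _.
  have -> : c * (t + s)%:C - c * t%:C - c * s%:C = 0 by rewrite rmorphD; ring.
  by rewrite Normc.normc0 mulr_ge0 // ltW.
have b1 : normc (H (Im z) (Re z + Re w) - f z * (Re z + Re w)%:C - (H (Im z) (Re z) - f z * (Re z)%:C)) <= e / 2 * `|Re w|.
  have := @rder_le_dist (fun t => H (Im z) t - f z * t%:C) (fun t => f (t +i* Im z) - f z) (Re z) (Re z + Re w) (e / 2).
  rewrite [Re z + Re w - Re z]addrC addKr; apply => t tw; split; first by apply: rderB.
  have -> : t +i* Im z = z + (t - Re z)%:C by rewrite {2}zE; simpc; rewrite addrC subrK.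
  by apply: hl; rewrite normcR (le_lt_trans tw) // (le_lt_trans _ wr) // Re_le_normc.
have b2 : normc (V (Re z + Re w) (Im z + Im w) - f z * (Im z + Im w)%:C - (V (Re z + Re w) (Im z) - f z * (Im z)%:C)) <= e / 2 * `|Im w|.
  have := @rder_le_dist (fun t => V (Re z + Re w) t - f z * t%:C) (fun t => f ((Re z + Re w) +i* t) - f z) (Im z) (Im z + Im w) (e / 2).
  rewrite [Im z + Im w - Im z]addrC addKr; apply => t tw; split; first by apply: rderB.
  have -> : (Re z + Re w) +i* t = z + (Re w +i* (t - Im z)) by case: (z) => p q /=; simpc; congr (_ +i* _); ring.
  apply: hl; apply: le_lt_trans wr.
  rewrite -(@ler_pXn2r _ 2) ?nnegrE ?normc_ge0 // !sqr_normcE /= lerD2l.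
  rewrite -[leLHS]real_normK ?num_real // -[leRHS]real_normK ?num_real //.
  by rewrite ler_pXn2r ?nnegrE.
apply: le_trans (le_normcD _ _) _; rewrite Normc.normcM.
have -> : normc ((0 +i* 1) : R[i]) = 1 by rewrite /normc /= expr0n add0r expr1n sqrtr1.
have := Re_le_normc w; have := Im_le_normc w => i1 i2; rewrite mul1r.
by have := ler_wpM2l (ltW e20) i1; have := ler_wpM2l (ltW e20) i2; lra.
Qed.
End Goursat.

(** * Mean value property and Cauchy estimate *)

Section MeanValue.
Context {R : realType}.
Implicit Types (f : R[i] -> R[i]) (z w : R[i]).

Lemma holo_cder f : holo f -> exists f' : R[i] -> R[i], forall z, cder f z (f' z).
Proof. by move=> H; have [g Hg] := choice H; exists g. Qed.

Lemma rder_lin (c : R[i]) (t : R) : rder (fun s => c * s%:C) t c.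
Proof.
move=> e1 e10; exists 1 => // s _.
have -> : c * (t + s)%:C - c * t%:C - c * s%:C = 0 by rewrite rmorphD; ring.
by rewrite Normc.normc0 mulr_ge0 // ltW.
Qed.

Lemma cder0_const f : (forall z, cder f z 0) -> forall z w, f z = f w.
Proof.
move=> H z w; apply/eqP; rewrite -subr_eq0; apply/eqP/Normc.eq0_normc/eqP.
rewrite eq_le normc_ge0 andbT -[0](mul0r (normc (z - w))).
have := @cder_le R f (fun=> 0) w (z - w) 0; rewrite [w + _]addrC subrK; apply => t _.
by rewrite Normc.normc0 lexx.
Qed.

Let T : R[i] := 0 +i* (2 * pi).

(* For k w = f (z + cexp w), the constant c is the integral of f (w) / (w - z) around every
   circle centred at z, since Re w is the logarithm of the radius. *)
Lemma periodic_increment (k : R[i] -> R[i]) : holo k -> (forall w, k (w + T) = k w) ->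
  exists (K : R[i] -> R[i]) (c : R[i]), (forall w, cder K w (k w)) /\ forall w, K (w + T) - K w = c.
Proof.
move=> hk kT; have [K HK] := holo_primitive hk.
exists K, (K (0 + T) - K 0); split => // w.
apply: (@cder0_const (fun w => K (w + T) - K w)) => {}w.
have E : cder (fun w => w + T) w 1.
  by apply: cder_eq (cderD (cder_id w) (cder_cst T w)) _; rewrite addr0.
apply: cder_eq (cderB (cder_comp E (HK (w + T))) (HK w)) _.
by rewrite kT mulr1 subrr.
Qed.

Lemma normc_cexp_vert (u v : R) : normc (cexp (u +i* v)) = expR u.
Proof. by rewrite normc_cexp. Qed.

Lemma pi2_gt0 : 0 < 2 * pi :> R.
Proof. by rewrite mulr_gt0 // pi_gt0. Qed.

Lemma addT (u : R) : (u +i* 0) + T = u +i* (2 * pi).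
Proof. by rewrite /T; simpc. Qed.

Lemma TE : (0 +i* (2 * pi) : R[i]) = (0 +i* 1) * (2 * pi)%:C.
Proof. by apply/eqP; rewrite eq_complex /=; apply/andP; split; apply/eqP; ring. Qed.

Lemma le_eps (x y c : R) : 0 < c -> (forall e, 0 < e -> x <= y + c * e) -> x <= y.
Proof.
move=> c0 H; rewrite leNgt; apply/negP => xy.
have := H ((x - y) / (2 * c)); rewrite divr_gt0 ?subr_gt0 ?mulr_gt0 // => /(_ isT).
have -> : c * ((x - y) / (2 * c)) = (x - y) / 2 by field; rewrite gt_eqF.
lra.
Qed.

Lemma eq_eps (x y : R[i]) (c : R) : 0 < c -> (forall e, 0 < e -> normc (x - y) <= c * e) -> x = y.
Proof.
move=> c0 H; apply/eqP; rewrite -subr_eq0; apply/eqP/Normc.eq0_normc/eqP.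
rewrite eq_le normc_ge0 andbT; apply: (le_eps c0) => e e0; rewrite add0r; exact: H.
Qed.

(** The increment [c0] over a period is the same on all vertical lines. Far to the left it is
    identified as 2 pi i f(z); on the line Re w = ln r, division by i gives an integral whose real
    part the hypothesis bounds. *)
Lemma mean_value_Re f z (r c : R) : holo f -> 0 < r ->
  (forall w, normc w = r -> Re (f (z + w)) <= c) -> Re (f z) <= c.
Proof.
move=> hf r0 Hc.
pose k w := f (z + cexp w).
have hk : holo k.
  move=> w; have [d hd] := hf (z + cexp w); exists (d * (0 + cexp w)).
  by apply: (@cder_comp _ f (fun w => z + cexp w)) hd; apply: cderD; [exact: cder_cst|exact: cder_cexp].
have [K [c0 [HK Hc0]]] := periodic_increment hk (fun w => congr1 (fun x => f (z + x)) (cexp_period w)).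
(* The radius tends to 0. *)
have i1 : c0 = (0 +i* (2 * pi)) * f z.
  apply: (eq_eps pi2_gt0) => e e0.
  have [d hd] := hf z; have [s s0 Hs] := cder_cont hd e0.
  pose u := ln (s / 2).
  have su : expR u = s / 2 by rewrite lnK // posrE divr_gt0.
  have := @rder_le _ (fun v => K (u +i* v) - ((0 +i* 1) * f z) * v%:C)
    (fun v => (0 +i* 1) * k (u +i* v) - (0 +i* 1) * f z) 0 (2 * pi) e (ltW pi2_gt0).
  rewrite subr0 [2 * pi * e]mulrC; set X := (X in normc X <= _); have -> : X = c0 - (0 +i* (2 * pi)) * f z.
    rewrite /X -(Hc0 (u +i* 0)) addT TE rmorph0; ring.
  apply => v _; split.
    by apply: rderB; [apply: cder_vertical|exact: rder_lin].
  rewrite -mulrBr Normc.normcM; have -> : normc ((0 +i* 1) : R[i]) = 1 by rewrite /normc /= expr0n add0r expr1n sqrtr1.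
  by rewrite mul1r ltW // Hs // normc_cexp_vert su; lra.
pose u := ln r.
have ru : expR u = r by rewrite lnK.
have := @rder_Re_le _ (fun v => (- (0 +i* 1)) * K (u +i* v))
    (fun v => (- (0 +i* 1)) * ((0 +i* 1) * k (u +i* v))) 0 (2 * pi) c (ltW pi2_gt0).
rewrite subr0 -mulrBr -addT Hc0 i1 => H.
have {}H : Re (- (0 +i* 1) * ((0 +i* (2 * pi)) * f z)) <= c * (2 * pi).
  apply: H => v _; split; first by apply: rderMl; apply: cder_vertical.
  have -> : - (0 +i* 1) * ((0 +i* 1) * k (u +i* v)) = k (u +i* v) by case: (k _) => p q; simpc.
  by apply: Hc; rewrite normc_cexp_vert.
have E : Re (- (0 +i* 1) * ((0 +i* (2 * pi)) * f z)) = Re (f z) * (2 * pi).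
  by case: (f z) => p q /=; simpc => /=; ring.
by move: H; rewrite E ler_pM2r // pi2_gt0.
Qed.

(** The argument of [mean_value_Re], with [k] the pullback under the exponential of the integrand
    f(w) / (w - z)^2. *)
Lemma cauchy_estimate f f' z (r M : R) : (forall w, cder f w (f' w)) -> 0 < r ->
  (forall w, normc w = r -> normc (f (z + w)) <= M) -> normc (f' z) <= M / r.
Proof.
move=> hf r0 HM.
pose k w := f (z + cexp w) * cexp (- w).
have cN w : cder (fun w => - w) w (-1).
  by have := cderMl (-1) (cder_id w); rewrite mulr1; apply: cder_ext => x; rewrite mulN1r.
have hk : holo k.
  move=> w; eexists; apply: cderM; last by apply: cder_cexp_comp; exact: cN.
  by apply: (@cder_comp _ f (fun w => z + cexp w)) (hf _); apply: cderD; [exact: cder_cst|exact: cder_cexp].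
have kT w : k (w + T) = k w.
  rewrite /k cexp_period; congr (_ * _).
  by rewrite -(cexp_period (- (w + _))); congr cexp; rewrite /T; case: w => p q; simpc; congr (_ +i* _); ring.
have [K [c0 [HK Hc0]]] := periodic_increment hk kT.
have nii : normc ((0 +i* 1) : R[i]) = 1 by rewrite /normc /= expr0n add0r expr1n sqrtr1.
have i1 : c0 = (0 +i* (2 * pi)) * f' z.
  apply: (eq_eps pi2_gt0) => e e0.
  have [s s0 Hs] := hf z e e0.
  pose u := ln (s / 2).
  have su : expR u = s / 2 by rewrite lnK // posrE divr_gt0.
  (* The added term [f z * cexp (- w)] is periodic, so it leaves the increment unchanged, while its
     derivative removes the part of [k] that blows up as the radius tends to 0. *)
  have := @rder_le _ (fun v => (K (u +i* v) + f z * cexp (- (u +i* v))) - ((0 +i* 1) * f' z) * v%:C)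
    (fun v => (0 +i* 1) * (k (u +i* v) + f z * (cexp (- (u +i* v)) * -1)) - (0 +i* 1) * f' z) 0 (2 * pi) e (ltW pi2_gt0).
  rewrite subr0 [2 * pi * e]mulrC; set X := (X in normc X <= _); have -> : X = c0 - (0 +i* (2 * pi)) * f' z.
    rewrite /X -(Hc0 (u +i* 0)) addT TE rmorph0.
    have -> : cexp (- (u +i* (2 * pi))) = cexp (- (u +i* 0)).
      by rewrite -(cexp_period (- (u +i* (2 * pi)))); congr cexp; simpc; congr (_ +i* _); ring.
    by ring.
  apply => v _; split.
    apply: rderB; last exact: rder_lin.
    apply: (@cder_vertical _ (fun w => K w + f z * cexp (- w))); apply: cderD => //.
    by apply: cderMl; apply: cder_cexp_comp; exact: cN.
  rewrite -mulrBr Normc.normcM nii mul1r.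
  have := Hs (cexp (u +i* v)); rewrite normc_cexp_vert su => /(_ _) W.
  have -> : k (u +i* v) + f z * (cexp (- (u +i* v)) * -1) - f' z =
    (f (z + cexp (u +i* v)) - f z - f' z * cexp (u +i* v)) * cexp (- (u +i* v)).
    have I : cexp (u +i* v) * cexp (- (u +i* v)) = 1 by rewrite -cexpD subrr cexp0.
    by rewrite mulrBl -mulrA I /k; ring.
  rewrite Normc.normcM normc_cexp [Re _]/= expRN su ler_pdivrMr ?divr_gt0 //.
  by apply: W; lra.
pose u := ln r.
have ru : expR u = r by rewrite lnK.
have := @rder_le _ (fun v => K (u +i* v)) (fun v => (0 +i* 1) * k (u +i* v)) 0 (2 * pi) (M / r) (ltW pi2_gt0).
rewrite subr0 -addT Hc0 i1 => H.
have {}H : normc ((0 +i* (2 * pi)) * f' z) <= M / r * (2 * pi).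
  apply: H => v _; split; first exact: cder_vertical.
  rewrite Normc.normcM nii mul1r Normc.normcM (normc_cexp (- _)) [Re _]/= expRN ru ler_pM2r ?invr_gt0 //.
  by apply: HM; rewrite normc_cexp_vert.
have E : normc ((0 +i* (2 * pi)) * f' z) = normc (f' z) * (2 * pi).
  by rewrite Normc.normcM mulrC; congr (_ * _); rewrite /normc /= expr0n add0r sqrtr_sqr ger0_norm // ltW // pi2_gt0.
by move: H; rewrite E ler_pM2r // pi2_gt0.
Qed.
End MeanValue.

(** * Maximum principle *)

Section MaximumPrinciple.
Context {R : realType}.
Implicit Types (f : R[i] -> R[i]) (z w : R[i]).

Lemma normc_continuous f : holo f -> continuous (fun p : R * R => normc (f (p.1 +i* p.2))).
Proof.
move=> hf p; apply/cvgrPdist_lt => e e0.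
have [d hd] := hf (p.1 +i* p.2); have [r r0 Hr] := cder_cont hd e0.
exists (ball p.1 (r / 2), ball p.2 (r / 2)) => /=.
  by split; apply: nbhsx_ballx; rewrite divr_gt0.
move=> q [] /=; rewrite /ball /= => q1 q2.
have := Hr ((q.1 - p.1) +i* (q.2 - p.2)).
have -> : p.1 +i* p.2 + ((q.1 - p.1) +i* (q.2 - p.2)) = q.1 +i* q.2 by simpc; congr (_ +i* _); ring.
have -> : normc ((q.1 - p.1) +i* (q.2 - p.2)) < r.
  by apply: le_lt_trans (normc_le_ReIm _) _; rewrite /= distrC [`|q.2 - _|]distrC; lra.
move=> /(_ isT); apply: le_lt_trans; rewrite ler_norml; apply/andP; split.
  rewrite lerBrDl -lerBrDr opprK addrC.
  have := le_normcD (f (q.1 +i* q.2) - f (p.1 +i* p.2)) (f (p.1 +i* p.2)); rewrite subrK; lra.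
rewrite normc_distC.
have := le_normcD (f (p.1 +i* p.2) - f (q.1 +i* q.2)) (f (q.1 +i* q.2)); rewrite subrK; lra.
Qed.

(* The term e |w|^2 makes the maximum strict. Expanding it around z, the hypothesis says
   that Re (g w) <= Re (g z) - e Q r^2 on the circle, against the mean value property. *)
Lemma no_interior_max f z (r e : R) : holo f -> 0 < r -> 0 < e -> f z != 0 ->
  ~ (forall w, normc w = r ->
     normc (f (z + w)) ^+ 2 + e * normc (z + w) ^+ 2 <= normc (f z) ^+ 2 + e * normc z ^+ 2).
Proof.
move=> hf r0 e0 fz0 H; pose q := f z ^+ 2; pose Q := normc q.
have Q0 : 0 < Q.
  rewrite lt_neqAle normc_ge0 andbT eq_sym; apply/eqP => /Normc.eq0_normc/eqP.
  by rewrite expf_eq0 (negPf fz0).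
have QE : Q = normc (f z) ^+ 2 by rewrite /Q normcX.
pose g w := conjc q * f w ^+ 2 + (2 * e * Q)%:C * conjc z * (w - z).
have hg : holo g.
  move=> w; have [d hd] := hf w; eexists.
  by apply: cderD; [apply: cderMl; apply: cderX; exact: hd|apply: cderMl; apply: cderB; [exact: cder_id|exact: cder_cst]].
have qq : Re (conjc q * q) = Q ^+ 2 by rewrite sqr_normcE; case: (q) => a b /=; ring.
have nconj w : normc (conjc w) = normc w by case: w => a b; rewrite /normc /= sqrrN.
have gz : Re (g z) = Q ^+ 2 by rewrite /g subrr mulr0 addr0 qq.
have := @mean_value_Re _ g z r (Q ^+ 2 - e * Q * r ^+ 2) hg r0.
rewrite gz => /(_ _) W; have : Q ^+ 2 <= Q ^+ 2 - e * Q * r ^+ 2.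
  apply: W => w wr; have := H w wr => Hw.
  have e1 : Re (conjc q * f (z + w) ^+ 2) <= Q * normc (f (z + w)) ^+ 2.
    by apply: le_trans (Re_le_norm _) _; rewrite Normc.normcM nconj normcX.
  have e2 : normc (z + w) ^+ 2 = normc z ^+ 2 + 2 * Re (conjc z * w) + r ^+ 2.
    by rewrite -wr !sqr_normcE; case: (z) (w) => a b [c d] /=; ring.
  have e3 : Re ((2 * e * Q)%:C * conjc z * (z + w - z)) = 2 * e * Q * Re (conjc z * w).
    by case: (z) (w) => a b [c d] /=; ring.
  have -> : Re (g (z + w)) = Re (conjc q * f (z + w) ^+ 2) + 2 * e * Q * Re (conjc z * w).
    by rewrite -e3 /g; case: (conjc q * _) ( (2 * e * Q)%:C * _ * _) => a b [c d].
  apply: le_trans (lerD e1 (lexx _)) _.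
  have : Q * normc (f (z + w)) ^+ 2 <= Q * (Q - e * (2 * Re (conjc z * w) + r ^+ 2)).
    by rewrite ler_pM2l //; rewrite e2 -QE in Hw; lra.
  have -> : Q * (Q - e * (2 * Re (conjc z * w) + r ^+ 2)) = Q ^+ 2 - 2 * e * Q * Re (conjc z * w) - e * Q * r ^+ 2 by ring.
  lra.
have : 0 < e * Q * r ^+ 2 by rewrite !mulr_gt0 // exprn_gt0.
lra.
Qed.

(** By compactness |f|^2 + e |z|^2 attains its maximum on the rectangle. There either f vanishes or,
    by [no_interior_max], the point lies on the boundary. [D] bounds |z|^2, and [e] tends to 0. *)
Lemma max_rect f (a b c d M : R) : holo f -> 0 <= M ->
  (forall x y, a <= x <= b -> c <= y <= d -> (x = a \/ x = b \/ y = c \/ y = d) -> normc (f (x +i* y)) <= M) ->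
  forall x y, a <= x <= b -> c <= y <= d -> normc (f (x +i* y)) <= M.
Proof.
move=> hf M0 HM x y xab ycd.
pose D : R := 1 + a ^+ 2 + b ^+ 2 + c ^+ 2 + d ^+ 2.
have D0 : 0 < D.
  by have := sqr_ge0 a; have := sqr_ge0 b; have := sqr_ge0 c; have := sqr_ge0 d; rewrite /D; lra.
have sqM (t u v : R) : u <= t <= v -> t ^+ 2 <= u ^+ 2 + v ^+ 2.
  move=> /andP[t1 t2]; have u2 := sqr_ge0 u; have v2 := sqr_ge0 v.
  have [t0|t0] := leP 0 t.
    have : 0 <= (v - t) * (v + t) by rewrite mulr_ge0 //; lra.
    have -> : (v - t) * (v + t) = v ^+ 2 - t ^+ 2 by ring. lra.
  have : 0 <= (t - u) * (- u - t) by rewrite mulr_ge0 //; lra.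
  have -> : (t - u) * (- u - t) = u ^+ 2 - t ^+ 2 by ring. lra.
rewrite -(@ler_pXn2r _ 2) ?nnegrE ?normc_ge0 //.
apply: (le_eps D0) => e e0.
pose U (p : R * R) := normc (f (p.1 +i* p.2)) ^+ 2 + e * (p.1 ^+ 2 + p.2 ^+ 2).
have nE u v : u ^+ 2 + v ^+ 2 = normc ((u +i* v) : R[i]) ^+ 2 by rewrite sqr_normcE.
have cU : continuous U.
  move=> p; apply: cvgD; first by apply: cvgM; exact: normc_continuous.
  apply: cvgM; first exact: cvg_cst.
  by apply: cvgD; apply: cvgM; first [exact: cvg_fst|exact: cvg_snd].
pose A : set (R * R) := (`[a, b] `*` `[c, d])%classic.
have cA : compact A by apply: compact_setX; exact: segment_compact.
have A0 : (A !=set0)%classic by exists (x, y); split; rewrite /= in_itv.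
have [[x0 y0]] := compact_EVT_max A0 cA (continuous_subspaceT cU).
rewrite inE => -[] /=; rewrite !in_itv /= => x0ab y0cd Hmax.
have UxyA u v : a <= u <= b -> c <= v <= d -> U (u, v) <= U (x0, y0).
  by move=> uab vcd; apply: Hmax; rewrite inE; split; rewrite /= in_itv.
apply: le_trans (_ : U (x, y) <= _); first by rewrite lerDl mulr_ge0 ?addr_ge0 ?sqr_ge0 // ltW.
apply: le_trans (UxyA _ _ xab ycd) _.
have eD : e * (x0 ^+ 2 + y0 ^+ 2) <= D * e.
  by rewrite mulrC ler_wpM2r ?(ltW e0) // /D; have := sqM _ _ _ x0ab; have := sqM _ _ _ y0cd; lra.
rewrite /U /= lerD //.
have [f0|fn0] := eqVneq (f (x0 +i* y0)) 0; first by rewrite f0 Normc.normc0 expr0n sqr_ge0.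
case: (pselect (x0 = a \/ x0 = b \/ y0 = c \/ y0 = d)) => [bd|nbd].
  by rewrite ler_pXn2r ?nnegrE ?normc_ge0 // HM.
have [/andP[xa xb] /andP[yc yd]] := (x0ab, y0cd).
have [xa' xb'] : a < x0 /\ x0 < b.
  by split; rewrite lt_neqAle ?xa ?xb andbT; apply/eqP => E; apply: nbd; [left|right; left].
have [yc' yd'] : c < y0 /\ y0 < d.
  by split; rewrite lt_neqAle ?yc ?yd andbT; apply/eqP => E; apply: nbd; right; right; [left|right].
pose r := Num.min (Num.min (x0 - a) (b - x0)) (Num.min (y0 - c) (d - y0)).
have r0 : 0 < r by rewrite !lt_min !subr_gt0 xa' xb' yc' yd'.
exfalso; apply: (@no_interior_max f (x0 +i* y0) r e hf r0 e0 fn0) => -[p q] wr.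
have -> : (x0 +i* y0 : R[i]) + (p +i* q) = (x0 + p) +i* (y0 + q) by simpc.
rewrite -!nE; apply: (UxyA (x0 + p) (y0 + q)).
  have := Re_le_normc (p +i* q); rewrite wr /r !le_min ler_norml ler_norml => /= /andP[/andP[h1 h2] _].
  by apply/andP; lra.
have := Im_le_normc (p +i* q); rewrite wr /r !le_min => /= /andP[_ /andP[]].
by rewrite !ler_norml; lra.
Qed.

End MaximumPrinciple.

(** * Phragmen-Lindelof bounds *)

Section PhragmenLindelof.
Context {R : realType}.
Implicit Types (f : R[i] -> R[i]) (z w : R[i]).

Lemma cos_ge_strip (l x k : R) : 0 <= l -> 0 <= k -> k * l < pi / 2 -> `|x| <= l -> cos (k * l) <= cos (k * x).
Proof.
move=> l0 k0 kl xl; rewrite -[cos (k * x)]cos_norm normrM (ger0_norm k0).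
have kx : k * `|x| <= k * l by rewrite ler_wpM2l.
have pi0 : 0 < pi :> R := pi_gt0 R.
have kx0 : 0 <= k * `|x| by rewrite mulr_ge0.
by rewrite leNgt ltr_cos -?leNgt // in_itv /=; apply/andP; lra.
Qed.

Lemma holo_comp f g : holo f -> holo g -> holo (fun w => f (g w)).
Proof. by move=> hf hg w; have [d hd] := hg w; have [e he] := hf (g w); exists (e * d); exact: cder_comp. Qed.

Lemma holoM f g : holo f -> holo g -> holo (fun w => f w * g w).
Proof. by move=> hf hg w; have [d hd] := hg w; have [e he] := hf w; exists (e * g w + f w * d); exact: cderM. Qed.

Lemma holoD f g : holo f -> holo g -> holo (fun w => f w + g w).
Proof. by move=> hf hg w; have [d hd] := hg w; have [e he] := hf w; exists (e + d); exact: cderD. Qed.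

Lemma holo_cst c : holo (fun=> c : R[i]).
Proof. by move=> w; exists 0; exact: cder_cst. Qed.

Lemma holo_id : holo (fun w : R[i] => w).
Proof. by move=> w; exists 1; exact: cder_id. Qed.

Lemma holo_cexp : holo (@cexp R).
Proof. by move=> w; exists (cexp w); exact: cder_cexp. Qed.

Lemma holo_cexp_comp f : holo f -> holo (fun w => cexp (f w)).
Proof. exact: (holo_comp holo_cexp). Qed.

(* The real part is 2 cosh (k u) cos (k (v - c)), which is positive in the strip and
   dominates exp (k' |u|) for k' < k. *)
Let damp (k c : R) w := cexp (k%:C * (w + (0 +i* - c))) + cexp ((- k)%:C * (w + (0 +i* - c))).

Let Re_damp (k c u v : R) : Re (damp k c (u +i* v)) = (expR (k * u) + expR (- (k * u))) * cos (k * (v - c)).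
Proof.
have e1 : k%:C * (u +i* v + (0 +i* - c)) = (k * u) +i* (k * (v - c)).
  by apply/eqP; rewrite eq_complex /=; apply/andP; split; apply/eqP; ring.
have e2 : (- k)%:C * (u +i* v + (0 +i* - c)) = (- (k * u)) +i* (- (k * (v - c))).
  by apply/eqP; rewrite eq_complex /=; apply/andP; split; apply/eqP; ring.
by rewrite /damp e1 e2 /cexp /= cosN; ring.
Qed.

Let holo_damp k c : holo (damp k c).
Proof.
by apply: holoD; apply: holo_cexp_comp; apply: holoM; rewrite /=; do ?[exact: holo_cst]; apply: holoD;
  [exact: holo_id|exact: holo_cst|exact: holo_id|exact: holo_cst].
Qed.

Lemma expRN_le (x : R) : 0 < x -> expR (- x) <= x^-1.
Proof.
move=> x0; rewrite expRN lef_pV2 ?posrE ?expR_gt0 //.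
by apply: le_trans (expR_ge1Dx x); rewrite lerDr.
Qed.

(** Multiplied by exp (- e [damp]), [f] tends to 0 at both ends of the strip because k' < k, and it
    does not grow on the edges. The maximum principle on a long rectangle applies, and then [e]
    tends to 0. *)
Lemma PL_strip f (c l k k' A K M : R) : holo f -> 0 < l -> 0 < k -> k * l < pi / 2 ->
  0 <= k' -> k' < k -> 0 <= A -> 0 <= K -> 0 <= M ->
  (forall u v, `|v - c| <= l -> normc (f (u +i* v)) <= A * expR (K * expR (k' * `|u|))) ->
  (forall u v, `|v - c| = l -> normc (f (u +i* v)) <= M) ->
  forall u v, `|v - c| <= l -> normc (f (u +i* v)) <= M.
Proof.
move=> hf l0 k0 kl k'0 k'k A0 K0 M0 Hg Hb u v vl.
pose s := cos (k * l).
have s0 : 0 < s by apply: cos_gt0_pihalf; rewrite kl andbT; have := pi_gt0 R; have : 0 < k * l by [apply: mulr_gt0]; lra.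
have sc x : `|x - c| <= l -> s <= cos (k * (x - c)) by apply: cos_ge_strip => //; exact: ltW.
pose P e w := f w * cexp ((- e)%:C * damp k c w).
have hP e : holo (P e).
  by apply: holoM => //; apply: holo_cexp_comp; apply: holoM; [exact: holo_cst|exact: holo_damp].
have nP e x y : normc (P e (x +i* y)) = normc (f (x +i* y)) * expR (- (e * ((expR (k * x) + expR (- (k * x))) * cos (k * (y - c))))).
  rewrite /P Normc.normcM normc_cexp; congr (_ * expR _).
  by rewrite -Re_damp; case: (damp _ _ _) => p q /=; ring.
have D0 x y : `|y - c| <= l -> 0 <= (expR (k * x) + expR (- (k * x))) * cos (k * (y - c)).
  by move=> /sc h; rewrite mulr_ge0 ?addr_ge0 ?expR_ge0 // (le_trans (ltW s0)).
have main e : 0 < e -> normc (P e (u +i* v)) <= M.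
  move=> e0; apply: (le_eps ltr01) => t t0; rewrite mul1r.
  (* Chosen so that at |x| = [L] the total exponent is at most - (A / t + 1); then A exp (- (A / t +
     1)) <= A / (A / t + 1) <= t. *)
  pose L := Num.max `|u| ((A / t + 1 + K) / (e * s * (k - k'))).
  have esk : 0 < e * s * (k - k') by rewrite !mulr_gt0 // subr_gt0.
  have L0 : 0 <= L by rewrite le_max normr_ge0.
  have Lx x y : `|x| = L -> `|y - c| <= l -> normc (P e (x +i* y)) <= t.
    move=> xL yl; rewrite nP.
    have i1 : e * s * expR (k * L) <= e * ((expR (k * x) + expR (- (k * x))) * cos (k * (y - c))).
      rewrite -mulrA ler_pM2l // mulrC; apply: ler_pM; rewrite ?expR_ge0 ?(ltW s0) ?sc //.
      rewrite -xL; have [x0|x0] := leP 0 x; first by rewrite ger0_norm // lerDl expR_ge0.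
      by rewrite ltr0_norm // mulrN lerDr expR_ge0.
    have i2 : A / t + 1 + K <= e * s * (k - k') * L.
      by rewrite [leRHS]mulrC -ler_pdivrMr // le_max lexx orbT.
    have Ekk : expR (k * L) = expR (k' * L) * expR ((k - k') * L) by rewrite -expRD; congr expR; ring.
    have E1 : 1 <= expR (k' * L) by rewrite -expR0 ler_expR mulr_ge0.
    have E2 := expR_ge1Dx ((k - k') * L).
    have At : 0 <= A / t by rewrite divr_ge0 // ltW.
    have i3 : A / t + 1 <= e * s * expR (k * L) - K * expR (k' * L).
      have i4 : A / t + 1 <= e * s * expR ((k - k') * L) - K.
        have : e * s * (1 + (k - k') * L) <= e * s * expR ((k - k') * L) by rewrite ler_pM2l // mulr_gt0.
        have : 0 < e * s by rewrite mulr_gt0.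
        rewrite mulrDr mulr1 mulrA; lra.
      apply: (le_trans i4); rewrite Ekk.
      have -> : e * s * (expR (k' * L) * expR ((k - k') * L)) - K * expR (k' * L) =
         expR (k' * L) * (e * s * expR ((k - k') * L) - K) by ring.
      by rewrite ler_peMl // (le_trans _ i4) // addr_ge0.
    apply: le_trans (ler_wpM2r (expR_ge0 _) (Hg x y yl)) _.
    rewrite -mulrA -expRD xL.
    apply: le_trans (_ : A * expR (- (A / t + 1)) <= _).
      by rewrite ler_wpM2l // ler_expR; lra.
    have p0 : 0 < A / t + 1 by lra.
    apply: le_trans (ler_wpM2l A0 (expRN_le p0)) _.
    rewrite ler_pdivrMr // mulrDr mulr1 mulrCA divff ?gt_eqF // mulr1; lra.
  apply: (@max_rect _ (P e) (- L) L (c - l) (c + l)) => //; first by rewrite addr_ge0 // ltW.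
  - move=> x y _ /andP[y1 y2] H.
    have yl : `|y - c| <= l by rewrite ler_norml; apply/andP; lra.
    case: H => [->|[->|H]].
    + by apply: le_trans (Lx _ _ _ yl) _; rewrite ?normrN ?ger0_norm //; lra.
    + by apply: le_trans (Lx _ _ _ yl) _; rewrite ?ger0_norm //; lra.
    have yl2 : `|y - c| = l.
      case: H => ->; first by rewrite (_ : c - l - c = - l) ?normrN ?gtr0_norm //; ring.
      by rewrite (_ : c + l - c = l) ?gtr0_norm //; ring.
    rewrite nP; apply: le_trans (_ : M * 1 <= _); last by rewrite mulr1; lra.
    apply: ler_pM; rewrite ?normc_ge0 ?expR_ge0 ?Hb //.
    by rewrite expR_le1 oppr_le0 mulr_ge0 ?D0 // ltW.
  - by have : `|u| <= L by [rewrite le_max lexx]; rewrite ler_norml.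
  - by move: vl; rewrite ler_norml => /andP[]; move=> *; apply/andP; lra.
(* At the fixed point, exp (- e D) >= 1 - e D makes the loss linear in [e]. *)
set N := normc _; set D := (expR (k * u) + expR (- (k * u))) * cos (k * (v - c)).
have N0 : 0 <= N by exact: normc_ge0.
have DD0 : 0 <= D by exact: D0.
have c0 : 0 < N * D + 1 by rewrite ltr_wpDl // mulr_ge0.
apply: (le_eps c0) => e e0; have := main e e0; rewrite nP -/N -/D => h.
have := ler_wpM2l N0 (expR_ge1Dx (- (e * D))) => h2.
have : N * (1 + - (e * D)) = N - N * D * e by ring.
have -> : (N * D + 1) * e = N * D * e + e by ring.
lra.
Qed.

End PhragmenLindelof.

(** * Phragmen-Lindelof in the half plane and in the plane *)

Section PhragmenLindelofPlane.
Context {R : realType}.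
Implicit Types (z w : R[i]).

Lemma polar_upper z : z != 0 -> 0 <= Im z ->
  exists u v : R, [/\ 0 <= v, v <= pi & z = cexp (u +i* v)].
Proof.
move=> z0 y0; have r0 : 0 < normc z.
  by apply: normc_gt0.
set r := normc z in r0.
have x1 : -1 <= Re z / r <= 1.
  by rewrite ler_pdivlMr // ler_pdivrMr // mulN1r mul1r -ler_norml; exact: Re_le_normc.
exists (ln r), (acos (Re z / r)); split; [exact: acos_ge0|exact: acos_lepi|].
rewrite /cexp /= lnK ?posrE // acosK ?in_itv // sin_acos //.
have -> : 1 - (Re z / r) ^+ 2 = (Im z / r) ^+ 2.
  have : r ^+ 2 = Re z ^+ 2 + Im z ^+ 2 by exact: sqr_normcE.
  move=> E; rewrite !expr_div_n; apply: (mulIf (_ : r ^+ 2 != 0)); first by rewrite gt_eqF // exprn_gt0.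
  by rewrite mulrBl !divfK ?gt_eqF ?exprn_gt0 // E; ring.
rewrite sqrtr_sqr ger0_norm ?divr_ge0 ?(ltW r0) // !(mulrC r) !divfK ?gt_eqF //.
by case: (z).
Qed.

Section HalfPlane.
Variables (G : R[i] -> R[i]) (A K M : R).
Hypotheses (hG : holo G) (A0 : 0 <= A) (K0 : 0 <= K) (M0 : 0 <= M).
Hypothesis HG : forall z, normc (G z) <= A * expR (K * normc z).
Hypothesis HM : forall x : R, normc (G x%:C) <= M * (1 + `|x|).

Let K1 : 0 <= K + 1. Proof. by rewrite addr_ge0. Qed.

(* In terms of z = cexp w the factors are exp (i (K + 1) z), which compensates the growth of
   G on the imaginary axis, and exp (- sqrt (z / i)), which absorbs 1 + |x| on the real one. *)
Let P w := G (cexp w) * cexp ((0 +i* (K + 1)) * cexp w) *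
  cexp (- 1 * cexp ((2^-1)%:C * (w + (0 +i* - (pi / 2))))).

Let hP : holo P.
Proof.
apply: holoM; first (apply: holoM; first exact: (holo_comp hG (@holo_cexp R))).
  by apply: holo_cexp_comp; apply: holoM; [exact: holo_cst|exact: holo_cexp].
apply: holo_cexp_comp; apply: holoM; first exact: holo_cst.
apply: holo_cexp_comp; apply: holoM; first exact: holo_cst.
by apply: holoD; [exact: holo_id|exact: holo_cst].
Qed.

Let nP (u v : R) : normc (P (u +i* v)) = normc (G (cexp (u +i* v))) * expR (- ((K + 1) * (expR u * sin v)))
  * expR (- (expR (u / 2) * cos ((v - pi / 2) / 2))).
Proof.
rewrite /P !Normc.normcM !normc_cexp; congr (_ * expR _ * expR _).
  by rewrite /cexp /=; ring.
have -> : (2^-1)%:C * (u +i* v + (0 +i* - (pi / 2))) = (u / 2) +i* ((v - pi / 2) / 2).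
  by apply/eqP; rewrite eq_complex /=; apply/andP; split; apply/eqP; ring.
by rewrite /cexp /=; ring.
Qed.

Let pi0 : 0 < (pi : R). Proof. exact: pi_gt0. Qed.

Let sin_ge0 (v : R) : 0 <= v <= pi -> 0 <= sin v.
Proof. have p0 := pi_gt0 R. by move=> /andP[v0 vp]; rewrite -cosBpihalf; apply: cos_ge0_pihalf; apply/andP; lra. Qed.

Let nP_le (u v : R) : 0 <= v <= pi ->
  normc (P (u +i* v)) <= normc (G (cexp (u +i* v))) * expR (- ((K + 1) * (expR u * sin v))).
Proof.
move=> v0; rewrite nP ler_piMr ?mulr_ge0 ?normc_ge0 ?expR_ge0 //.
rewrite expR_le1 oppr_le0 mulr_ge0 ?expR_ge0 //; apply: cos_ge0_pihalf.
by case/andP: v0 => *; apply/andP; lra.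
Qed.

Let nP_growth (u v : R) : 0 <= v <= pi -> normc (P (u +i* v)) <= A * expR (K * expR u).
Proof.
move=> v0; apply: le_trans (nP_le _ v0) _.
apply: le_trans (_ : normc (G (cexp (u +i* v))) * 1 <= _).
  rewrite ler_wpM2l ?normc_ge0 // expR_le1 oppr_le0 !mulr_ge0 ?expR_ge0 ?sin_ge0 ?K1 //.
by rewrite mulr1; apply: le_trans (HG _) _; rewrite normc_cexp.
Qed.

Let nP_mid (u : R) : normc (P (u +i* (pi / 2))) <= A.
Proof.
have p0 := pi_gt0 R; have k0 := K0; have m0 := M0; have a0 := A0.
have v0 : 0 <= (pi : R) / 2 <= (pi : R) by apply/andP; lra.
apply: le_trans (nP_le _ v0) _; rewrite sin_pihalf mulr1.
apply: le_trans (ler_wpM2r (expR_ge0 _) (HG _)) _; rewrite normc_cexp /= -mulrA -expRD.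
rewrite -[leRHS]mulr1 ler_wpM2l // expR_le1.
by have := expR_ge0 u; lra.
Qed.

Let nP_real (u v : R) : v = 0 \/ v = pi -> normc (P (u +i* v)) <= 4 * M.
Proof.
have p0 := pi_gt0 R; have k0 := K0; have m0 := M0; have a0 := A0.
move=> vE; rewrite nP.
have [x [xE xu]] : exists x : R, cexp (u +i* v) = x%:C /\ `|x| = expR u.
  case: vE => ->; [exists (expR u)|exists (- expR u)]; rewrite /cexp /= ?cos0 ?sin0 ?cospi ?sinpi ?mulr1 ?mulr0 ?mulrN1 ?normrN.
    by rewrite ger0_norm ?expR_ge0.
  by rewrite ger0_norm ?expR_ge0.
have -> : sin v = 0 by case: vE => ->; rewrite ?sin0 ?sinpi.
rewrite !mulr0 oppr0 expR0 mulr1 xE.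
have -> : cos ((v - pi / 2) / 2) = cos (pi / 4).
  case: vE => ->; last by congr cos; field.
  by rewrite -cosN; congr cos; field.
have c2 : cos (pi / 4) ^+ 2 = 1 / 2 :> R.
  have := cos_mulr2n (pi / 4 : R); rewrite (_ : pi / 4 *+ 2 = pi / 2 :> R); last by rewrite mulr2n; field.
  by rewrite cos_pihalf; lra.
have c0 : 0 <= cos (pi / 4) :> R by apply: cos_ge0_pihalf; apply/andP; lra.
set y := expR (u / 2) * cos (pi / 4).
have y0 : 0 <= y by rewrite mulr_ge0 ?expR_ge0.
have y2 : y ^+ 2 = expR u / 2 by rewrite /y exprMn c2 -expRM_natr; congr (expR _ * _); [field|lra].
(* 1 + y^2 / 2 <= exp y with y^2 = |x| / 2 gives 4 + |x| <= 4 exp y: the origin of the factor 4 in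
   front of [M]. *)
have h := expR_ge1Dxn 1 y0.
have h2 : 1 + expR u <= 4 * expR y.
  move: h; rewrite y2 (_ : 2`! = 2)%N //; have := expR_ge0 y; lra.
rewrite expRN ler_pdivrMr ?expR_gt0 //; apply: le_trans (HM x) _; rewrite xu.
by have := ler_wpM2l M0 h2; lra.
Qed.

(* A quadrant is narrow enough for functions of order 1; once P is known to be bounded,
   the strip lemma applies to the whole half plane. *)
Let nP_bounded (u v : R) : 0 <= v <= pi -> normc (P (u +i* v)) <= 4 * M + A.
Proof.
have p0 := pi_gt0 R; have k0 := K0; have m0 := M0; have a0 := A0.
move=> /andP[v0 vp].
have quad (c : R) : (c = pi / 4) \/ (c = 3 / 4 * pi) -> `|v - c| <= pi / 4 -> normc (P (u +i* v)) <= 4 * M + A.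
  (* For half width pi / 4 the exponent [k] may be anything below 2; 3 / 2 exceeds the growth
     exponent 1. *)
  move=> cE; apply: (@PL_strip _ P c (pi / 4) (3 / 2) 1 A K (4 * M + A)) => //; try lra.
    move=> u' v'; rewrite ler_norml mul1r => /andP[v1 v2].
    apply: le_trans (nP_growth _ _) _; first by apply/andP; case: cE => cE; lra.
    by rewrite ler_wpM2l // ler_expR ler_wpM2l // ler_expR ler_norm.
  move=> u' v' vc; have [v1|v1] : v' - c = pi / 4 \/ v' - c = - (pi / 4).
    by case: (leP 0 (v' - c)) vc => h; [rewrite ger0_norm //; left|rewrite ltr0_norm // => <-; right; rewrite opprK].
  - case: cE => cE.
      by have -> : v' = pi / 2 by [lra]; apply: le_trans (nP_mid _) _; lra.
    by apply: le_trans (nP_real _ _) _; [right; lra|lra].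
  - case: cE => cE.
      by apply: le_trans (nP_real _ _) _; [left; lra|lra].
    by have -> : v' = pi / 2 by [lra]; apply: le_trans (nP_mid _) _; lra.
have [h|h] := leP v (pi / 2).
  by apply: (quad (pi / 4)); [left|rewrite ler_norml; apply/andP; lra].
by apply: (quad (3 / 4 * pi)); [right|rewrite ler_norml; apply/andP; lra].
Qed.

Let nP_final (u v : R) : 0 <= v <= pi -> normc (P (u +i* v)) <= 4 * M.
Proof.
have p0 := pi_gt0 R; have k0 := K0; have m0 := M0; have a0 := A0.
move=> /andP[v0 vp].
apply: (@PL_strip _ P (pi / 2) (pi / 2) (3 / 4) (1 / 2) (4 * M + A) 0 (4 * M)) => //; try lra.
- by move=> u' v'; rewrite ler_norml mul0r expR0 mulr1 => /andP[v1 v2]; apply: nP_bounded; apply/andP; lra.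
- move=> u' v' vc; apply: nP_real.
  by case: (leP 0 (v' - pi / 2)) vc => h; [rewrite ger0_norm //; right; lra|rewrite ltr0_norm // => ?; left; lra].
- by rewrite ler_norml; apply/andP; lra.
Qed.

(** Removing the two factors of [P] from [nP_final] costs at most exp ((K + 1) |z|) and exp (sqrt
    |z|), and sqrt |z| <= 1 + |z|. The growth constant [A] has disappeared. *)
Lemma PL_upper z : 0 <= Im z -> normc (G z) <= 4 * M * expR ((K + 2) * normc z + 1).
Proof.
have p0 := pi_gt0 R; have k0 := K0; have m0 := M0; have a0 := A0.
move=> y0; have [->|z0] := eqVneq z 0.
  have := HM 0; rewrite normr0 addr0 mulr1 Normc.normc0 mulr0 add0r => h.
  have e1 : 1 <= expR 1 :> R by rewrite -[leLHS]expR0 ler_expR.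
  by apply: (le_trans h); have := ler_wpM2l M0 e1; lra.
have [u [v [v0 vp zE]]] := polar_upper z0 y0.
have vv : 0 <= v <= pi by rewrite v0.
have := nP_final u vv; rewrite nP -zE -mulrA -expRD.
have nz : normc z = expR u by rewrite zE normc_cexp.
move: (cos _) (cos_le1 ((v - pi / 2) / 2)) => c c1.
set X := _ + _ => h.
have e1 : expR (u / 2) <= 1 + expR u.
  have -> : expR u = expR (u / 2) ^+ 2 by rewrite -expRM_natr; congr expR; field.
  by have := expR_ge0 (u / 2); have := sqr_ge0 (expR (u / 2) - 1 / 2); rewrite sqrrB; lra.
have h1 : - X <= (K + 2) * expR u + 1.
  have i1 : expR (u / 2) * c <= expR (u / 2) by rewrite ler_piMr ?expR_ge0.
  have i2 : (K + 1) * (expR u * sin v) <= (K + 1) * expR u.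
    by apply: ler_wpM2l; [rewrite addr_ge0|rewrite ler_piMr ?expR_ge0 ?sin_le1].
  by rewrite /X; lra.
have -> : normc (G z) = normc (G z) * expR X * expR (- X) by rewrite -mulrA -expRD subrr expR0 mulr1.
rewrite nz; apply: ler_pM; rewrite ?mulr_ge0 ?normc_ge0 ?expR_ge0 //.
by rewrite ler_expR.
Qed.
End HalfPlane.

Lemma PL_plane (G : R[i] -> R[i]) (A K M : R) : holo G -> 0 <= A -> 0 <= K -> 0 <= M ->
  (forall z, normc (G z) <= A * expR (K * normc z)) ->
  (forall x : R, normc (G x%:C) <= M * (1 + `|x|)) ->
  forall z, normc (G z) <= 4 * M * expR ((K + 2) * normc z + 1).
Proof.
move=> hG A0 K0 M0 HG HM z; have [z0|z0] := leP 0 (Im z); first exact: (PL_upper hG A0 K0 M0 HG HM).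
have hN : holo (fun w : R[i] => -1 * w) by apply: holoM; [exact: holo_cst|exact: holo_id].
have := @PL_upper (fun w => G (-1 * w)) A K M (holo_comp hG hN) A0 K0 M0 _ _ (- z).
rewrite mulN1r opprK normcN; apply.
- by move=> w; apply: le_trans (HG _) _; rewrite mulN1r normcN.
- by move=> x; rewrite mulN1r -(normrN x); have := HM (- x); rewrite rmorphN.
- by case: (z) z0 => a b /= b0; rewrite oppr_ge0 ltW.
Qed.
End PhragmenLindelofPlane.

(** * Growth of entire functions and integral bounds for primitives *)

Section Entire.
Context {R : realType}.
Implicit Types (f : R[i] -> R[i]) (z w : R[i]).

Lemma entire_holo (f : R[i]^o -> R[i]^o) : entire f -> holo f.
Proof. by move=> hf z; exists ('D_1 (f : R[i]^o -> R[i]^o) (z : R[i]^o)); apply/cderP; exact: derivableP. Qed.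

Lemma holo_entire f : holo f -> entire (f : R[i]^o -> R[i]^o).
Proof. by move=> hf z; have [d /cderP[]] := hf z. Qed.

(** The gap between 1 and 2 turns the limsup into a bound valid for |z| >= s. The rest follows from
    the maximum principle on the square of half side s, whose boundary has moduli between s and 2
    s. *)
Lemma exp_type_bound (f : R[i]^o -> R[i]^o) : holo f -> (exp_type f <= 1)%E ->
  exists2 C : R, 0 <= C & forall z, normc (f z) <= C * expR (2 * normc z).
Proof.
move=> hf; rewrite /exp_type /limf_esup => f1.
have : (ereal_inf [set ereal_sup ((fun z : R[i]^o => ((normc z)^-1)%:E * lne (normc (f z))%:E) @` V) |
   V in filter_from [set: R] (fun r => [set z | (r < normc z)%R])]%classic < 2%:E)%E.
  by apply: le_lt_trans f1 _; rewrite lte_fin ltr1n.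
move=> /ereal_inf_lt[_ [V [r _ rV] <-]] Vlt.
pose s := Num.max r 0 + 1.
have s1 : 1 <= s by rewrite /s lerDr le_max lexx orbT.
have rs : r < s by rewrite /s; have : r <= Num.max r 0 by [rewrite le_max lexx]; lra.
have big z : s <= normc z -> normc (f z) <= expR (2 * normc z).
  move=> sz; have z0 : 0 < normc z by lra.
  have [->|fz0] := eqVneq (normc (f z)) 0; first exact: expR_ge0.
  have fz : 0 < normc (f z) by rewrite lt_neqAle eq_sym fz0 normc_ge0.
  have : (((normc z)^-1)%:E * lne (normc (f z))%:E < 2%:E)%E.
    apply: le_lt_trans Vlt; apply: ereal_sup_ubound; exists z => //.
    by apply: rV => /=; apply: lt_le_trans sz.
  rewrite lne_EFin // -EFinM lte_fin mulrC ltr_pdivrMr // => h.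
  by rewrite -[leLHS]lnK ?posrE // ler_expR ltW.
exists (expR (4 * s)) => [|z]; first exact: expR_ge0.
have E1 : 1 <= expR (4 * s) by rewrite -[leLHS]expR0 ler_expR; lra.
have E2 : 1 <= expR (2 * normc z) by rewrite -[leLHS]expR0 ler_expR mulr_ge0 ?normc_ge0.
have [sz|zs] := leP s (normc z); first by apply: le_trans (big z sz) _; rewrite ler_peMl // expR_ge0.
apply: le_trans (_ : expR (4 * s) <= _); last by rewrite ler_peMr // expR_ge0.
have ReIm : `|Re z| <= s /\ `|Im z| <= s.
  by split; apply: le_trans (ltW zs); [exact: Re_le_normc|exact: Im_le_normc].
case: z ReIm {zs E2} => x y /= []; rewrite !ler_norml => xs ys.
apply: (@max_rect _ f (- s) s (- s) s) => // {}x {}y {}xs {}ys H.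
have zs : s <= normc (x +i* y) /\ normc (x +i* y) <= 2 * s.
  have h1 := Re_le_normc (x +i* y); have h2 := Im_le_normc (x +i* y); have h3 := normc_le_ReIm (x +i* y).
  move: h1 h2 h3 => /=; rewrite -!ler_norml in xs ys; move=> h1 h2 h3; split; last by lra.
  have s0 : 0 <= s by lra.
  have ns : `|s| = s by rewrite ger0_norm.
  by case: H => [E|[E|[E|E]]]; subst; rewrite ?normrN ns in h1 h2; lra.
by apply: le_trans (big _ zs.1) _; rewrite ler_expR; lra.
Qed.

(** As for [rder_le], [g] is multiplied by the conjugate of its increment [w]; after subtraction of
    [normc w * Q] the real part has a nonpositive derivative. *)
Lemma rder_le_primitive (g g' : R -> R[i]) (Q q : R -> R) (a b : R) : a <= b ->
  (forall t, a <= t <= b -> rder g t (g' t)) -> (forall t, a <= t <= b -> is_derive t 1 Q (q t)) ->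
  (forall t, a <= t <= b -> normc (g' t) <= q t) ->
  normc (g b - g a) <= Q b - Q a.
Proof.
move=> ab Hg HQ Hq; set w := g b - g a.
have Q0 : 0 <= Q b - Q a.
  have := @rder_Re_le _ (fun t => - 1 * (Q t)%:C) (fun t => - 1 * (q t)%:C) a b 0 ab.
  rewrite mul0r -mulrBr -rmorphB mulN1r /= oppr_le0; apply => t tab; split.
    by apply: rderMl; apply/rderP; split; [exact: HQ|exact: is_derive_cst].
  have -> : -1 * q t - - 0 * 0 = - q t by ring.
  by rewrite oppr_le0; apply: le_trans (Hq t tab); exact: normc_ge0.
have [->|w0] := eqVneq w 0; first by rewrite Normc.normc0.
have nw : 0 < normc w by apply: normc_gt0.
have ww : Re (conjc w * w) = normc w ^+ 2.
  by rewrite sqr_normcE; case: (w) => x y /=; ring.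
have := @rder_Re_le _ (fun t => conjc w * g t + (- (normc w)%:C) * (Q t)%:C) (fun t => conjc w * g' t + (- (normc w)%:C) * (q t)%:C) a b 0 ab.
have -> : conjc w * g b + (- (normc w)%:C) * (Q b)%:C - (conjc w * g a + (- (normc w)%:C) * (Q a)%:C) =
  conjc w * w + (- (normc w * (Q b - Q a)))%:C by rewrite /w rmorphN rmorphM rmorphB /=; ring.
have -> : Re (conjc w * w + (- (normc w * (Q b - Q a)))%:C) = normc w * (normc w - (Q b - Q a)).
  have -> : forall p (t : R), Re (p + t%:C) = Re p + t by move=> [].
  by rewrite ww; ring.
rewrite mul0r pmulr_rle0 // subr_le0; apply => t tab; split.
  apply: rderD; first by apply: rderMl; exact: Hg.
  by apply: rderMl; apply/rderP; split; [exact: HQ|exact: is_derive_cst].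
have -> : conjc w * g' t + - (normc w)%:C * (q t)%:C = conjc w * g' t + (- (normc w * q t))%:C.
  by rewrite mulNr -rmorphM -rmorphN.
have -> : forall p (t : R), Re (p + t%:C) = Re p + t by move=> [].
rewrite subr_le0; apply: le_trans (Re_le_norm _) _.
rewrite Normc.normcM; have -> : normc (conjc w) = normc w by case: (w) => x y; rewrite /normc /= sqrrN.
by rewrite ler_pM2l // Hq.
Qed.

Lemma holo_real_continuous f : holo f -> continuous (fun t : R => normc (f t%:C)).
Proof.
move=> hf t U /(@normc_continuous _ _ hf (t, 0))[[A B] /= [hA hB] AB].
by apply: filterS hA => s As; apply: (AB (s, 0)); split => //=; exact: nbhs_singleton.
Qed.

Lemma primitive_integral_le (h G : R[i] -> R[i]) (a b : R) : holo h -> (forall z, cder G z (h z)) -> a <= b ->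
  ((normc (G b%:C - G a%:C))%:E <= \int[@lebesgue_measure R]_(t in `[a, b]) (normc (h t%:C))%:E)%E.
Proof.
move=> hh HG; rewrite le_eqVlt => /orP[/eqP ->|ab].
  by rewrite subrr Normc.normc0; apply: integral_ge0 => t _; rewrite lee_fin normc_ge0.
have ch := holo_real_continuous hh.
have [Q HQ] := continuous_primitive ch.
rewrite (@continuous_FTC2 _ _ Q) //.
- rewrite -EFinB lee_fin.
  apply: (@rder_le_primitive (fun t => G t%:C) (fun t => h t%:C) Q (fun t => normc (h t%:C))) => //; first exact: ltW.
  move=> t _; exact: (cder_horizontal (HG (t +i* 0))).
- exact: continuous_subspaceT.
- split => [t _||]; first by have [] := HQ t.
  + by apply: cvg_at_right_filter; apply: differentiable_continuous; apply/derivable1_diffP; have [] := HQ a.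
  + by apply: cvg_at_left_filter; apply: differentiable_continuous; apply/derivable1_diffP; have [] := HQ b.
- by move=> t _; rewrite derive1E; have [_ ->] := HQ t.
Qed.
End Entire.

(** * Pointwise bounds from the weighted norm *)

Section Pointwise.
Context {R : realType}.
Notation mu := (@lebesgue_measure R).
Implicit Types (f : R[i] -> R[i]) (z w : R[i]).

Definition weight f (a t : R) : R := normc (f t%:C) ^+ 2 * `|t| `^ (2 * a + 1).

Lemma weight_ge0 f a t : 0 <= weight f a t.
Proof. by rewrite mulr_ge0 ?sqr_ge0 ?powR_ge0. Qed.

Lemma measurable_abs_powR (p : R) (D : set R) : measurable_fun D (fun t : R => `|t| `^ p).
Proof.
apply: measurable_funTS; apply: (measurableT_comp (measurable_powR p)); exact: normr_measurable.
Qed.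

Lemma measurable_weight f a (D : set R) : holo f -> measurable_fun D (weight f a).
Proof.
move=> hf; apply: measurable_funM; last exact: measurable_abs_powR.
apply: measurable_funTS; apply: measurable_funX; apply: continuous_measurable_fun; exact: holo_real_continuous.
Qed.

Lemma weighted_sqnormE a f : weighted_sqnorm a f = (\int[mu]_t (weight f a t)%:E)%E.
Proof. by []. Qed.

Section Bound.
Variables (f : R[i] -> R[i]) (a N : R).
Hypotheses (hf : holo f) (a1 : -1 < a) (HN : weighted_sqnorm a f = N%:E).

Lemma sqnorm_ge0 : 0 <= N.
Proof. by rewrite -lee_fin -HN; apply: integral_ge0 => t _; rewrite lee_fin weight_ge0. Qed.

(* 2 a + 1 < n <= 2 a + 2, so that |s|^n <= (1 + |x|) |s|^(2 a + 1) for |s| <= |x|. *)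
Let n := Num.truncn (2 * (a + 1)).
Let h z := f z ^+ 2 * z ^+ n.

Lemma n_itv : 2 * a + 1 < n%:R /\ n%:R <= 2 * a + 2.
Proof.
have a1' := a1; have /Num.Theory.truncn_itv/andP : 0 <= 2 * (a + 1) by lra.
by rewrite -/n -natr1; lra.
Qed.

Let hh : holo h.
Proof.
have hX (g : R[i] -> R[i]) k : holo g -> holo (fun z => g z ^+ k).
  by move=> hg z; have [d hd] := hg z; eexists; exact: cderX hd.
by apply: holoM; apply: hX => //; exact: holo_id.
Qed.

Let h_le (x s : R) : s != 0 -> `|s| <= `|x| -> normc (h s%:C) <= (1 + `|x|) * weight f a s.
Proof.
move=> s0 sx; have [n1 n2] := n_itv; have s0' : 0 < `|s| by rewrite normr_gt0.
rewrite /h Normc.normcM !normcX normcR /weight mulrCA; apply: ler_wpM2l; first exact: sqr_ge0.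
rewrite -powR_mulrn // (_ : n%:R = (n%:R - (2 * a + 1)) + (2 * a + 1)); last by rewrite subrK.
rewrite powRD ?(gt_eqF s0') ?implybT // ler_wpM2r ?powR_ge0 //.
have [l1|l1] := leP `|s| 1.
  apply: le_trans (_ : 1 <= _); last by rewrite lerDl.
  by rewrite -[leRHS](powRr0 `|s|); apply: ger_powR; rewrite ?s0' ?l1 //; lra.
apply: le_trans (_ : `|s| <= _); last by have := normr_ge0 x; lra.
by rewrite -[leRHS]powRr1 //; apply: ler_powR; [exact: ltW|lra].
Qed.

Let int_h_le (x : R) (D : set R) : measurable D -> (forall s, D s -> s != 0 /\ `|s| <= `|x|) ->
  (\int[mu]_(s in D) (normc (h s%:C))%:E <= (N * (1 + `|x|))%:E)%E.
Proof.
move=> mD HD; apply: (@le_trans _ _ (\int[mu]_(s in D) ((1 + `|x|)%:E * (weight f a s)%:E))%E).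
  apply: ge0_le_integral => //.
  - by move=> s _; rewrite lee_fin normc_ge0.
  - by apply/measurable_EFinP; apply: measurable_funTS; apply: continuous_measurable_fun; exact: holo_real_continuous.
  - by apply/measurable_EFinP; apply: measurable_funM; [exact: measurable_cst|exact: measurable_weight].
  - by move=> s /HD[s0 sx]; rewrite -EFinM lee_fin h_le.
have x0 : 0 <= 1 + `|x| by rewrite addr_ge0.
rewrite ge0_integralZl_EFin //; last 2 first.
- by move=> s _; rewrite lee_fin weight_ge0.
- by apply/measurable_EFinP; exact: measurable_weight.
rewrite mulrC EFinM; apply: lee_wpmul2l; first by rewrite lee_fin.
rewrite -HN weighted_sqnormE; apply: ge0_subset_integral => //.
- by apply/measurable_EFinP; exact: measurable_weight.
- by move=> s _; rewrite lee_fin weight_ge0.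
Qed.

Lemma primitive_real_growth (G : R[i] -> R[i]) : (forall z, cder G z (h z)) -> G 0 = 0 ->
  forall x : R, normc (G x%:C) <= N * (1 + `|x|).
Proof.
move=> HG G0 x; rewrite -lee_fin.
have mh D : measurable_fun D (fun s : R => (normc (h s%:C))%:E).
  by apply/measurable_EFinP; apply: measurable_funTS; apply: continuous_measurable_fun; exact: holo_real_continuous.
have G0' : G (0 : R)%:C = 0 by [].
have [x0|x0|x0] := ltgtP 0 x; last first.
- by rewrite -x0 G0' Normc.normc0 lee_fin mulr_ge0 ?addr_ge0 // sqnorm_ge0.
- have := primitive_integral_le hh HG (ltW x0); rewrite G0' sub0r normcN => /le_trans; apply.
  (* The end point 0 is removed: for n = 0 the comparison of powers may fail there, since [0 ^ p] is
     0 for negative p. *)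
  rewrite -integral_itv_bndo_bndc //; apply: int_h_le => // s /=; rewrite in_itv /= => /andP[s1 s2].
  by split; [rewrite lt_eqF|rewrite !ltr0_norm // lerN2].
- have := primitive_integral_le hh HG (ltW x0); rewrite G0' subr0 => /le_trans; apply.
  rewrite -integral_itv_obnd_cbnd //; apply: int_h_le => // s /=; rewrite in_itv /= => /andP[s1 s2].
  by split; [rewrite gt_eqF|rewrite !gtr0_norm].
Qed.

Hypothesis Hexp : exists2 C : R, 0 <= C & forall z, normc (f z) <= C * expR (2 * normc z).

(** [Hexp] and |z|^(n + 1) <= (n + 1)! exp |z| give some growth exp (5 |z|) of [G], with a constant
    depending on [f] that [PL_plane] eliminates. The Cauchy estimate on unit circles replaces 7 |z|
    + 1 by 7 (|z| + 1) + 1. *)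
Let h_bound z : normc (h z) <= 4 * N * expR (7 * normc z + 8).
Proof.
have [C C0 HC] := Hexp.
have [G1 HG1] := holo_primitive hh.
pose G z := G1 z - G1 0.
have HG w : cder G w (h w) by apply: cder_eq (cderB (HG1 w) (cder_cst (G1 0) w)) _; rewrite subr0.
have G0 : G 0 = 0 by rewrite /G subrr.
pose A := C ^+ 2 * (n.+1)`!%:R.
have A0 : 0 <= A by rewrite mulr_ge0 // sqr_ge0.
have growth w : normc (G w) <= A * expR (5 * normc w).
  have w0 := normc_ge0 w.
  have e1 : normc (G w) <= C ^+ 2 * expR (4 * normc w) * normc w ^+ n * normc w.
    have := @cder_le _ G h 0 w (C ^+ 2 * expR (4 * normc w) * normc w ^+ n).
    rewrite add0r G0 subr0; apply => t /andP[t0 t1]; split; first exact: HG.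
    have tw : normc (0 + t%:C * w) <= normc w by rewrite add0r Normc.normcM normcR ger0_norm // ler_piMl.
    rewrite /h Normc.normcM !normcX; apply: ler_pM; rewrite ?exprn_ge0 ?normc_ge0 //.
      have -> : 4 * normc w = (2 * normc w) * 2%:R by ring.
      rewrite expRM_natr -exprMn lerXn2r ?nnegrE ?mulr_ge0 ?normc_ge0 ?expR_ge0 //.
      by apply: le_trans (HC _) _; rewrite ler_wpM2l // ler_expR ler_wpM2l.
    by rewrite lerXn2r ?nnegrE ?normc_ge0.
  apply: le_trans e1 _; rewrite -mulrA -exprSr /A.
  have -> : 5 * normc w = 4 * normc w + normc w by ring.
  rewrite expRD.
  have -> : C ^+ 2 * n.+1`!%:R * (expR (4 * normc w) * expR (normc w)) =
     C ^+ 2 * expR (4 * normc w) * (n.+1`!%:R * expR (normc w)) by ring.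
  rewrite ler_wpM2l ?mulr_ge0 ?sqr_ge0 ?expR_ge0 // mulrC -ler_pdivrMr ?ltr0n ?fact_gt0 //.
  by apply: le_trans (expR_ge1Dxn n w0); rewrite lerDr.
have hG : holo G by move=> w; exists (h w).
have PL := PL_plane hG A0 (ler0n _ 5) sqnorm_ge0 growth (primitive_real_growth HG G0).
have := @cauchy_estimate _ G h z 1 (4 * N * expR (7 * normc z + 8)) HG ltr01; rewrite divr1; apply => w w1.
apply: le_trans (PL _) _; rewrite ler_wpM2l ?mulr_ge0 ?sqnorm_ge0 // ler_expR.
by have := le_normcD z w; rewrite w1; lra.
Qed.

(** On the boundary r <= |z| <= 2 r, so that |z|^n >= r^n >= r^(2 a + 1), the last step by r >= 1,
    and 7 |z| <= 14 r. *)
Lemma sqr_le_square (r x y : R) : 1 <= r -> `|x| <= r -> `|y| <= r ->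
  normc (f (x +i* y)) ^+ 2 <= 4 * N * expR (14 * r + 8) * r `^ (- (2 * a + 1)).
Proof.
move=> r1; rewrite !ler_norml => xr yr; rewrite -normcX.
have r0 : 0 < r by lra.
have B0 : 0 <= 4 * N * expR (14 * r + 8) * r `^ (- (2 * a + 1)).
  by rewrite !mulr_ge0 ?sqnorm_ge0 ?expR_ge0 ?powR_ge0.
apply: (@max_rect _ (fun z => f z ^+ 2) (- r) r (- r) r) => //.
  by move=> z; have [d hd] := hf z; eexists; exact: cderX hd.
move=> {}x {}y {}xr {}yr H.
have [zr1 zr2] : r <= normc (x +i* y) /\ normc (x +i* y) <= 2 * r.
  have h1 := Re_le_normc (x +i* y); have h2 := Im_le_normc (x +i* y); have h3 := normc_le_ReIm (x +i* y).
  move: h1 h2 h3 => /=; rewrite -!ler_norml in xr yr; move=> h1 h2 h3; split; last by lra.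
  have nr : `|r| = r by rewrite ger0_norm // ltW.
  by case: H => [E|[E|[E|E]]]; subst; rewrite ?normrN nr in h1 h2; lra.
set z := x +i* y in zr1 zr2 *.
have := h_bound z; rewrite /h Normc.normcM [normc (z ^+ n)]normcX => hb.
have [n1 n2] := n_itv.
have zn : r `^ (2 * a + 1) <= normc z ^+ n.
  apply: le_trans (_ : r ^+ n <= _); last by rewrite lerXn2r ?nnegrE ?normc_ge0 // ltW.
  by rewrite -powR_mulrn ?(ltW r0) //; apply: ler_powR => //; exact: ltW.
have p0 : 0 < r `^ (2 * a + 1) by rewrite powR_gt0.
rewrite powRN ler_pdivlMr //.
apply: le_trans (_ : normc (f z ^+ 2) * normc z ^+ n <= _); first by rewrite ler_wpM2l ?normc_ge0.
apply: le_trans hb _; rewrite ler_wpM2l ?mulr_ge0 ?sqnorm_ge0 // ler_expR; lra.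
Qed.

End Bound.
End Pointwise.

(** * Integrals of powers *)

Section PowerIntegrals.
Context {R : realType}.
Notation mu := (@lebesgue_measure R).
Local Open Scope classical_set_scope.
Local Open Scope ereal_scope.

Lemma integral_even_symmetric (f : R -> \bar R) (D : set R) : measurable D ->
  measurable_fun setT f -> (forall t, 0 <= f t) -> (forall t, f (- t)%R = f t) ->
  (forall t, D t -> D (- t)%R) ->
  \int[mu]_(t in D) f t = 2%:E * \int[mu]_(t in `]0%R, +oo[ `&` D) f t.
Proof.
move=> mD mf f0 ef eD; rewrite integral_mkcondr [LHS]integral_mkcond.
set g := f \_ D.
have mg : measurable_fun setT g by apply/(measurable_restrictT f mD); exact: measurable_funTS.
have g0 t : 0 <= g t by apply: erestrict_ge0 => ? _; exact: f0.
have eg t : g (- t)%R = g t.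
  have DN : D (- t)%R = D t.
    by apply/propext; split; [move=> /eD; rewrite opprK|exact: eD].
  rewrite /g /patch ef (_ : ((- t)%R \in D) = (t \in D)) //.
  by apply/idP/idP; rewrite !inE DN.
have mgD A : measurable_fun A g by exact: measurable_funTS.
rewrite -(setUv `]0%R, +oo[%classic) ge0_integral_setU //=; last 3 first.
- exact: measurableC.
- by rewrite setUv.
- by rewrite disj_set2E setICr.
rewrite setCitvr mule_natl mule2n; congr (_ + _).
have E : \int[mu]_(r in `[0%R, +oo[) g r = \int[mu]_(r in `]-oo, 0%R]) g r.
  by rewrite ge0_integration_by_substitution0 //; apply: eq_integral => r _; rewrite eg.
by rewrite -E -integral_itv_obnd_cbnd.
Qed.

Lemma integral_powR_near0 (p r : R) : (0 < p)%R -> (0 < r)%R ->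
  \int[mu]_(t in `]0%R, r]) (t `^ (p - 1))%:E = (r `^ p / p)%:E.
Proof.
move=> p0 r0.
(* The integrand may be unbounded at 0, so the fundamental theorem is applied on an exhaustion;
   [k.+2] keeps the intervals nondegenerate. *)
pose F k : set R := `[(r / k.+2%:R)%R, r].
have rk k : (0 < r / k.+2%:R)%R by rewrite divr_gt0.
have UF : \bigcup_k F k = `]0%R, r].
  apply/seteqP; split => [t [k _]|t]; rewrite /F /= !in_itv /= => /andP[t0 tr].
    by rewrite tr (lt_le_trans _ t0).
  exists (Num.bound (r / t)) => //=; rewrite in_itv /= tr andbT ler_pdivrMr // mulrC -ler_pdivrMr //.
  apply/ltW; apply: lt_trans (archi_boundP _) _; first by rewrite divr_ge0 // ltW.
  by rewrite ltr_nat ltnW.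
have FTC k : \int[mu]_(t in F k) (t `^ (p - 1))%:E = ((r `^ p / p)%:E - ((r / k.+2%:R) `^ p / p)%:E).
  have pos (t : R) : (r / k.+2%:R <= t)%R -> (0 < t)%R by move=> h; apply: lt_le_trans (rk k) h.
  have der (t : R) : (0 < t)%R -> is_derive t (1%R : R) (fun t : R => t `^ p / p)%R (t `^ (p - 1))%R.
    move=> t0; have h := is_deriveM (is_derive1_powR p t0) (is_derive_cst (p^-1)%R t (1%R : R)).
    apply: is_derive_eq h _; rewrite scaler0 add0r /GRing.scale /= mulrA mulVf ?mul1r //.
    by rewrite gt_eqF.
  have cont (t : R) : (0 < t)%R -> {for t, continuous (fun t : R => t `^ p / p)%R}.
    by move=> t0; apply: differentiable_continuous; apply/derivable1_diffP; have [] := der t t0.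
  rewrite (@continuous_FTC2 _ _ (fun t : R => t `^ p / p)%R) //.
  - by rewrite ltr_pdivrMr // ltr_pMr // ltr1n.
  - apply: continuous_in_subspaceT => t; rewrite inE /= in_itv /= => /andP[/pos t0 _].
    by apply: differentiable_continuous; apply/derivable1_diffP; have [] := is_derive1_powR (p - 1)%R t0.
  - split.
    + by move=> t; rewrite in_itv /= => /andP[/ltW/pos t0 _]; have [] := der t t0.
    + by apply: cvg_at_right_filter; apply: cont.
    + by apply: cvg_at_left_filter; apply: cont.
  - by move=> t; rewrite in_itv /= => /andP[/ltW/pos t0 _]; rewrite derive1E; have [_ ->] := der t t0.
have L1 : \int[mu]_(t in F k) (t `^ (p - 1))%:E @[k --> \oo] --> \int[mu]_(t in `]0%R, r]) (t `^ (p - 1))%:E.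
  rewrite -UF; apply: ge0_nondecreasing_set_cvg_integral.
  - apply/nondecreasing_seqP => k; rewrite subsetEset => t; rewrite /F /= !in_itv /= => /andP[t0 ->].
    rewrite andbT (le_trans _ t0) // ler_wpM2l ?(ltW r0) // lef_pV2 ?posrE //.
    by rewrite ler_nat.
  - by move=> k; exact: measurable_itv.
  - by move=> k; apply/measurable_EFinP; apply: measurable_funTS; exact: measurable_powR.
  - by move=> k t _; rewrite lee_fin powR_ge0.
have L2 : \int[mu]_(t in F k) (t `^ (p - 1))%:E @[k --> \oo] --> (r `^ p / p)%:E.
  under eq_cvg do rewrite FTC -EFinB.
  apply: cvg_EFin; first by near=> k.
  rewrite -[X in _ --> X]subr0; apply: cvgB; first exact: cvg_cst.
  rewrite -[X in _ --> X](mul0r (p^-1)%R); apply: cvgM; last exact: cvg_cst.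
  apply: (@cvg_comp _ _ _ (fun k : nat => (r / k.+2%:R)%R) (fun x => x `^ p)%R _ (0%R : R)^'+); last exact: powR_cvg0.
  move=> U [e /= e0 He]; near=> k; apply: He; last exact: rk.
  rewrite /= sub0r normrN gtr0_norm // ltr_pdivrMr // mulrC -ltr_pdivrMr //.
  by apply: lt_trans (_ : (k%:R < _)%R); [near: k; exact: nbhs_infty_gtr|rewrite ltr_nat].
by apply: (cvg_unique _ L1 L2).
Unshelve. all: by end_near. Qed.

Lemma integral_powR_infty (q r : R) : (0 < q)%R -> (0 < r)%R ->
  \int[mu]_(t in `[r, +oo[) (t `^ (- q - 1))%:E = (r `^ (- q) / q)%:E.
Proof.
move=> q0 r0.
have der (t : R) : (0 < t)%R -> is_derive t (1%R : R) (fun t : R => t `^ (- q) * - q^-1)%R (t `^ (- q - 1))%R.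
  move=> t0; have h := is_deriveM (is_derive1_powR (- q) t0) (is_derive_cst (- q^-1)%R t (1%R : R)).
  apply: is_derive_eq h _; rewrite scaler0 add0r /GRing.scale /= mulrA mulrNN mulVf ?mul1r //.
  by rewrite gt_eqF.
have cont (t : R) : (0 < t)%R -> {for t, continuous (fun t : R => t `^ (- q) * - q^-1)%R}.
  by move=> t0; apply: differentiable_continuous; apply/derivable1_diffP; have [] := der t t0.
rewrite (@ge0_continuous_FTC2y _ _ (fun t : R => t `^ (- q) * - q^-1)%R _ 0%R) //.
- by rewrite -EFinB sub0r mulrN opprK.
- by move=> t _; exact: powR_ge0.
- apply: continuous_in_subspaceT => t; rewrite inE /= in_itv /= andbT => rt.
  have t0 : (0 < t)%R by exact: lt_le_trans rt.
  by apply: differentiable_continuous; apply/derivable1_diffP; have [] := is_derive1_powR (- q - 1)%R t0.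
- rewrite -[X in _ --> X](mul0r (- q^-1)%R); apply: cvgM; last exact: cvg_cst.
  apply/cvgrPdist_lt => e e0; near=> t.
  have a0 : (0 < e `^ (- q^-1))%R by rewrite powR_gt0.
  have ta : (e `^ (- q^-1) < t)%R by near: t; apply: nbhs_pinfty_gt; rewrite num_real.
  have t0 : (0 < t)%R := lt_trans a0 ta.
  rewrite sub0r normrN ger0_norm ?powR_ge0 // powRN -[e]invrK ltf_pV2 ?posrE ?invr_gt0 ?powR_gt0 //.
  have := gt0_ltr_powR q0 (_ : _ \in Num.nneg) (_ : _ \in Num.nneg) ta.
  rewrite -powRrM mulNr mulVf ?gt_eqF // powR_inv1 ?(ltW e0) // => -> //; rewrite nnegrE ltW //.
- by move=> t rt; have [] := der t (lt_trans r0 rt).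
- by apply: cvg_at_right_filter; apply: cont.
- by move=> t; rewrite in_itv /= andbT => rt; rewrite derive1E; have [_ ->] := der t (lt_trans r0 rt).
Unshelve. all: by end_near. Qed.

End PowerIntegrals.

(** * Comparison of weighted norms *)

Section NormComparison.
Context {R : realType}.
Notation mu := (@lebesgue_measure R).
Implicit Types (f : R[i] -> R[i]).

Lemma integral_absR_powR (a r : R) : -1 < a -> 0 < r ->
  (\int[mu]_(t in `[(- r)%R, r]%classic) (`|t| `^ (2 * a + 1))%:E = (r `^ (2 * (a + 1)) / (a + 1))%:E)%E.
Proof.
move=> a1 r0; have a2 : 0 < a + 1 by lra.
rewrite (@integral_even_symmetric _ (fun t => (`|t| `^ (2 * a + 1))%:E)) //; last 3 first.
- by apply/measurable_EFinP; exact: measurable_abs_powR.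
- by move=> t; rewrite normrN.
- by move=> t /=; rewrite !in_itv /= => /andP[t1 t2]; rewrite lerN2 t2 lerNl.
have -> : (`]0%R, +oo[ `&` `[(- r)%R, r] = `]0%R, r])%classic.
  apply/seteqP; split => t /=; rewrite !in_itv /= ?andbT.
    by move=> [-> /andP[_ ->]].
  by move=> /andP[t0 ->]; rewrite t0 andbT; split => //; lra.
have -> : (\int[mu]_(t in `]0%R, r]%classic) (`|t| `^ (2 * a + 1))%:E = \int[mu]_(t in `]0%R, r]%classic) (t `^ (2 * (a + 1) - 1))%:E)%E.
  apply: eq_integral => t; rewrite inE /= in_itv /= => /andP[t0 _]; rewrite gtr0_norm //.
  by congr (_ `^ _)%:E; ring.
rewrite integral_powR_near0 ?mulr_gt0 // -EFinM; congr _%:E.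
by field; rewrite gt_eqF.
Qed.

Lemma integral_absR_powR_tail (s r : R) : 0 < s -> 0 < r ->
  (\int[mu]_(t in ~` `](- r)%R, r[%classic) (`|t| `^ (- (2 * s) - 1))%:E = (r `^ (- (2 * s)) / s)%:E)%E.
Proof.
move=> s0 r0.
rewrite (@integral_even_symmetric _ (fun t => (`|t| `^ (- (2 * s) - 1))%:E)) //; last 4 first.
- exact: measurableC.
- by apply/measurable_EFinP; exact: measurable_abs_powR.
- by move=> t; rewrite normrN.
- by move=> t /= H; contradict H; move: H; rewrite !in_itv /= => /andP[t1 t2]; apply/andP; lra.
have -> : (`]0%R, +oo[ `&` ~` `](- r)%R, r[ = `[r, +oo[)%classic.
  apply/seteqP; split => t /=; rewrite !in_itv /= ?andbT.
    move=> [t0 /negP]; rewrite negb_and -!leNgt => /orP[|//]; lra.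
  by move=> rt; split; [lra|apply/negP; rewrite negb_and -!leNgt rt orbT].
have -> : (\int[mu]_(t in `[r, +oo[%classic) (`|t| `^ (- (2 * s) - 1))%:E = \int[mu]_(t in `[r, +oo[%classic) (t `^ (- (2 * s) - 1))%:E)%E.
  by apply: eq_integral => t; rewrite inE /= in_itv /= andbT => rt; rewrite ger0_norm //; lra.
rewrite integral_powR_infty ?mulr_gt0 // -EFinM; congr _%:E.
by field; rewrite gt_eqF.
Qed.

(** The second majorant [v] serves for the quadratic term of a Lipschitz bound at 0 and for the
    indicator of the origin; elsewhere it is 0. *)
Lemma integral_le_lin (D : set R) (F u v : R -> R) (p q U V : R) : measurable D ->
  measurable_fun D F -> measurable_fun D u -> measurable_fun D v ->
  (forall t, 0 <= F t) -> (forall t, 0 <= u t) -> (forall t, 0 <= v t) -> 0 <= p -> 0 <= q ->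
  (forall t, D t -> F t <= p * u t + q * v t) ->
  (\int[mu]_(t in D) (u t)%:E <= U%:E)%E -> (\int[mu]_(t in D) (v t)%:E <= V%:E)%E ->
  (\int[mu]_(t in D) (F t)%:E <= (p * U + q * V)%:E)%E.
Proof.
move=> mD mF mU mV F0 u0 v0 p0 q0 H HU HV.
have mpu : measurable_fun D (fun t => (p%:E * (u t)%:E)%E).
  by apply/measurable_EFinP; apply: measurable_funM => //; exact: measurable_cst.
have mqv : measurable_fun D (fun t => (q%:E * (v t)%:E)%E).
  by apply/measurable_EFinP; apply: measurable_funM => //; exact: measurable_cst.
apply: (@le_trans _ _ (\int[mu]_(t in D) (p%:E * (u t)%:E + q%:E * (v t)%:E))%E).
  by apply: ge0_le_integral => //; try (by move=> t _; rewrite lee_fin); try exact/measurable_EFinP; try exact: emeasurable_funD.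
rewrite ge0_integralD //; try (by move=> t _; rewrite -EFinM lee_fin mulr_ge0).
rewrite !ge0_integralZl_EFin //; try (by move=> t _; rewrite lee_fin); try exact/measurable_EFinP.
by rewrite EFinD !EFinM; apply: leeD; apply: lee_wpmul2l.
Qed.

Lemma weighted_sqnorm_split f (b r : R) : holo f ->
  (weighted_sqnorm b f = \int[mu]_(t in ~` `](- r)%R, r[%classic) (weight f b t)%:E +
     \int[mu]_(t in `](- r)%R, r[%classic) (weight f b t)%:E)%E.
Proof.
move=> hf; rewrite weighted_sqnormE -(setvU `](- r)%R, r[%classic) ge0_integral_setU //.
- exact: measurableC.
- by apply/measurable_EFinP; exact: measurable_weight.
- by move=> t _; rewrite lee_fin weight_ge0.
- by rewrite disj_set2E setICl.
Qed.

Lemma weight_outer f (a b r t : R) : 0 < r -> b <= a -> r <= `|t| ->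
  weight f b t <= r `^ (- (2 * (a - b))) * weight f a t.
Proof.
move=> r0 ba rt; have t0 : 0 < `|t| by lra.
rewrite /weight mulrCA; apply: ler_wpM2l; first exact: sqr_ge0.
have -> : 2 * b + 1 = - (2 * (a - b)) + (2 * a + 1) by ring.
rewrite powRD ?(gt_eqF t0) ?implybT // ler_wpM2r ?powR_ge0 //.
have d0 : 0 <= 2 * (a - b) by rewrite mulr_ge0 // subr_ge0.
by rewrite !powRN lef_pV2 ?posrE ?powR_gt0 //; apply: ge0_ler_powR; rewrite ?nnegrE ?(ltW r0) ?(ltW t0).
Qed.

Lemma integral_weight_outer f (a b r N : R) : holo f -> 0 < r -> b <= a -> weighted_sqnorm a f = N%:E ->
  (\int[mu]_(t in ~` `](- r)%R, r[%classic) (weight f b t)%:E <= (r `^ (- (2 * (a - b))) * N)%:E)%E.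
Proof.
move=> hf r0 ba HN.
have := @integral_le_lin (~` `](- r)%R, r[%classic) (weight f b) (weight f a) (fun=> 0) (r `^ (- (2 * (a - b)))) 0 N 0.
rewrite mul0r addr0; apply => //; rewrite ?powR_ge0 //.
- exact: measurableC.
- exact: measurable_weight.
- exact: measurable_weight.
- exact: weight_ge0.
- exact: weight_ge0.
- move=> t /= tr; rewrite addr0; apply: weight_outer => //.
  by rewrite leNgt; apply/negP => /ltr_normlP [h1 h2]; apply: tr; rewrite in_itv /= h2 andbT ltrNl.
- rewrite -HN weighted_sqnormE; apply: ge0_subset_integral => //.
  + exact: measurableC.
  + by apply/measurable_EFinP; exact: measurable_weight.
  + by move=> t _; rewrite lee_fin weight_ge0.
- by rewrite integral0.
Qed.

End NormComparison.

(** * Lower bound *)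

Section InnerIntegral.
Context {R : realType}.
Notation mu := (@lebesgue_measure R).

Lemma integral_absR_powR_le (a r : R) : -1 < a -> 0 < r ->
  (\int[mu]_(t in `](- r)%R, r[%classic) (`|t| `^ (2 * a + 1))%:E <= (r `^ (2 * (a + 1)) / (a + 1))%:E)%E.
Proof.
move=> a1 r0; rewrite -integral_absR_powR //; apply: ge0_subset_integral => //.
- by apply/measurable_EFinP; exact: measurable_abs_powR.
- exact: subset_itv_oo_cc.
Qed.

Lemma expR2_ge4 : 4 <= expR 2 :> R.
Proof.
have -> : (2 : R) = 1 * 2%:R by rewrite mul1r.
rewrite expRM_natr; have h := expR_ge1Dx (1 : R).
have -> : (4 : R) = 2 ^+ 2 by ring.
by rewrite lerXn2r ?nnegrE ?expR_ge0 //; lra.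
Qed.

Variables (f : R[i] -> R[i]) (a N : R).
Hypotheses (hf : holo f) (a1 : -1 < a) (HN : weighted_sqnorm a f = N%:E).
Hypothesis Hexp : exists2 C : R, 0 <= C & forall z, normc (f z) <= C * expR (2 * normc z).

(** Up to the exponential this is the integral of |t|^(2 b + 1) over |t| < r divided by that of
    |t|^(2 a + 1) over |t| < a + 2, as if [f] were constant there. *)
Definition inner_const (b r : R) :=
  expR (60 * (a + 2)) * ((a + 1) / (b + 1)) * (a + 2) `^ (- (2 * (a + 1))) * r `^ (2 * (b + 1)).

Let N0 : 0 <= N. Proof. exact: sqnorm_ge0 HN. Qed.

(** Here 1 <= a + 1, so the supremum of |f|^2 on |t| <= a + 2 suffices. The remaining factors 4 and
    a + 2 go into the exponential. *)
Let inner_large (b r : R) : 0 <= a -> -1 < b -> 0 < r -> r <= a + 2 ->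
  (\int[mu]_(t in `](- r)%R, r[%classic) (weight f b t)%:E <= (inner_const b r * N)%:E)%E.
Proof.
move=> a0 b1 r0 ra; have n0 := N0.
pose S := 4 * N * expR (14 * (a + 2) + 8) * (a + 2) `^ (- (2 * a + 1)).
have S0 : 0 <= S by rewrite !mulr_ge0 ?expR_ge0 ?powR_ge0.
apply: (@le_trans _ _ (S * (r `^ (2 * (b + 1)) / (b + 1)) + 0 * 0)%:E).
  apply: (@integral_le_lin _ _ _ (fun t => `|t| `^ (2 * b + 1)) (fun=> 0)) => //.
  - exact: measurable_weight.
  - exact: measurable_abs_powR.
  - exact: weight_ge0.
  - move=> t /=; rewrite in_itv /= => /andP[t1 t2]; rewrite mul0r addr0 /weight ler_wpM2r ?powR_ge0 //.
    apply: (sqr_le_square hf a1 HN Hexp); rewrite ?normr0; try lra.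
    by rewrite ler_norml; apply/andP; lra.
  - exact: integral_absR_powR_le.
  - by rewrite integral0.
rewrite mul0r addr0 lee_fin /inner_const.
have b0 : 0 < b + 1 by lra.
have SE : S <= expR (60 * (a + 2)) * (a + 2) `^ (- (2 * (a + 1))) * N.
  rewrite /S; have -> : - (2 * a + 1) = - (2 * (a + 1)) + 1 by ring.
  have a20 : 0 < a + 2 by lra.
  rewrite powRD ?(gt_eqF a20) ?implybT // powRr1 ?(ltW a20) //.
  have -> : 4 * N * expR (14 * (a + 2) + 8) * ((a + 2) `^ (- (2 * (a + 1))) * (a + 2)) =
    (4 * expR (14 * (a + 2) + 8) * (a + 2)) * ((a + 2) `^ (- (2 * (a + 1))) * N) by ring.
  rewrite -[leRHS]mulrA; apply: ler_wpM2r; first by rewrite mulr_ge0 ?powR_ge0.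
  apply: le_trans (_ : expR 2 * expR (14 * (a + 2) + 8) * expR (a + 2) <= _).
    apply: ler_pM; rewrite ?mulr_ge0 ?expR_ge0 ?(ltW a20) //.
      by apply: ler_wpM2r; [exact: expR_ge0|exact: expR2_ge4].
    by apply: le_trans (expR_ge1Dx _); lra.
  by rewrite -!expRD ler_expR; lra.
apply: le_trans (ler_wpM2r (_ : 0 <= r `^ (2 * (b + 1)) / (b + 1)) SE) _; first by rewrite divr_ge0 ?powR_ge0 // ltW.
have -> : expR (60 * (a + 2)) * (a + 2) `^ (- (2 * (a + 1))) * N * (r `^ (2 * (b + 1)) / (b + 1)) =
  expR (60 * (a + 2)) * (a + 2) `^ (- (2 * (a + 1))) * N * r `^ (2 * (b + 1)) * (1 / (b + 1)) by field; rewrite gt_eqF.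
have -> : expR (60 * (a + 2)) * ((a + 1) / (b + 1)) * (a + 2) `^ (- (2 * (a + 1))) * r `^ (2 * (b + 1)) * N =
  expR (60 * (a + 2)) * (a + 2) `^ (- (2 * (a + 1))) * N * r `^ (2 * (b + 1)) * ((a + 1) / (b + 1)) by field; rewrite gt_eqF.
apply: ler_wpM2l; first by rewrite !mulr_ge0 ?expR_ge0 ?powR_ge0.
by rewrite ler_pM2r ?invr_gt0 //; lra.
Qed.

(** The bound of [sqr_le_square] at radius 3: 50 = 14 * 3 + 8, and 3^(- (2 a + 1)) <= 3 because a >
    -1. *)
Let S := 12 * N * expR 50.

Let S0 : 0 <= S. Proof. by rewrite /S !mulr_ge0 ?expR_ge0 ?N0. Qed.

Let near0_bound (x y : R) : `|x| <= 2 -> `|y| <= 2 -> normc (f (x +i* y)) ^+ 2 <= S.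
Proof.
move=> x2 y2; have := @sqr_le_square _ f a N hf a1 HN Hexp 3 x y; rewrite ler1n => /(_ isT).
have -> : 14 * 3 + 8 = 50 :> R by ring.
move=> H; apply: le_trans (H _ _) _; [lra|lra|].
have n0 := N0; have e0 := expR_ge0 (50 : R); have aa := a1.
have -> : S = 4 * N * expR 50 * 3 by rewrite /S; ring.
apply: ler_wpM2l; first by rewrite !mulr_ge0.
by rewrite -[leRHS]powRr1 //; apply: ler_powR; lra.
Qed.

(** Unit circles centred on [-1, 1] stay in the square of half side 2, so [cauchy_estimate] bounds
    the derivative on that segment. *)
Let lipschitz0 (t : R) : `|t| <= 1 -> normc (f t%:C - f 0) <= Num.sqrt S * `|t|.
Proof.
move=> t1; have [f' Hf'] := holo_cder hf.
have := @cder_le _ f f' 0 t%:C (Num.sqrt S); rewrite add0r normcR; apply => s /andP[s0 s1]; split; first exact: Hf'.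
have := @cauchy_estimate _ f f' (0 + s%:C * t%:C) 1 (Num.sqrt S) Hf' ltr01; rewrite divr1; apply => w w1.
rewrite -(@ler_pXn2r _ 2) ?nnegrE ?normc_ge0 ?sqrtr_ge0 // sqr_sqrtr ?S0 //.
have st : `|s * t| <= 1 by rewrite normrM ger0_norm // -[leRHS]mulr1 ler_pM.
have h1 := Re_le_normc w; have h2 := Im_le_normc w; rewrite w1 in h1 h2.
have -> : 0 + s%:C * t%:C + w = (s * t + Re w) +i* Im w.
  by case: (w) => p q; rewrite add0r -rmorphM; simpc.
apply: near0_bound; last by lra.
by apply: le_trans (ler_normD _ _) _; lra.
Qed.

Let sqr_growth (t : R) : `|t| <= 1 ->
  normc (f t%:C) ^+ 2 <= 2 * normc (f 0) ^+ 2 + 2 * S * t ^+ 2 /\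
  normc (f 0) ^+ 2 <= 2 * normc (f t%:C) ^+ 2 + 2 * S * t ^+ 2.
Proof.
move=> t1; have L := lipschitz0 t1.
have L2 : normc (f t%:C - f 0) ^+ 2 <= S * t ^+ 2.
  have -> : S * t ^+ 2 = (Num.sqrt S * `|t|) ^+ 2 by rewrite exprMn sqr_sqrtr ?S0 // real_normK ?num_real.
  by rewrite lerXn2r ?nnegrE ?normc_ge0 ?mulr_ge0 ?sqrtr_ge0.
have sq (x y d : R) : 0 <= x -> 0 <= y -> 0 <= d -> x <= y + d -> x ^+ 2 <= 2 * y ^+ 2 + 2 * d ^+ 2.
  move=> x0 y0 d0 xyd; apply: le_trans (_ : (y + d) ^+ 2 <= _).
    by rewrite lerXn2r ?nnegrE ?addr_ge0.
  by have := sqr_ge0 (y - d); rewrite sqrrB sqrrD; lra.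
have n1 := normc_ge0 (f t%:C); have n2 := normc_ge0 (f 0); have n3 := normc_ge0 (f t%:C - f 0).
split.
  have := sq _ _ _ n1 n2 n3; have := le_normcD (f t%:C - f 0) (f 0); rewrite subrK => h /(_ _) h2.
  by have := h2 ltac:(lra); lra.
have := sq _ _ _ n2 n1 n3; have := le_normcD (f 0 - f t%:C) (f t%:C); rewrite subrK normc_distC => h /(_ _) h2.
by have := h2 ltac:(lra); lra.
Qed.

Let sqr_absR_powR (c t : R) : -1 < c -> t ^+ 2 * `|t| `^ (2 * c + 1) = `|t| `^ (2 * (c + 1) + 1).
Proof.
move=> c1; have [->|t0] := eqVneq t 0.
  by rewrite expr0n mul0r normr0 powR0 //; apply/eqP; lra.
have tp : 0 < `|t| by rewrite normr_gt0.
have -> : 2 * (c + 1) + 1 = 2%:R + (2 * c + 1) by ring.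
by rewrite [RHS]powRD ?(gt_eqF tp) ?implybT // powR_mulrn // real_normK ?num_real.
Qed.

(* Near a = -1 the weight has mass about 1 / (a + 1) at the origin, whence the factor a + 1;
   it is the source of the quotient (a + 1) / (b + 1). *)
Let value0_bound : a < 0 -> normc (f 0) ^+ 2 <= (a + 1) * (2 * N + 2 * S).
Proof.
move=> a0; have aa := a1; have n0 := N0; have s0 := S0.
have a2 : 0 < a + 1 by lra.
have : (\int[mu]_(t in `[(-1)%R, 1%R]%classic) (normc (f 0) ^+ 2 * `|t| `^ (2 * a + 1))%:E <= (2 * N + 2 * S * (1 / (a + 1 + 1)))%:E)%E.
  apply: (@integral_le_lin _ _ _ (weight f a) (fun t => `|t| `^ (2 * (a + 1) + 1))) => //.
  - by apply: measurable_funM; [exact: measurable_cst|exact: measurable_abs_powR].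
  - exact: measurable_weight.
  - exact: measurable_abs_powR.
  - by move=> t; rewrite mulr_ge0 ?sqr_ge0 ?powR_ge0.
  - exact: weight_ge0.
  - by rewrite mulr_ge0.
  - move=> t /=; rewrite in_itv /= => t1.
    have tl : `|t| <= 1 by rewrite ler_norml.
    have [_ h] := sqr_growth tl.
    rewrite -sqr_absR_powR // /weight.
    apply: le_trans (ler_wpM2r (powR_ge0 _ _) h) _.
    by rewrite le_eqVlt; apply/orP; left; apply/eqP; ring.
  - rewrite -HN weighted_sqnormE; apply: ge0_subset_integral => //.
    + by apply/measurable_EFinP; exact: measurable_weight.
    + by move=> t _; rewrite lee_fin weight_ge0.
  - by rewrite integral_absR_powR ?ltr01 //; [rewrite powR1|lra].
have -> : (\int[mu]_(t in `[(-1)%R, 1%R]%classic) (normc (f 0) ^+ 2 * `|t| `^ (2 * a + 1))%:E = (normc (f 0) ^+ 2 / (a + 1))%:E)%E.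
  under eq_integral do rewrite EFinM.
  rewrite ge0_integralZl_EFin ?sqr_ge0 //.
  - by rewrite integral_absR_powR ?ltr01 // powR1 -EFinM mulrA mulr1.
  - by apply/measurable_EFinP; exact: measurable_abs_powR.
rewrite lee_fin ler_pdivrMr // => h; apply: le_trans h _; rewrite mulrC; apply: ler_wpM2l; first exact: ltW.
rewrite lerD2l; apply: ler_piMr; first by rewrite mulr_ge0.
by rewrite ler_pdivrMr ?mul1r; lra.
Qed.

(** The term |f(0)|^2 gets the quotient (a + 1) / (b + 1) from [value0_bound]. The term in t^2
    raises the exponent by 2, so its integral carries only 1 / (b + 2) <= 1 <= (a + 1) / (b + 1). *)
Let inner_small (b r : R) : a < 0 -> -1 < b -> b <= a -> 0 < r -> r <= 1 ->
  (\int[mu]_(t in `](- r)%R, r[%classic) (weight f b t)%:E <= (inner_const b r * N)%:E)%E.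
Proof.
move=> a0 b1 ba r0 r1; have aa := a1; have n0 := N0; have s0 := S0.
have b0 : 0 < b + 1 by lra.
apply: (@le_trans _ _ (2 * normc (f 0) ^+ 2 * (r `^ (2 * (b + 1)) / (b + 1)) + 2 * S * (r `^ (2 * (b + 1 + 1)) / (b + 1 + 1)))%:E).
  apply: (@integral_le_lin _ _ _ (fun t => `|t| `^ (2 * b + 1)) (fun t => `|t| `^ (2 * (b + 1) + 1))) => //.
  - exact: measurable_weight.
  - exact: measurable_abs_powR.
  - exact: measurable_abs_powR.
  - exact: weight_ge0.
  - by rewrite mulr_ge0 ?sqr_ge0.
  - by rewrite mulr_ge0.
  - move=> t /=; rewrite in_itv /= => /andP[t1 t2].
    have tl : `|t| <= 1 by rewrite ler_norml; apply/andP; lra.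
    have [h _] := sqr_growth tl.
    rewrite -sqr_absR_powR // /weight.
    apply: le_trans (ler_wpM2r (powR_ge0 _ _) h) _.
    by rewrite le_eqVlt; apply/orP; left; apply/eqP; ring.
  - exact: integral_absR_powR_le.
  - by apply: integral_absR_powR_le => //; lra.
rewrite lee_fin /inner_const.
set P := r `^ (2 * (b + 1)); have P0 : 0 <= P by exact: powR_ge0.
have P2 : r `^ (2 * (b + 1 + 1)) <= P by apply: ger_powR; rewrite ?r0 ?r1 //; lra.
have V0 := value0_bound a0.
pose Q := (a + 1) / (b + 1) * P.
have Q0 : 0 <= Q by rewrite mulr_ge0 // divr_ge0 //; lra.
have i1 : 2 * normc (f 0) ^+ 2 * (P / (b + 1)) <= (4 * N + 4 * S) * Q.
  apply: le_trans (_ : 2 * ((a + 1) * (2 * N + 2 * S)) * (P / (b + 1)) <= _).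
    by apply: ler_wpM2r; [rewrite divr_ge0 // ltW|rewrite ler_wpM2l].
  by rewrite le_eqVlt; apply/orP; left; apply/eqP; rewrite /Q; ring.
have i2 : 2 * S * (r `^ (2 * (b + 1 + 1)) / (b + 1 + 1)) <= 2 * S * Q.
  apply: ler_wpM2l; first by rewrite mulr_ge0.
  rewrite /Q mulrC; apply: ler_pM; rewrite ?invr_ge0 ?powR_ge0 //; first by lra.
  rewrite ler_pdivlMr // mulrC ler_pdivrMr; nra.
apply: le_trans (lerD i1 i2) _.
have E50 : 1 <= expR 50 :> R by rewrite -[leLHS]expR0 ler_expR.
(* 76 = 4 + 6 * 12. Below, 76 <= 4^4 <= exp 8, and 8 + 50 fits into 60 (a + 2) - 2 (a + 1). *)
have i3 : (4 * N + 4 * S) * Q + 2 * S * Q <= 76 * expR 50 * (N * Q).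
  have -> : (4 * N + 4 * S) * Q + 2 * S * Q = 4 * (N * Q) + 72 * expR 50 * (N * Q) by rewrite /S; ring.
  have nq : 0 <= N * Q by rewrite mulr_ge0.
  by have := ler_wpM2r nq E50; lra.
apply: le_trans i3 _.
have -> : expR (60 * (a + 2)) * ((a + 1) / (b + 1)) * (a + 2) `^ (- (2 * (a + 1))) * P * N =
  expR (60 * (a + 2)) * (a + 2) `^ (- (2 * (a + 1))) * (N * Q) by rewrite /Q; ring.
apply: ler_wpM2r; first by rewrite mulr_ge0.
have a2 : 1 <= a + 2 by lra.
have i4 : expR (- (2 * (a + 1))) <= (a + 2) `^ (- (2 * (a + 1))).
  rewrite /powR gt_eqF; last by lra.
  rewrite ler_expR; have l1 : ln (a + 2) <= 1.
    have e1 := expR_ge1Dx (1 : R); have a2' : 0 < a + 2 by lra.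
    by rewrite -[leRHS]expRK ler_ln ?posrE ?expR_gt0 //; lra.
  have : (2 * (a + 1)) * ln (a + 2) <= (2 * (a + 1)) * 1 by apply: ler_wpM2l => //; lra.
  lra.
apply: le_trans (_ : expR (60 * (a + 2)) * expR (- (2 * (a + 1))) <= _); last by rewrite ler_wpM2l ?expR_ge0.
rewrite -expRD; apply: le_trans (_ : expR (8 + 50) <= _); last by rewrite ler_expR; lra.
rewrite (expRD 8 50); apply: ler_wpM2r; first exact: expR_ge0.
have -> : (8 : R) = 2 * 4%:R by ring.
have h4 := expR2_ge4; rewrite expRM_natr; apply: le_trans (_ : 4 ^+ 4 <= _); first by lra.
by rewrite lerXn2r ?nnegrE ?expR_ge0.
Qed.

(** The half in the condition on [r] ensures r <= 1 when a < 0, where the Lipschitz bound holds. *)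
Lemma inner_integral_le (b r : R) : -1 < b -> b <= a -> 0 < r -> r <= (a + 2) / 2 ->
  (\int[mu]_(t in `](- r)%R, r[%classic) (weight f b t)%:E <= (inner_const b r * N)%:E)%E.
Proof.
move=> b1 ba r0 ra; have aa := a1; have [a0|a0] := leP 0 a.
  by apply: inner_large => //; lra.
by apply: inner_small => //; lra.
Qed.

Lemma sqnorm_eq0 : N = 0 -> forall z, f z = 0.
Proof.
move=> NE z; pose r := Num.max 1 (normc z).
have := @sqr_le_square _ f a N hf a1 HN Hexp r (Re z) (Im z); rewrite le_max lexx => /(_ isT).
have h1 : `|Re z| <= r by rewrite le_max Re_le_normc orbT.
have h2 : `|Im z| <= r by rewrite le_max Im_le_normc orbT.
move=> /(_ h1 h2); rewrite NE mulr0 !mul0r.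
have -> : Re z +i* Im z = z by case: (z).
move=> h; apply: Normc.eq0_normc; apply/eqP; rewrite -sqrf_eq0 eq_le h sqr_ge0 //.
Qed.

End InnerIntegral.

(** * The error term and the choice of the splitting radius *)

Section LowerBound.
Context {R : realType}.
Notation mu := (@lebesgue_measure R).

Definition error_scale (a b : R) : R := (a - b) * (a + 2) / (a + 1).
Definition error_log (a b : R) : R := ln (2 * (a + 1) * (a - b + 1) / ((a - b) * (a + 2))).

Section Scale.
Variables a b : R.
Hypotheses (b1 : -1 < b) (ba : b < a).
Notation t := (error_scale a b).
Notation L := (error_log a b).

(** t is the sum of a - b and (a - b) / (a + 1). The first absorbs constants raised to the power a -
    b, the second the deviation of (b + 1) / (a + 1) from 1. *)
Lemma error_scale_ge : [/\ a - b <= t, (a - b) / (a + 1) <= t & 0 < t].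
Proof.
have [b1' ba'] := (b1, ba); have a0 : 0 < a + 1 by lra.
have d0 : 0 < a - b by lra.
have E : t = (a - b) + (a - b) / (a + 1) by rewrite /error_scale; field; rewrite gt_eqF.
have q0 : 0 < (a - b) / (a + 1) by rewrite divr_gt0.
by rewrite E; split; lra.
Qed.

Let arg := 2 * (a + 1) * (a - b + 1) / ((a - b) * (a + 2)).

Let arg_ge2 : 2 <= arg.
Proof.
have [b1' ba'] := (b1, ba); rewrite /arg ler_pdivlMr; last by rewrite mulr_gt0; lra.
have -> : 2 * (a + 1) * (a - b + 1) = 2 * ((a - b) * (a + 2)) + 2 * (b + 1) by ring.
lra.
Qed.

(** A positive lower bound for [L] lets every O(t) be absorbed in O(t L). It comes from ln 2 >= 1 /
    2, that is, exp (- 1 / 2) >= 1 / 2. *)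
Lemma error_log_ge : 1 / 2 <= L.
Proof.
have h := arg_ge2; have p2 : (0 : R) < 2 by [].
apply: le_trans (_ : ln 2 <= _); last by rewrite /error_log -/arg ler_ln ?posrE //; lra.
rewrite -[leLHS]expRK ler_ln ?posrE ?expR_gt0 // -[leLHS]invrK -expRN -[leRHS]invrK.
rewrite lef_pV2 ?posrE ?invr_gt0 ?expR_gt0 //.
by apply: le_trans (expR_ge1Dx _); lra.
Qed.

(** exp (- L) equals t / (2 (a - b + 1)): a factor exp (- L) is what reduces a crude part to the
    size of the error. *)
Lemma expRN_error_log : expR (- L) <= t /\ expR (- L) <= 1 / 2.
Proof.
have h := arg_ge2; have argp : 0 < arg by lra.
have [b1' ba'] := (b1, ba).
have a1 : 0 < a + 1 by lra.
have [d1 _ t0] := error_scale_ge.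
have -> : expR (- L) = arg^-1 by rewrite expRN /error_log -/arg lnK.
split.
  have -> : arg^-1 = t / (2 * (a - b + 1)).
    by rewrite /arg /error_scale; field; rewrite !gt_eqF //; lra.
  by rewrite ler_pdivrMr; nra.
by rewrite -[leRHS]invrK lef_pV2 ?posrE ?invr_gt0 //; lra.
Qed.

Lemma error_scale_le_error : t <= 2 * (t * L) /\ 0 < t * L.
Proof.
have [_ _ t0] := error_scale_ge; have h := error_log_ge.
have := ler_wpM2l (ltW t0) h; split; nra.
Qed.
End Scale.

Lemma powR_expR (x y : R) : 0 < x -> x `^ y = expR (y * ln x).
Proof. by move=> x0; rewrite /powR gt_eqF. Qed.

(** With r = (a + 2) exp x both terms contain (a + 2)^(- 2 (a - b)), and the premise of [key]
    remains. Decreasing x shrinks the inner part and enlarges the outer one. *)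
Lemma lower_radius (a b : R) : -1 < b -> b < a ->
  exists r : R, [/\ 0 < r, r <= (a + 2) / 2 &
    r `^ (- (2 * (a - b))) + inner_const a b r <=
    expR (- (2 * (a - b) * ln (a + 2) + ln ((b + 1) / (a + 1))) + 250 * (error_scale a b * error_log a b))].
Proof.
move=> b1 ba; set t := error_scale a b; set L := error_log a b.
have [dt st t0] := error_scale_ge b1 ba; have L2 := error_log_ge b1 ba.
have [eLt eL2] := expRN_error_log b1 ba; have [tE E0] := error_scale_le_error b1 ba.
rewrite -/t -/L in dt st t0 L2 eLt eL2 tE E0.
have a1 : 0 < a + 1 by lra.
have b10 : 0 < b + 1 by lra.
have a2 : 0 < a + 2 by lra.
pose l := ln (a + 2).
have lnE : ln ((b + 1) / (a + 1)) = - ln ((a + 1) / (b + 1)).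
  by rewrite -lnV ?posrE ?divr_gt0 // invf_div.
have q1 : 1 <= (a + 1) / (b + 1) by rewrite ler_pdivlMr // mul1r; lra.
have inner_scaled (x : R) : inner_const a b ((a + 2) * expR x) =
    expR (60 * (a + 2) + 2 * (b + 1) * x) * ((a + 1) / (b + 1)) * expR (- (2 * (a - b) * l)).
  rewrite /inner_const !powR_expR ?mulr_gt0 ?expR_gt0 // lnM ?posrE ?expR_gt0 // expRK -/l.
  have -> : 2 * (b + 1) * (l + x) = 2 * (b + 1) * x + 2 * (b + 1) * l by ring.
  have -> : - (2 * (a - b) * l) = - (2 * (a + 1)) * l + 2 * (b + 1) * l by ring.
  by rewrite (expRD (60 * (a + 2))) (expRD (2 * (b + 1) * x)) (expRD (- (2 * (a + 1)) * l)); ring.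
have pow_scaled (x : R) : ((a + 2) * expR x) `^ (- (2 * (a - b))) = expR (- (2 * (a - b) * l)) * expR (- (2 * (a - b) * x)).
  by rewrite powR_expR ?mulr_gt0 ?expR_gt0 // lnM ?posrE ?expR_gt0 // expRK -/l -expRD; congr expR; ring.
have -> : - (2 * (a - b) * l + ln ((b + 1) / (a + 1))) + 250 * (t * L) =
   - (2 * (a - b) * l) + ln ((a + 1) / (b + 1)) + 250 * (t * L) by rewrite lnE; ring.
rewrite !expRD lnK ?posrE ?divr_gt0 //.
have key (x : R) : expR (- (2 * (a - b) * x)) + expR (60 * (a + 2) + 2 * (b + 1) * x) * ((a + 1) / (b + 1)) <=
    (a + 1) / (b + 1) * expR (250 * (t * L)) ->
  ((a + 2) * expR x) `^ (- (2 * (a - b))) + inner_const a b ((a + 2) * expR x) <=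
    expR (- (2 * (a - b) * l)) * ((a + 1) / (b + 1)) * expR (250 * (t * L)).
  move=> h; rewrite inner_scaled pow_scaled; have := ler_wpM2l (expR_ge0 (- (2 * (a - b) * l))) h.
  rewrite mulrDr mulrA [_ * (_ / _)]mulrC mulrA; move: (expR _) (expR _) (expR _) => *; lra.
have exp_le_q (y : R) : 0 <= y -> y <= (a + 1) / (b + 1) * y.
  by move=> y0; apply: ler_peMl.
(* In the second case a + 2 <= 2 t, so the error term absorbs every exp (O (a + 2)). *)
have [sb|sb] := leP (a + 1) (2 * (b + 1)).
  (* As L >= 1 / 2, 120 L (a + 2) absorbs the 60 (a + 2) of [inner_const]. The rest leaves exp (- 2
     L): one factor exp (- L) is at most t, the other at most 1 / 2, which cancels (a + 1) / (b + 1)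
     <= 2. *)
  pose x := - (124 * L * ((a + 2) / (a + 1))).
  exists ((a + 2) * expR x).
  have a21 : 1 <= (a + 2) / (a + 1) by rewrite ler_pdivlMr //; lra.
  have xL : x <= - L.
    rewrite /x lerN2 -mulrA; apply: le_trans (_ : 124 * (L * 1) <= _); first by lra.
    by rewrite ler_pM2l // ler_pM2l //; lra.
  split; first by rewrite mulr_gt0 ?expR_gt0.
    rewrite ler_pM2l //; apply: le_trans (_ : expR (- L) <= _); first by rewrite ler_expR.
    by lra.
  apply: key.
  have -> : - (2 * (a - b) * x) = 248 * (t * L) by rewrite /x /t /error_scale; field; rewrite gt_eqF.
  have h1 : expR (60 * (a + 2) + 2 * (b + 1) * x) * ((a + 1) / (b + 1)) <= t.
    have q2 : (a + 1) / (b + 1) <= 2 by rewrite ler_pdivrMr.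
    have x0 : x <= 0 by lra.
    have x2 : 2 * (b + 1) * x <= - (124 * L * (a + 2)).
      have -> : - (124 * L * (a + 2)) = (a + 1) * x by rewrite /x; field; rewrite gt_eqF.
      by apply: ler_wnM2r.
    have x3 : 60 * (a + 2) + 2 * (b + 1) * x <= - L + - L.
      nra.
    apply: le_trans (_ : expR (- L + - L) * 2 <= _).
      by apply: ler_pM; rewrite ?expR_ge0 ?ler_expR // divr_ge0 // ltW.
    rewrite expRD; have := expR_ge0 (- L); nra.
  apply: le_trans (lerD (lexx _) h1) _.
  apply: le_trans (exp_le_q _ (expR_ge0 _)).
  (* 248 is the cost of the outer part; by t <= 2 t L the remaining 2 absorbs the inner part t
     through 1 + y <= exp y. *)
  have -> : 250 * (t * L) = 248 * (t * L) + 2 * (t * L) by ring.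
  rewrite expRD; apply: le_trans (_ : expR (248 * (t * L)) * (1 + 2 * (t * L)) <= _); last first.
    by apply: ler_wpM2l; [exact: expR_ge0|exact: expR_ge1Dx].
  have : 1 <= expR (248 * (t * L)) by rewrite -[leLHS]expR0 ler_expR; lra.
  by nra.
pose x := - ln (2 : R).
exists ((a + 2) * expR x).
have xE : expR x = 2^-1 by rewrite expRN lnK // posrE.
split; [by rewrite mulr_gt0 ?expR_gt0|by rewrite xE|apply: key].
have ln20 : 0 <= ln (2 : R) by rewrite ln_ge0 // ler1n.
have ln21 : ln (2 : R) <= 1.
  rewrite -[leRHS]expRK ler_ln ?posrE ?expR_gt0 //.
  by have := expR_ge1Dx (1 : R); lra.
have at2 : a + 2 <= 2 * t.
  have -> : t = (a - b) / (a + 1) * (a + 2) by rewrite /t /error_scale; ring.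
  have : 1 / 2 <= (a - b) / (a + 1) by rewrite ler_pdivlMr //; lra.
  by move=> h; have := ler_wpM2r (ltW a2) h; lra.
have h1 : expR (- (2 * (a - b) * x)) <= expR (120 * t).
  rewrite ler_expR /x mulrN opprK.
  have := ler_wpM2l (_ : 0 <= 2 * (a - b)) ln21; rewrite mulr1 => /(_ ltac:(lra)); lra.
have h2 : expR (60 * (a + 2) + 2 * (b + 1) * x) <= expR (120 * t).
  rewrite ler_expR /x mulrN; have : 0 <= 2 * (b + 1) * ln 2 by rewrite mulr_ge0 // mulr_ge0 // ltW.
  lra.
apply: le_trans (_ : expR (120 * t) + expR (120 * t) * ((a + 1) / (b + 1)) <= _).
  by apply: lerD => //; apply: ler_wpM2r => //; rewrite divr_ge0 // ltW.
have h3 := exp_le_q _ (expR_ge0 (120 * t)).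
apply: le_trans (_ : (a + 1) / (b + 1) * (2 * expR (120 * t)) <= _); first by lra.
apply: ler_wpM2l; first by rewrite divr_ge0 // ltW.
(* 1 <= a + 2 <= 2 t, so 1 + 120 t <= 122 t <= 244 t L. *)
apply: le_trans (_ : expR 1 * expR (120 * t) <= _).
  by apply: ler_wpM2r; [exact: expR_ge0|have := expR_ge1Dx (1 : R); lra].
by rewrite -expRD ler_expR; lra.
Qed.

End LowerBound.

(** * Lower bound for the quotient of norms *)

Section RatioLower.
Context {R : realType}.
Notation mu := (@lebesgue_measure R).

Lemma weighted_sqnorm_ge0 (a : R) (f : R[i]^o -> R[i]^o) : (0 <= weighted_sqnorm a f)%E.
Proof. by apply: integral_ge0 => t _; rewrite lee_fin weight_ge0. Qed.

Lemma in_H11_sqnorm (a : R) (f : R[i]^o -> R[i]^o) : -1 < a -> f <> (fun=> 0) -> in_H11 a f ->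
  [/\ holo f, exists2 C : R, 0 <= C & forall z, normc (f z) <= C * expR (2 * normc z)
    & exists2 N : R, 0 < N & weighted_sqnorm a f = N%:E].
Proof.
move=> a1 f0 [/entire_holo hf [//|[_ f1]] fN].
have Hexp := exp_type_bound hf f1; split => //.
have fin : weighted_sqnorm a f \is a fin_num by rewrite ge0_fin_numE // weighted_sqnorm_ge0.
exists (fine (weighted_sqnorm a f)); last by rewrite fineK.
have N0 : 0 <= fine (weighted_sqnorm a f) by rewrite fine_ge0 // weighted_sqnorm_ge0.
rewrite lt_neqAle N0 andbT eq_sym; apply/eqP => NE; apply: f0; apply/funext => z.
exact: (sqnorm_eq0 hf a1 (esym (fineK fin)) Hexp NE).
Qed.

(** The splitting estimate also shows that the norm for [b] is finite, and [sqnorm_eq0] that it is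
    nonzero, so the extended quotient is an ordinary one. *)
Lemma ratio_lower (a b : R) (f : R[i]^o -> R[i]^o) : -1 < b -> b < a -> f <> (fun=> 0) -> in_H11 a f ->
  ((expR (2 * (a - b) * ln (a + 2) + ln ((b + 1) / (a + 1)) - 250 * (error_scale a b * error_log a b)))%:E
    <= weighted_sqnorm a f / weighted_sqnorm b f)%E.
Proof.
move=> b1 ba f0 fH; have a1 : -1 < a by lra.
have [hf Hexp [N N0 HN]] := in_H11_sqnorm a1 f0 fH.
have [r [r0 ra Hr]] := lower_radius b1 ba.
set Lam := _ + inner_const a b r in Hr.
have le_b : (weighted_sqnorm b f <= (Lam * N)%:E)%E.
  rewrite (weighted_sqnorm_split b r hf) /Lam mulrDl EFinD; apply: leeD.
    by apply: integral_weight_outer => //; exact: ltW.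
  by apply: inner_integral_le => //; exact: ltW.
have fin : weighted_sqnorm b f \is a fin_num.
  by rewrite ge0_fin_numE ?weighted_sqnorm_ge0 //; apply: le_lt_trans le_b (ltry _).
have [M HM] : exists M, weighted_sqnorm b f = M%:E by exists (fine (weighted_sqnorm b f)); rewrite fineK.
have M0 : 0 < M.
  have : 0 <= M by rewrite -lee_fin -HM weighted_sqnorm_ge0.
  rewrite le_eqVlt => /orP[/eqP ME|//]; exfalso; apply: f0; apply/funext => z.
  exact: (sqnorm_eq0 hf b1 HM Hexp (esym ME)).
rewrite HN HM; rewrite HM lee_fin in le_b.
rewrite inver gt_eqF // -EFinM lee_fin ler_pdivlMr //.
set Y := 2 * (a - b) * ln (a + 2) + _ in Hr *.
have -> : Y - 250 * (error_scale a b * error_log a b) = - (- Y + 250 * (error_scale a b * error_log a b)) by ring.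
rewrite expRN mulrC ler_pdivrMr ?expR_gt0 //; apply: le_trans le_b _; rewrite mulrC ler_wpM2l // ltW //.
Qed.

End RatioLower.

(** * Upper bound *)

Section TestFunction.
Context {R : realType}.
Notation mu := (@lebesgue_measure R).

Definition expm1_quot (u : R[i]) : R[i] := if u == 0 then 1 else (cexp u - 1) / u.

(** At the removable singularity the derivative is 1 / 2, by the third Taylor remainder divided by
    [h]; elsewhere the formula holds on a disc avoiding 0. *)
Lemma holo_expm1_quot : holo expm1_quot.
Proof.
move=> u; have [->|u0] := eqVneq u 0.
  exists (2^-1) => e e0; have E0 : 0 < expR 1 :> R := expR_gt0 1.
  exists (Num.min 1 (e / expR 1)) => [|h]; first by rewrite lt_min ltr01 divr_gt0.
  rewrite lt_min ltr_pdivlMr // => /andP[h1 he]; rewrite add0r /expm1_quot eqxx.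
  have [->|h0] := eqVneq h 0; first by rewrite subrr mulr0 subr0 Normc.normc0 mulr0.
  have hp : 0 < normc h by apply: normc_gt0.
  have -> : (cexp h - 1) / h - 1 - 2^-1 * h = (cexp h - 1 - h - h ^+ 2 / 2) / h by field.
  rewrite Normc.normcM Normc.normcV ler_pdivrMr //; apply: le_trans (cexp_sub3_le h) _.
  have -> : normc h ^+ 3 * expR (normc h) = (normc h * expR (normc h)) * (normc h * normc h) by ring.
  rewrite -[leRHS]mulrA; apply: ler_wpM2r; first by rewrite mulr_ge0 ?normc_ge0.
  apply: le_trans (ltW he); rewrite ler_pM2l // ler_expR; exact: ltW.
have up : 0 < normc u by apply: normc_gt0.
exists ((cexp u - 0) * u^-1 + (cexp u - 1) * (- 1 / u ^+ 2)).
apply: (@cder_near _ _ (fun w => (cexp w - 1) * w^-1) _ _ (normc u) up) => [h hu|].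
  rewrite /expm1_quot ifF //; apply/eqP => E; have : u = - h by apply/eqP; rewrite -subr_eq0 opprK E.
  by move=> uE; move: hu; rewrite uE normcN ltxx.
apply: cderM; first by apply: cderB; [exact: cder_cexp|exact: cder_cst].
exact: (@cderV _ id u 1 u0 (cder_id u)).
Qed.

Lemma expm1_quot_le (u : R[i]) : normc (expm1_quot u) <= expR (normc u).
Proof.
rewrite /expm1_quot; case: eqP => [->|/eqP u0]; first by rewrite Normc.normc1 Normc.normc0 expR0.
have up : 0 < normc u by apply: normc_gt0.
by rewrite Normc.normcM Normc.normcV ler_pdivrMr // mulrC cexp_sub1_le.
Qed.

(** Gives a ray on which the test function does not decay, so that its exponential type is not
    -oo. *)
Lemma expm1_quot_real (s : R) : 0 < s -> 1 <= normc (expm1_quot s%:C).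
Proof.
move=> s0; have sC : (s%:C == 0 :> R[i]) = false by apply/eqP => -[/eqP]; rewrite gt_eqF.
rewrite /expm1_quot sC Normc.normcM Normc.normcV normcR gtr0_norm // ler_pdivlMr // mul1r.
apply: le_trans (Re_le_norm _); rewrite /cexp /= cos0 mulr1.
by have := expR_ge1Dx s; lra.
Qed.

Let nI (s : R) : normc ((0 +i* s) : R[i]) = `|s|.
Proof. by rewrite /normc /= expr0n add0r sqrtr_sqr. Qed.

Let ncexpI (s : R) : normc (cexp (0 +i* s)) = 1.
Proof. by rewrite normc_cexp expR0. Qed.

Let segI (s t : R) : 0 + t%:C * (0 +i* s) = 0 +i* (t * s).
Proof. by rewrite add0r; simpc. Qed.

(** On the imaginary axis [cexp] has modulus 1, so the Taylor remainders lose their exponential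
    factor. *)
Let sub1 (s : R) : normc (cexp (0 +i* s) - 1) <= `|s|.
Proof.
have := @cder_le R (@cexp R) (@cexp R) 0 (0 +i* s) 1; rewrite add0r cexp0 mul1r nI; apply => t _.
by split; [exact: cder_cexp|rewrite segI ncexpI].
Qed.

Let sub2 (s : R) : normc (cexp (0 +i* s) - 1 - (0 +i* s)) <= `|s| * `|s|.
Proof.
have := @cder_le R (fun w => cexp w - 1 - w) (fun w => cexp w - 0 - 1) 0 (0 +i* s) `|s|.
rewrite add0r cexp0 subrr !subr0 nI; apply => t /andP[t0 t1]; split.
  by apply: cderB; [apply: cderB; [exact: cder_cexp|exact: cder_cst]|exact: cder_id].
rewrite subr0 segI; apply: le_trans (sub1 _) _.
by rewrite normrM (ger0_norm t0) ler_piMl.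
Qed.

Let I0 (s : R) : s != 0 -> ((0 +i* s : R[i]) == 0) = false.
Proof. by move=> s0; apply/eqP => -[/eqP]; rewrite (negPf s0). Qed.

(** For s != 0 the three bounds express that |exp (i s) - 1| is at most |s|, at most 2, and at least
    |s| - s^2. *)
Lemma expm1_quot_imag (s : R) : normc (expm1_quot (0 +i* s)) <= 1 /\ normc (expm1_quot (0 +i* s)) * `|s| <= 2 /\
  (`|s| <= 1 / 2 -> 1 / 2 <= normc (expm1_quot (0 +i* s))).
Proof.
have [->|s0] := eqVneq s 0.
  rewrite /expm1_quot eqxx Normc.normc1 normr0 mulr0; split => //; split => // _; lra.
have sp : 0 < `|s| by rewrite normr_gt0.
have E : normc (expm1_quot (0 +i* s)) = normc (cexp (0 +i* s) - 1) / `|s|.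
  by rewrite /expm1_quot I0 // Normc.normcM Normc.normcV nI.
split; first by rewrite E ler_pdivrMr // mul1r sub1.
split.
  by rewrite E divfK ?gt_eqF //; apply: le_trans (normcB _ _) _; rewrite ncexpI Normc.normc1; lra.
move=> s2; rewrite E ler_pdivlMr //.
have h := sub2 s; have := le_normcD (cexp (0 +i* s) - 1) (- (cexp (0 +i* s) - 1 - (0 +i* s))).
rewrite normcN (_ : _ + - _ = 0 +i* s); last by ring.
rewrite nI; have : `|s| * `|s| <= `|s| * (1 / 2) by rewrite ler_pM2l.
lra.
Qed.

Lemma test_function (m : nat) : (0 < m)%N -> exists f : R[i]^o -> R[i]^o,
  [/\ holo f, f <> (fun=> 0), exp_type f \is a fin_num /\ (exp_type f <= 1)%E &
  forall x : R, [/\ normc (f x%:C) <= 1, normc (f x%:C) * `|x| ^+ m <= (2 * m%:R) ^+ m &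
     `|x| <= m%:R / 2 -> (1 / 2) ^+ m <= normc (f x%:C)]].
Proof.
move=> m0; have mp : 0 < m%:R :> R by rewrite ltr0n.
pose g z := expm1_quot ((0 +i* m%:R^-1) * z).
pose f : R[i]^o -> R[i]^o := fun z => g z ^+ m.
have hg : holo g.
  by apply: (holo_comp holo_expm1_quot); apply: holoM; [exact: holo_cst|exact: holo_id].
have gx (x : R) : g x%:C = expm1_quot (0 +i* (x / m%:R)) by rewrite /g; simpc; rewrite mulrC.
have f_le z : normc (f z) <= expR (normc z).
  rewrite /f normcX; apply: le_trans (_ : expR (normc z / m%:R) ^+ m <= _).
    rewrite lerXn2r ?nnegrE ?normc_ge0 ?expR_ge0 //; apply: le_trans (expm1_quot_le _) _.
    by rewrite Normc.normcM nI ger0_norm ?invr_ge0 // mulrC.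
  by rewrite -expRM_natr divfK // gt_eqF.
have f_ge (y : R) : 0 < y -> 1 <= normc (f (0 +i* - y)).
  move=> y0; rewrite /f normcX; apply: exprn_ege1; rewrite /g.
  have -> : (0 +i* m%:R^-1) * (0 +i* - y) = (y / m%:R)%:C :> R[i].
    by apply/eqP; rewrite eq_complex /=; apply/andP; split; apply/eqP; ring.
  by apply: expm1_quot_real; rewrite divr_gt0.
exists f; split.
- by move=> z; have [d hd] := hg z; eexists; exact: cderX hd.
- move=> f0; have := f_ge 1 ltr01; rewrite f0 Normc.normc0; lra.
- have le1 : (exp_type f <= 1)%E.
    apply: (@le_trans _ _ (ereal_sup ((fun z : R[i]^o => ((normc z)^-1)%:E * lne (normc (f z))%:E)%E @` [set z | 1 < normc z]%classic)%classic)).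
      by apply: ereal_inf_lbound; exists [set z : R[i] | 1 < normc z]%classic => //; exists 1.
    apply: ge_ereal_sup => _ [z z1 <-]; have {}z1 : 1 < normc z := z1; cbv beta.
    have z0 : 0 < normc z by lra.
    have [->|fz0] := eqVneq (normc (f z)) 0.
      by rewrite le0_lneNy // gt0_muleNy ?lte_fin ?invr_gt0 // leNye.
    have fz : 0 < normc (f z) by rewrite lt_neqAle eq_sym fz0 normc_ge0.
    rewrite lne_EFin // -EFinM lee_fin mulrC ler_pdivrMr // mul1r.
    by rewrite -[leRHS]expRK ler_ln ?posrE ?expR_gt0.
  split => //; apply/fin_numP; split; last first.
    by apply/eqP => E; move: le1; rewrite E leye_eq.
  (* The negative imaginary axis meets every set of the filter, and |f| >= 1 on it, so all suprema
     are nonnegative. *)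
  have : (0 <= exp_type f)%E.
    apply: le_ereal_inf_tmp => _ [V [r _ rV] <-].
    pose y := Num.max r 0 + 1.
    have y0 : 0 < y by rewrite /y; have : 0 <= Num.max r 0 by [rewrite le_max lexx orbT]; lra.
    have ry : r < y by rewrite /y; have : r <= Num.max r 0 by [rewrite le_max lexx]; lra.
    have ny : normc ((0 +i* - y) : R[i]) = y by rewrite nI normrN gtr0_norm.
    apply: (@le_trans _ _ (((normc ((0 +i* - y) : R[i]))^-1)%:E * lne (normc (f (0 +i* - y)))%:E)%E).
      rewrite lne_EFin; last by apply: lt_le_trans (f_ge _ y0).
      by rewrite -EFinM lee_fin mulr_ge0 ?invr_ge0 ?normc_ge0 // ln_ge0 // f_ge.
    by apply: ereal_sup_ubound; exists (0 +i* - y) => //; apply: rV; rewrite /mkset ny.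
  by move=> h; apply/eqP => E; move: h; rewrite E.
move=> x; have [h1 [h2 h3]] := expm1_quot_imag (x / m%:R).
have xm : `|x / m%:R| = `|x| / m%:R by rewrite normrM normfV (ger0_norm (ltW mp)).
rewrite xm in h2 h3; rewrite /f normcX gx; split.
- by apply: exprn_ile1; rewrite ?normc_ge0.
- rewrite -exprMn; apply: lerXn2r; rewrite ?nnegrE ?mulr_ge0 ?normc_ge0 //.
  by move: h2; rewrite mulrA ler_pdivrMr.
- move=> hx; apply: lerXn2r; rewrite ?nnegrE ?normc_ge0 //.
  by apply: h3; rewrite ler_pdivrMr //; lra.
Qed.
End TestFunction.

(** * Norms of the test function *)

Section TestFunctionNorms.
Context {R : realType}.
Notation mu := (@lebesgue_measure R).

Section Norms.
Variables (f : R[i] -> R[i]) (m : nat) (M : R).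
Hypotheses (hf : holo f) (M0 : 0 < M).
Hypothesis f_le1 : forall x : R, normc (f x%:C) <= 1.
Hypothesis f_decay : forall x : R, normc (f x%:C) * `|x| ^+ m <= M ^+ m.
Hypothesis f_ge : forall x : R, `|x| <= M / 4 -> (1 / 2) ^+ m <= normc (f x%:C).

Lemma sqr_le1 x : normc (f x%:C) ^+ 2 <= 1.
Proof. by rewrite -[leRHS](expr1n _ 2); apply: lerXn2r; rewrite ?nnegrE ?normc_ge0. Qed.

Lemma integral_weight_tail (a r : R) : a + 1 < m%:R -> 0 < r ->
  (\int[mu]_(t in ~` `](- r)%R, r[%classic) (weight f a t)%:E
    <= (M `^ (2 * m%:R) * (r `^ (- (2 * (m%:R - (a + 1)))) / (m%:R - (a + 1))))%:E)%E.
Proof.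
move=> am r0; have s0 : 0 < m%:R - (a + 1) by rewrite subr_gt0.
have := @integral_le_lin R (~` `](- r)%R, r[%classic) (weight f a) (fun t => `|t| `^ (- (2 * (m%:R - (a + 1))) - 1)) (fun=> 0)
  (M `^ (2 * m%:R)) 0 (r `^ (- (2 * (m%:R - (a + 1)))) / (m%:R - (a + 1))) 0.
rewrite mul0r addr0; apply => //; rewrite ?powR_ge0 //.
- exact: measurableC.
- exact: measurable_weight.
- exact: measurable_abs_powR.
- exact: weight_ge0.
- move=> t /= tr; rewrite addr0.
  have rt : r <= `|t|.
    by rewrite leNgt; apply/negP => /ltr_normlP [h1 h2]; apply: tr; rewrite in_itv /= h2 andbT ltrNl.
  have t0 : 0 < `|t| by exact: lt_le_trans rt.
  have -> : - (2 * (m%:R - (a + 1))) - 1 = - (2 * m%:R) + (2 * a + 1) by ring.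
  rewrite powRD ?(gt_eqF t0) ?implybT // /weight mulrA ler_wpM2r ?powR_ge0 //.
  rewrite powRN ler_pdivlMr ?powR_gt0 //.
  have E (y : R) : 0 <= y -> y `^ (2 * m%:R) = (y ^+ m) ^+ 2.
    by move=> y0; rewrite -natrM powR_mulrn // -exprM mulnC.
  rewrite !E ?(ltW M0) // -exprMn; apply: lerXn2r; rewrite ?nnegrE ?mulr_ge0 ?normc_ge0 ?exprn_ge0 ?(ltW M0) //.
- by rewrite integral_absR_powR_tail.
- by rewrite integral0.
Qed.

(** The bounds 1 and (M / |x|)^m cross at |x| = M; splitting there gives both parts the same power
    of M. *)
Lemma sqnorm_upper (a : R) : -1 < a -> a + 1 < m%:R ->
  (weighted_sqnorm a f <= (M `^ (2 * (a + 1)) * (1 / (a + 1) + 1 / (m%:R - (a + 1))))%:E)%E.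
Proof.
move=> a1 am; rewrite (weighted_sqnorm_split a M hf).
have -> : M `^ (2 * (a + 1)) * (1 / (a + 1) + 1 / (m%:R - (a + 1))) =
   M `^ (2 * m%:R) * (M `^ (- (2 * (m%:R - (a + 1)))) / (m%:R - (a + 1))) + (1 * (M `^ (2 * (a + 1)) / (a + 1)) + 0 * 0).
  have -> : M `^ (2 * (a + 1)) = M `^ (2 * m%:R) * M `^ (- (2 * (m%:R - (a + 1)))).
    by rewrite -powRD ?(gt_eqF M0) ?implybT //; congr (_ `^ _); ring.
  by ring.
rewrite EFinD; apply: leeD; first exact: integral_weight_tail.
apply: (@integral_le_lin _ _ _ (fun t => `|t| `^ (2 * a + 1)) (fun=> 0)) => //.
- exact: measurable_weight.
- exact: measurable_abs_powR.
- exact: weight_ge0.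
- by move=> t _; rewrite mul0r addr0; apply: ler_wpM2r; [exact: powR_ge0|exact: sqr_le1].
- exact: integral_absR_powR_le.
- by rewrite integral0.
Qed.

(** Only the tail is estimated by the decay of [f]; the main part is compared with the norm of [f]
    itself for [b], without a loss exp (O (a + 2)) when a - b is small. *)
Lemma sqnorm_compare (a b r Nb : R) : -1 < b -> b <= a -> a + 1 < m%:R -> 0 < r ->
  weighted_sqnorm b f = Nb%:E ->
  (weighted_sqnorm a f <= (r `^ (2 * (a - b)) * Nb +
     M `^ (2 * m%:R) * (r `^ (- (2 * (m%:R - (a + 1)))) / (m%:R - (a + 1))))%:E)%E.
Proof.
move=> b1 ba am r0 HN; rewrite (weighted_sqnorm_split a r hf) (addrC (r `^ (2 * (a - b)) * Nb)) EFinD.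
apply: leeD; first exact: integral_weight_tail.
rewrite -[r `^ _ * Nb]addr0 -(mul1r (0 : R)).
(* 0 `^ 0 = 1, so the weights cannot be compared at t = 0 when 2 a + 1 = 0. *)
apply: (@integral_le_lin _ _ _ (weight f b) \1_[set 0]) => //.
- exact: measurable_weight.
- exact: measurable_weight.
- exact: weight_ge0.
- exact: weight_ge0.
- exact: powR_ge0.
- move=> t /=; rewrite in_itv /= => /andP[t1 t2]; have [->|t0] := eqVneq t 0.
    rewrite indicE mem_set // mulr1; apply: le_trans (_ : 1 <= _); last first.
      by rewrite lerDr mulr_ge0 ?powR_ge0 ?weight_ge0.
    rewrite /weight normr0 /powR eqxx; case: eqP => _; rewrite ?mulr1 ?mulr0 //.
    exact: (sqr_le1 0).
  have tp : 0 < `|t| by rewrite normr_gt0.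
  apply: le_trans (_ : r `^ (2 * (a - b)) * weight f b t <= _); last by rewrite lerDl mulr_ge0.
  rewrite /weight mulrCA; apply: ler_wpM2l; first exact: sqr_ge0.
  have -> : 2 * a + 1 = 2 * (a - b) + (2 * b + 1) by ring.
  rewrite powRD ?(gt_eqF tp) ?implybT // ler_wpM2r ?powR_ge0 //.
  apply: ge0_ler_powR; rewrite ?nnegrE ?(ltW r0) //; first by rewrite mulr_ge0 // subr_ge0.
  by rewrite ler_norml; apply/andP; lra.
- rewrite -HN weighted_sqnormE; apply: ge0_subset_integral => //.
  + by apply/measurable_EFinP; exact: measurable_weight.
  + by move=> t _; rewrite lee_fin weight_ge0.
- rewrite integral_indic //.
  apply: (@le_trans _ _ (mu [set 0])%classic).
    by apply: le_measure; rewrite ?inE //; exact: measurableI.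
  by rewrite lebesgue_measure_set1.
Qed.

Lemma sqnorm_lower (b : R) : -1 < b ->
  (((1 / 4) ^+ m * ((M / 4) `^ (2 * (b + 1)) / (b + 1)))%:E <= weighted_sqnorm b f)%E.
Proof.
move=> b1; have M4 : 0 < M / 4 by rewrite divr_gt0.
rewrite EFinM -integral_absR_powR //.
rewrite -ge0_integralZl_EFin ?exprn_ge0 //; last first.
  by apply/measurable_EFinP; exact: measurable_abs_powR.
apply: (@le_trans _ _ (\int[mu]_(t in `[(- (M / 4))%R, (M / 4)%R]%classic) (weight f b t)%:E)%E).
  apply: ge0_le_integral => //.
  - by apply/measurable_EFinP; apply: measurable_funM; [exact: measurable_cst|exact: measurable_abs_powR].
  - by apply/measurable_EFinP; exact: measurable_weight.
  - move=> t /=; rewrite in_itv /= => tM; rewrite -EFinM lee_fin; apply: ler_wpM2r; first exact: powR_ge0.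
    have -> : (1 / 4 : R) ^+ m = ((1 / 2) ^+ m) ^+ 2.
      by rewrite exprAC; congr (_ ^+ m); field.
    apply: lerXn2r; rewrite ?nnegrE ?normc_ge0 ?exprn_ge0 //.
    by apply: f_ge; rewrite ler_norml.
rewrite weighted_sqnormE; apply: ge0_subset_integral => //.
- by apply/measurable_EFinP; exact: measurable_weight.
- by move=> t _; rewrite lee_fin weight_ge0.
Qed.
End Norms.

(** [N] and [Y] stand for the norms of the test function for [a] and [b]. The comparison at a radius
    r is used if a + 1 <= 2 (b + 1), the separate bounds otherwise. *)
Lemma upper_numeric (a b m N Y : R) : -1 < b -> b < a -> 2 * (a + 2) < m -> m <= 3 * (a + 2) ->
  expR (- (ln 4 * m)) * ((2 * m / 4) `^ (2 * (b + 1)) / (b + 1)) <= Y ->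
  N <= (2 * m) `^ (2 * (a + 1)) * (1 / (a + 1) + 1 / (m - (a + 1))) ->
  (forall r, 0 < r -> N <= r `^ (2 * (a - b)) * Y +
     (2 * m) `^ (2 * m) * (r `^ (- (2 * (m - (a + 1)))) / (m - (a + 1)))) ->
  N <= expR (2 * (a - b) * ln (a + 2)) * ((b + 1) / (a + 1)) *
    expR (60 * (error_scale a b * error_log a b)) * Y.
Proof.
move=> b1 ba m1 m2 Nb_low Na Ncmp; set t := error_scale a b; set L := error_log a b.
have [dt st t0] := error_scale_ge b1 ba; have L2 := error_log_ge b1 ba.
have [eLt _] := expRN_error_log b1 ba; have [tE E0] := error_scale_le_error b1 ba.
rewrite -/t -/L in dt st t0 L2 eLt tE E0.
have a1 : 0 < a + 1 by lra.
have b10 : 0 < b + 1 by lra.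
have a2 : 0 < a + 2 by lra.
set M := 2 * m in Nb_low Na Ncmp; set s := m - (a + 1) in Na Ncmp.
have M0 : 0 < M by rewrite /M; lra.
have s0 : a + 2 <= s by rewrite /s; lra.
pose lM := ln M; pose l := ln (a + 2).
have ln4 : ln 4 <= 2 :> R.
  by rewrite -[leRHS]expRK ler_ln ?posrE ?expR_gt0 //; exact: expR2_ge4.
have lML : lM <= l + 4.
  have m0 : 0 < m by lra.
  rewrite /lM -(expRK 4) -lnM ?posrE ?expR_gt0 // ler_ln ?posrE ?mulr_gt0 ?expR_gt0 //.
  apply: le_trans (_ : (a + 2) * 6 <= _); first by rewrite /M; lra.
  rewrite ler_pM2l // (_ : (4 : R) = 2 * 2%:R); last by ring.
  have h4 := @expR2_ge4 R; rewrite expRM_natr; nra.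
have Ylow : expR (2 * (b + 1) * lM - 10 * (a + 2)) / (b + 1) <= Y.
  apply: le_trans Nb_low; rewrite mulrA; apply: ler_wpM2r; first by rewrite invr_ge0 ltW.
  rewrite powR_expR ?divr_gt0 // -expRD ler_expR ln_div ?posrE // -/lM.
  have : ln 4 * m <= 2 * (3 * (a + 2)) by apply: ler_pM => //; [rewrite ln_ge0 // ler1n|lra].
  have : ln 4 * (2 * (b + 1)) <= 2 * (2 * (b + 1)) by apply: ler_wpM2r => //; lra.
  lra.
have Y0 : 0 < Y by apply: lt_le_trans Ylow; rewrite divr_gt0 ?expR_gt0.
clear Nb_low.
(* The lower bound on [Y] in the form 1 <= (b + 1) e1 Y, which turns any additive term into a
   multiple of [Y]. *)
pose e1 := expR (10 * (a + 2) - 2 * (b + 1) * lM).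
have Yone : 1 <= (b + 1) * e1 * Y.
  have h := ler_wpM2l (_ : 0 <= (b + 1) * e1) Ylow.
  apply: le_trans (h _); last by rewrite mulr_ge0 ?expR_ge0 // ltW.
  set e2 := expR (2 * (b + 1) * lM - 10 * (a + 2)).
  have -> : (b + 1) * e1 * (e2 / (b + 1)) = e1 * e2 * ((b + 1) / (b + 1)) by ring.
  by rewrite /e1 /e2 -expRD (_ : _ + _ = 0) ?expR0 ?divff ?mulr1 ?gt_eqF //; ring.
have MlM x : M `^ x = expR (x * lM) by rewrite powR_expR.
have s1 : 0 < s by lra.
have dlM : 2 * (a - b) * lM <= 2 * (a - b) * l + 8 * t.
  have : 2 * (a - b) * lM <= 2 * (a - b) * (l + 4) by apply: ler_wpM2l => //; lra.
  lra.
have Yle c d : 0 <= c -> c * ((b + 1) * e1) <= d -> c <= d * Y.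
  move=> c0 cd; apply: le_trans (_ : c * ((b + 1) * e1 * Y) <= _).
    by rewrite -[leLHS]mulr1; apply: ler_wpM2l.
  by rewrite mulrA; apply: ler_wpM2r => //; exact: ltW.
(* As in the lower bound, a + 2 <= 2 t in the second case. *)
have [sb|sb] := leP (a + 1) (2 * (b + 1)).
  (* At this radius the tail relative to the main term is at most exp (- 30 L s + 10 (a + 2)). Since
     s >= a + 2 and L >= 1 / 2, this is at most exp (- L) <= t. *)
  have r0 : 0 < M * expR (15 * L) by rewrite mulr_gt0 ?expR_gt0.
  have := Ncmp _ r0; clear Ncmp Na.
  rewrite !powR_expR // lnM ?posrE ?expR_gt0 // expRK -/lM mulrA -expRD.
  have -> : 2 * m * lM + - (2 * s) * (lM + 15 * L) = 2 * (a + 1) * lM - 30 * L * s by rewrite /s; ring.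
  have -> : 2 * (a - b) * (lM + 15 * L) = 2 * (a - b) * lM + 30 * (a - b) * L by ring.
  set c := expR (2 * (a + 1) * lM - 30 * L * s) / s => h.
  have c0 : 0 <= c by rewrite divr_ge0 ?expR_ge0 // ltW.
  have cY : c <= expR (2 * (a - b) * lM) * t * Y.
    apply: Yle => //.
    have -> : c * ((b + 1) * e1) = expR (2 * (a - b) * lM) * (expR (- (30 * L * s) + 10 * (a + 2)) * ((b + 1) / s)).
      rewrite /c /e1; have -> : expR (2 * (a + 1) * lM - 30 * L * s) / s * ((b + 1) * expR (10 * (a + 2) - 2 * (b + 1) * lM)) =
        expR (2 * (a + 1) * lM - 30 * L * s) * expR (10 * (a + 2) - 2 * (b + 1) * lM) * ((b + 1) / s) by ring.
      by rewrite -expRD [RHS]mulrA -expRD; congr (expR _ * _); ring.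
    apply: ler_wpM2l; first exact: expR_ge0.
    apply: le_trans eLt; rewrite -[leRHS]mulr1; apply: ler_pM; rewrite ?expR_ge0 //.
    - by rewrite divr_ge0 // ltW.
    - by rewrite ler_expR; nra.
    - by rewrite ler_pdivrMr // mul1r; lra.
  apply: (le_trans h); apply: le_trans (lerD (lexx _) cY) _; rewrite -mulrDl; apply: ler_wpM2r; first exact: ltW.
  rewrite (expRD (2 * (a - b) * lM)) -mulrDr.
  (* The comparison of norms does not produce the factor (b + 1) / (a + 1) = 1 - q; as q <= 1 / 2,
     one has 1 - q >= 1 / (1 + 2 q) >= exp (- 2 q), which the error term absorbs. *)
  have BA : expR (- (2 * t)) <= (b + 1) / (a + 1).
    have E : (b + 1) / (a + 1) = 1 - (a - b) / (a + 1) by field; rewrite gt_eqF.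
    set q := (a - b) / (a + 1) in E st.
    have q0 : 0 <= q by rewrite divr_ge0 //; lra.
    have q2 : q <= 1 / 2 by rewrite /q ler_pdivrMr //; lra.
    have q3 := expR_ge1Dx (2 * q).
    rewrite E expRN -[leRHS]invrK lef_pV2 ?posrE ?invr_gt0 ?expR_gt0 //; last by lra.
    apply: le_trans (_ : expR (2 * q) <= _); last by rewrite ler_expR; lra.
    by apply: le_trans q3; rewrite -div1r ler_pdivrMr; nra.
  have dtL : 30 * (a - b) * L <= 30 * (t * L).
    rewrite -mulrA; apply: ler_wpM2l => //; apply: ler_wpM2r => //; lra.
  have i1 : expR (30 * (a - b) * L) + t <= expR (30 * (t * L) + t).
    rewrite expRD; have := expR_ge1Dx t; have : expR (30 * (a - b) * L) <= expR (30 * (t * L)) by rewrite ler_expR.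
    have : 1 <= expR (30 * (t * L)) by rewrite -[leLHS]expR0 ler_expR; lra.
    nra.
  apply: le_trans (_ : expR (2 * (a - b) * l + 8 * t) * expR (30 * (t * L) + t) <= _).
    by apply: ler_pM; rewrite ?expR_ge0 ?ler_expR // addr_ge0 ?expR_ge0 // ltW.
  rewrite expRD -mulrA -[leRHS]mulrA; apply: ler_wpM2l; first exact: expR_ge0.
  apply: le_trans (_ : expR (- (2 * t)) * expR (60 * (t * L)) <= _); last by apply: ler_wpM2r; rewrite ?expR_ge0.
  by rewrite -!expRD ler_expR; lra.
clear Ncmp; apply: (le_trans Na); clear Na; rewrite MlM; apply: Yle.
  by rewrite mulr_ge0 ?expR_ge0 // addr_ge0 // divr_ge0 // ltW.
have at2 : a + 2 <= 2 * t.
  have -> : t = (a - b) / (a + 1) * (a + 2) by rewrite /t /error_scale; ring.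
  have : 1 / 2 <= (a - b) / (a + 1) by rewrite ler_pdivlMr //; lra.
  by move=> h; have := ler_wpM2r (ltW a2) h; lra.
have is1 : 1 / (a + 1) + 1 / s <= 2 / (a + 1).
  have : 1 / s <= 1 / (a + 1) by rewrite !div1r lef_pV2 ?posrE //; lra.
  have -> : 2 / (a + 1) = 1 / (a + 1) + 1 / (a + 1) by field; rewrite gt_eqF.
  lra.
apply: le_trans (_ : expR (2 * (a + 1) * lM) * (2 / (a + 1)) * ((b + 1) * e1) <= _).
  apply: ler_wpM2r; first by rewrite mulr_ge0 ?expR_ge0 // ltW.
  by apply: ler_wpM2l; rewrite ?expR_ge0.
have -> : expR (2 * (a + 1) * lM) * (2 / (a + 1)) * ((b + 1) * e1) =
  2 * (expR (2 * (a + 1) * lM) * e1) * ((b + 1) / (a + 1)) by ring.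
rewrite [leRHS]mulrAC; apply: ler_wpM2r; first by rewrite divr_ge0 // ltW.
(* The exponent exceeds 2 (a - b) l by at most 2 t + 8 t + 20 t = 30 t <= 60 t L: here the constant
   60 is attained. *)
rewrite /e1 -!expRD; apply: le_trans (_ : expR 1 * expR (2 * (a + 1) * lM + (10 * (a + 2) - 2 * (b + 1) * lM)) <= _).
  by apply: ler_wpM2r; [exact: expR_ge0|have := expR_ge1Dx (1 : R); lra].
rewrite -/l; by rewrite -expRD ler_expR; lra.
Qed.

End TestFunctionNorms.

Section RatioUpper.
Context {R : realType}.
Notation mu := (@lebesgue_measure R).

Lemma ratio_upper (a b : R) : -1 < b -> b < a -> exists f : R[i]^o -> R[i]^o,
  [/\ f <> (fun=> 0), in_H11 a f &
   (weighted_sqnorm a f / weighted_sqnorm b f <=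
    (expR (2 * (a - b) * ln (a + 2) + ln ((b + 1) / (a + 1)) + 60 * (error_scale a b * error_log a b)))%:E)%E].
Proof.
move=> b1 ba.
have a1 : 0 < a + 1 by lra.
have b10 : 0 < b + 1 by lra.
have a2 : 0 < a + 2 by lra.
have a11 : -1 < a by lra.
(* Large enough for the tail exponent s = m - (a + 1) to be at least a + 2, small enough for 4^m to
   remain exp (O (a + 2)). *)
pose m := (Num.truncn (2 * (a + 2))).+1.
have [m1 m2] : 2 * (a + 2) < m%:R /\ m%:R <= 3 * (a + 2).
  have /Num.Theory.truncn_itv/andP[h1 h2] : 0 <= 2 * (a + 2) by lra.
  by split => //; rewrite /m -natr1; lra.
have [f [hf f0 [ft1 ft2] Hf]] := @test_function R m (ltn0Sn _).
pose M := 2 * m%:R : R.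
have M0 : 0 < M by rewrite /M; lra.
have f_le1 x : normc (f x%:C) <= 1 by have [] := Hf x.
have f_decay x : normc (f x%:C) * `|x| ^+ m <= M ^+ m by have [] := Hf x.
have f_ge x : `|x| <= M / 4 -> (1 / 2) ^+ m <= normc (f x%:C).
  by have [_ _ h] := Hf x; move=> xM; apply: h; rewrite /M in xM; lra.
pose s : R := m%:R - (a + 1).
have s0 : a + 2 <= s by rewrite /s; lra.
have am : a + 1 < m%:R by lra.
have Na := sqnorm_upper hf M0 f_le1 f_decay a11 am.
have fin_a : (weighted_sqnorm a f < +oo)%E by apply: le_lt_trans Na (ltry _).
have fH : in_H11 a f by split; [exact: holo_entire|right|].
have [_ Hexp [N N0 HN]] := in_H11_sqnorm a11 f0 fH.
have Nb_low := sqnorm_lower hf M0 f_ge b1.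
have fin_b : weighted_sqnorm b f \is a fin_num.
  have b1' : b + 1 < m%:R by lra.
  rewrite (ge0_fin_numE (weighted_sqnorm_ge0 b f)).
  exact: le_lt_trans (sqnorm_upper hf M0 f_le1 f_decay b1 b1') (ltry _).
have [Y HY] : exists Y, weighted_sqnorm b f = Y%:E by exists (fine (weighted_sqnorm b f)); rewrite fineK.
exists f; split => //.
rewrite HY lee_fin in Nb_low; rewrite HN lee_fin -/s in Na.
have Ncmp r : 0 < r -> N <= r `^ (2 * (a - b)) * Y + M `^ (2 * m%:R) * (r `^ (- (2 * s)) / s).
  by move=> r0; have := sqnorm_compare hf M0 f_le1 f_decay b1 (ltW ba) am r0 HY; rewrite HN lee_fin.
have Y0 : 0 < Y.
  apply: lt_le_trans Nb_low; rewrite mulr_gt0 ?exprn_gt0 //.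
  by rewrite !divr_gt0 ?powR_gt0 ?divr_gt0.
rewrite HN HY inver gt_eqF // -EFinM lee_fin ler_pdivrMr //.
rewrite !expRD lnK ?posrE ?divr_gt0 //.
apply: (@upper_numeric R a b m%:R) => //.
apply: le_trans Nb_low; rewrite le_eqVlt; apply/orP; left; apply/eqP; congr (_ * _).
by rewrite expRN expRM_natr lnK ?posrE // mul1r exprVn.
Qed.

End RatioUpper.

(** * The extremal constant *)

Section ExtremalConstant.
Context {R : realType}.

Lemma EP1_diag (a : R) : -1 < a -> EP1 a a = 1%:E.
Proof.
move=> a1.
have ratio1 (f : R[i]^o -> R[i]^o) : f <> (fun=> 0) -> in_H11 a f -> (weighted_sqnorm a f / weighted_sqnorm a f)%E = 1%:E.
  move=> f0 fH; have [_ _ [N N0 ->]] := in_H11_sqnorm a1 f0 fH.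
  by rewrite inver gt_eqF // -EFinM divff // gt_eqF.
(* The infimum is 1 only if the space contains a nonzero function; [ratio_upper] provides one for
   any smaller exponent, here the midpoint of -1 and [a]. *)
have b1 : -1 < (a - 1) / 2 by lra.
have ba : (a - 1) / 2 < a by lra.
have [f [f0 fH _]] := ratio_upper b1 ba.
apply/eqP; rewrite eq_le; apply/andP; split.
  by apply: ereal_inf_lbound; exists f; [split|exact: ratio1].
by apply: le_ereal_inf_tmp => _ [g [g0 gH] <-]; rewrite ratio1.
Qed.

Lemma EP1_bounds (a b : R) : -1 < b -> b < a ->
  let X := 2 * (a - b) * ln (a + 2) + ln ((b + 1) / (a + 1)) in
  let E := error_scale a b * error_log a b in
  exists2 v : R, EP1 a b = v%:E & expR (X - 250 * E) <= v <= expR (X + 60 * E).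
Proof.
move=> b1 ba X E.
have lo : ((expR (X - 250 * E))%:E <= EP1 a b)%E.
  by apply: le_ereal_inf_tmp => _ [g [g0 gH] <-]; exact: ratio_lower.
have hi : (EP1 a b <= (expR (X + 60 * E))%:E)%E.
  have [f [f0 fH fr]] := ratio_upper b1 ba; apply: le_trans fr.
  by apply: ereal_inf_lbound; exists f.
have fin : EP1 a b \is a fin_num.
  by rewrite fin_numElt (lt_le_trans _ lo) ?ltNyr // (le_lt_trans hi) // ltry.
exists (fine (EP1 a b)); first by rewrite fineK.
by rewrite -!lee_fin fineK // lo hi.
Qed.
End ExtremalConstant.

(* For alpha = beta the factor alpha - beta makes the error term 0, whatever the
   value of the logarithm (inversion and ln are total). *)
Theorem theorem5 (R : realType) :
  exists C : R, forall alpha beta : R, -1 < beta -> beta <= alpha ->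
    (`| lne (EP1 alpha beta)
        - (2 * (alpha - beta) * ln (alpha + 2)
           + ln ((beta + 1) / (alpha + 1)))%:E |
     <= (C * ((alpha - beta) * (alpha + 2) / (alpha + 1)
              * ln (2 * (alpha + 1) * (alpha - beta + 1)
                    / ((alpha - beta) * (alpha + 2)))))%:E)%E.
Proof.
exists 250 => a b b1; rewrite le_eqVlt => /orP[/eqP <-|ba].
  have b0 : b + 1 != 0 by rewrite gt_eqF //; lra.
  rewrite EP1_diag // lne1 subrr mulr0 !mul0r mulr0 divff // ln1 addr0.
  by rewrite sube0 abse0.
have [v vE /andP[lo hi]] := EP1_bounds b1 ba.
have [_ E0] := error_scale_le_error b1 ba.
have v0 : 0 < v by apply: lt_le_trans lo; exact: expR_gt0.
rewrite vE lne_EFin // -EFinB lee_fin.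
rewrite -/(error_scale a b) -/(error_log a b).
set E := error_scale a b * error_log a b in lo hi E0 *.
set X := 2 * (a - b) * ln (a + 2) + _ in lo hi *.
have lo' : X - 250 * E <= ln v by rewrite -[leLHS]expRK ler_ln ?posrE ?expR_gt0.
have hi' : ln v <= X + 60 * E by rewrite -[leRHS]expRK ler_ln ?posrE ?expR_gt0.
by rewrite ler_norml; apply/andP; lra.
Qed.
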